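(* Let $a,b>0$, $\alpha\in(0,3)$ and $p>2$. Let $h:\mathbb{Z}^3\to\mathbb{R}$ satisfy: (1) there exists $h_0>0$ with $h(x)\ge h_0$ for all $x\in\mathbb{Z}^3$; (2) $h$ is $\tau$-periodic in $x\in\mathbb{Z}^3$ for some $\tau\in\mathbb{Z}$ (i.e. $h(x+\tau e_j)=h(x)$ for every coordinate direction $e_j$). Then the equation $$-\Big(a+b\int_{\mathbb{Z}^3}|\nabla u|^2\,d\mu\Big)\Delta u+h(x)u=(R_\alpha\ast|u|^p)|u|^{p-2}u,\quad x\in\mathbb{Z}^3,$$ has a ground state solution, i.e. there is $u\in H$ with $J'(u)=0$ and $J(u)=c=\inf_{v\in\mathcal{N}}J(v)$.
   Context: $\mathbb{Z}^3$ is the integer lattice graph: $x\sim y$ iff $\sum_{i=1}^3|x_i-y_i|=1$; $\mu$ is counting measure, so $\int_{\mathbb{Z}^3}f\,d\mu=\sum_{x}f(x)$. For $u:\mathbb{Z}^3\to\mathbb{R}$, $\Delta u(x)=\sum_{y\sim x}(u(y)-u(x))$, $|\nabla u|(x)=\big(\tfrac12\sum_{y\sim x}(u(y)-u(x))^2\big)^{1/2}$, and $\int\nabla u\nabla v\,d\mu=\sum_x\tfrac12\sum_{y\sim x}(u(y)-u(x))(v(y)-v(x))$. $R_\alpha$ is the Green's function of the discrete fractional Laplacian: $R_\alpha(x,y)=\frac{K_\alpha}{(2\pi)^3}\int_{\mathbb{T}^3}e^{i(x-y)\cdot k}\mu(k)^{-\alpha/2}\,dk$, with $K_\alpha=\frac{1}{(2\pi)^3}\int_{\mathbb{T}^3}\mu(k)^{\alpha/2}dk$,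 $\mu(k)=6-2\sum_{j=1}^3\cos k_j$, $\mathbb{T}^3=[0,2\pi]^3$, and $(R_\alpha\ast f)(x)=\sum_y R_\alpha(x,y)f(y)$. $H^1(\mathbb{Z}^3)$ is the completion of finitely supported functions under $\|u\|_{H^1}^2=\sum(|\nabla u|^2+u^2)$; $H=\{u\in H^1(\mathbb{Z}^3):\sum h u^2<\infty\}$ with norm $\|u\|^2=\sum_x(a|\nabla u|^2+h(x)u^2)$. The energy functional is $J(u)=\frac12\|u\|^2+\frac b4\big(\int|\nabla u|^2d\mu\big)^2-\frac1{2p}\int(R_\alpha\ast|u|^p)|u|^p\,d\mu$ on $H$, with $(J'(u),\phi)=\int(a\nabla u\nabla\phi+hu\phi)d\mu+b\int|\nabla u|^2d\mu\int\nabla u\nabla\phi\,d\mu-\int(R_\alpha\ast|u|^p)|u|^{p-2}u\phi\,d\mu$. The Nehari manifold is $\mathcal{N}=\{u\in H\setminus\{0\}:(J'(u),u)=0\}$. *)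

(* Defs.v *)
From HB Require Import structures.
From mathcomp Require Import all_boot all_order all_algebra.
From mathcomp Require Import all_classical all_reals all_analysis.
Set Implicit Arguments. Unset Strict Implicit. Unset Printing Implicit Defensive.
Import Order.TTheory GRing.Theory Num.Theory.
Import numFieldNormedType.Exports.
Local Open Scope classical_set_scope.
Local Open Scope ring_scope.

Definition Z3 := (int * int * int)%type.

Definition Zcoord (x : Z3) (j : 'I_3) : int :=
  match val j with 0%N => x.1.1 | 1%N => x.1.2 | _ => x.2 end.

Definition Zshift (x : Z3) (j : 'I_3) (t : int) : Z3 :=
  match val j with
  | 0%N => (x.1.1 + t, x.1.2, x.2)
  | 1%N => (x.1.1, x.1.2 + t, x.2)
  | _ => (x.1.1, x.1.2, x.2 + t)
  end.

Definition nbrs (x : Z3) : seq Z3 :=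
  [seq Zshift x j 1 | j <- enum 'I_3] ++ [seq Zshift x j (-1) | j <- enum 'I_3].

Section Lattice.
Variable R : realType.

(* Sums over Z^3 w.r.t. counting measure (integral = sum of positive part
   minus sum of negative part; meaningful when zsummable). *)
Definition zsummable (f : Z3 -> R) : Prop :=
  (\esum_(x in [set: Z3]) (`|f x|)%:E < +oo)%E.

Definition zsum (f : Z3 -> R) : R :=
  fine (\esum_(x in [set: Z3]) (Num.max (f x) 0)%:E)
  - fine (\esum_(x in [set: Z3]) (Num.max (- f x) 0)%:E).

Definition Lap (u : Z3 -> R) (x : Z3) : R := \sum_(y <- nbrs x) (u y - u x).

Definition gradsq (u : Z3 -> R) (x : Z3) : R :=
  2^-1 * \sum_(y <- nbrs x) (u y - u x) ^+ 2.

Definition gradprod (u v : Z3 -> R) (x : Z3) : R :=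
  2^-1 * \sum_(y <- nbrs x) (u y - u x) * (v y - v x).

(* H^1: completion of finitely supported functions under the H^1 norm,
   realised concretely as the functions of finite H^1 norm that are
   H^1-limits of finitely supported functions. *)
Definition H1sq (u : Z3 -> R) : R := zsum (fun x => gradsq u x + u x ^+ 2).

Definition inH1 (u : Z3 -> R) : Prop :=
  zsummable (fun x => gradsq u x + u x ^+ 2) /\
  exists un : nat -> Z3 -> R,
    (forall n, finite_set [set x | un n x != 0]) /\
    (fun n => H1sq (fun x => un n x - u x)) @ \oo --> (0 : R).

Definition inH (h : Z3 -> R) (u : Z3 -> R) : Prop :=
  inH1 u /\ zsummable (fun x => h x * u x ^+ 2).

Definition Hnormsq (a : R) (h : Z3 -> R) (u : Z3 -> R) : R :=
  zsum (fun x => a * gradsq u x + h x * u x ^+ 2).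

Definition leb3 := ((@lebesgue_measure R \x @lebesgue_measure R) \x
                     @lebesgue_measure R)%E.

Definition T3 : set (R * R * R) :=
  [set k | k.1.1 \in `[0, 2 * pi] /\ k.1.2 \in `[0, 2 * pi] /\ k.2 \in `[0, 2 * pi]].

Definition symb (k : R * R * R) : R := 6 - 2 * (cos k.1.1 + cos k.1.2 + cos k.2).

Definition Kalpha (alpha : R) : R :=
  (2 * pi) ^- 3 * fine (\int[leb3]_(k in T3) (symb k `^ (alpha / 2))%:E)%E.

(* R_alpha(x,y): the integrand e^{i(x-y).k} mu(k)^{-alpha/2} has vanishing
   imaginary part (odd under k -> -k), so R_alpha is its real (cosine) part. *)
Definition Ralpha (alpha : R) (x y : Z3) : R :=
  Kalpha alpha / (2 * pi) ^+ 3 *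
  fine (\int[leb3]_(k in T3)
          (cos ((Zcoord x 0 - Zcoord y 0)%:~R * k.1.1
              + (Zcoord x 1 - Zcoord y 1)%:~R * k.1.2
              + (Zcoord x 2 - Zcoord y 2)%:~R * k.2)
           * symb k `^ (- (alpha / 2)))%:E)%E.

Definition Rconv (alpha : R) (f : Z3 -> R) (x : Z3) : R :=
  zsum (fun y => Ralpha alpha x y * f y).

Definition Jfun (a b alpha p : R) (h : Z3 -> R) (u : Z3 -> R) : R :=
  2^-1 * Hnormsq a h u + b / 4 * (zsum (gradsq u)) ^+ 2
  - (2 * p)^-1 * zsum (fun x => Rconv alpha (fun y => `|u y| `^ p) x * `|u x| `^ p).

Definition dJ (a b alpha p : R) (h : Z3 -> R) (u phi : Z3 -> R) : R :=
  zsum (fun x => a * gradprod u phi x + h x * u x * phi x)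
  + b * zsum (gradsq u) * zsum (gradprod u phi)
  - zsum (fun x => Rconv alpha (fun y => `|u y| `^ p) x
                   * `|u x| `^ (p - 2) * u x * phi x).

Definition Nehari (a b alpha p : R) (h : Z3 -> R) : set (Z3 -> R) :=
  [set u | inH h u /\ u <> (fun _ => 0) /\ dJ a b alpha p h u u = 0].

End Lattice.

(* Main.v *)
Require Import Defs.
From HB Require Import structures.
From mathcomp Require Import all_boot all_order all_algebra.
From mathcomp Require Import all_classical all_reals all_analysis.
From mathcomp Require Import measurable_realfun.
From mathcomp Require Import ring lra.

(* For f >= 0 summable write D(f) for the double sum of R_alpha(x,y) f(x) f(y).
   Only four facts about R_alpha are used: it is bounded, translation
   invariant, positive semidefinite (as the Fourier transform of the positive
   weight symb^(-alpha/2)), and it tends to 0 at infinity.  The weight is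
   integrable since symb dominates each 2 (1 - cos k_j), so that it is bounded
   by a product of three functions of one variable with integrable
   singularities; decay follows by truncating the weight and applying Bessel's
   inequality to the bounded part.

   As h is periodic and positive, H is l^2.  A minimizing sequence on the
   Nehari manifold is bounded and cannot vanish uniformly, hence after a
   translation by a multiple of tau it has a nonzero pointwise limit u along an
   ultrafilter.  Moving u_n along the delta function at a site and rescaling
   back to the manifold cannot lower the energy below the infimum; since this
   one-site variation changes all energies by explicit scalars, it passes to the
   limit and shows that u solves the equation with A = lim |grad u_n|^2 in place
   of |grad u|^2 <= A.  Testing with u gives (J'(u), u) <= 0, so t u lies on the
   manifold for some t <= 1, and Fatou's lemma (with positive semidefiniteness
   for the nonlocal term) bounds J(t u) by the infimum; hence t = 1 and
   A = |grad u|^2. *)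

Set Implicit Arguments. Unset Strict Implicit. Unset Printing Implicit Defensive.
Import Order.TTheory GRing.Theory Num.Theory.
Import numFieldNormedType.Exports.
Local Open Scope classical_set_scope.
Local Open Scope ring_scope.

(** * Sums over the lattice *)

(** The obstacle is loss of mass in the pointwise limit: a priori [EG u] may be smaller than the
    limit [A] of the gradient energies, so the limit equation carries a coefficient that need not be
    the one of [u]. What closes the gap is that on the manifold [J] equals [N / 4 + kap * D] with
    [kap = 1/4 - 1/(2p)], positive because p > 2. The quartic gradient term is thereby eliminated,
    and the two terms left are lower semicontinuous and do not grow when a function is scaled down.

    The same inequality 2p > 4 puts the maximum of the energy on a ray at its Nehari point. This
    replaces Lagrange multipliers and any differentiability of [J] on H: the energies of the varied
    and of the unvaried function are compared at one and the same scaling factor, so that the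
    dependence of this factor on the size of the variation never has to be differentiated.

    Along an ultrafilter all energies and all point values converge simultaneously, so a single
    limit process serves for every bounded scalar, including the scaling factors of the varied
    functions. *)

Section Sums.
Variable R : realType.
Implicit Types (f g : Z3 -> R).

(* The first [n] points in the fixed enumeration of the countable type Z^3 (not a metric ball). *)
Definition zball (n : nat) : seq Z3 := pmap (@pickle_inv Z3) (iota 0 n).

Definition psum f (n : nat) : R := \sum_(x <- zball n) f x.

Lemma mem_zball (n : nat) (x : Z3) : (x \in zball n) = (pickle x < n)%N.
Proof.
rewrite mem_pmap; apply/mapP/idP => [[k]|xn].
  rewrite mem_iota add0n /= => kn xk.
  by have := @pickle_invK Z3 k; rewrite -xk /= => ->.
by exists (pickle x); rewrite ?mem_iota ?pickleK_inv.
Qed.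

Lemma zball_uniq (n : nat) : uniq (zball n).
Proof. by rewrite (pmap_uniq (@pickle_invK Z3)) ?iota_uniq. Qed.

Lemma sub_zball (s : seq Z3) : exists n, {subset s <= zball n}.
Proof.
exists (\max_(x <- s) (pickle x).+1) => x xs; rewrite mem_zball.
by rewrite (big_rem x) //= leq_max ltnSn.
Qed.

Lemma zball_leq (m n : nat) : (m <= n)%N -> {subset zball m <= zball n}.
Proof. by move=> mn x; rewrite !mem_zball => /leq_trans; apply. Qed.

Lemma ler_sum_subset (s t : seq Z3) f :
  uniq s -> uniq t -> {subset s <= t} -> (forall x, x \in t -> 0 <= f x) ->
  \sum_(x <- s) f x <= \sum_(x <- t) f x.
Proof.
move=> us ut st f0; rewrite [leRHS](bigID (mem s)) /=.
have -> : \sum_(x <- t | x \in s) f x = \sum_(x <- s) f x.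
  rewrite -big_filter; apply: perm_big; apply: uniq_perm => //.
    exact: filter_uniq.
  by move=> x; rewrite mem_filter; case: (boolP (x \in s)) => //= /st ->.
rewrite lerDl big_seq_cond sumr_ge0// => x /andP[xt _]; exact: f0.
Qed.

Lemma psum_le f g n : (forall x, f x <= g x) -> psum f n <= psum g n.
Proof. by move=> fg; exact: ler_sum. Qed.

Lemma psumD f g n : psum (fun x => f x + g x) n = psum f n + psum g n.
Proof. exact: big_split. Qed.

Lemma psumZ c f n : psum (fun x => c * f x) n = c * psum f n.
Proof. by rewrite /psum mulr_sumr. Qed.

Lemma psum_nd f : (forall x, 0 <= f x) -> nondecreasing_seq (psum f).
Proof.
move=> f0 m n mn; apply: ler_sum_subset; rewrite ?zball_uniq//.
exact: zball_leq.
Qed.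

Lemma esum_le_psum f (M : R) : (forall x, 0 <= f x) -> (forall n, psum f n <= M) ->
  (\esum_(x in [set: Z3]) (f x)%:E <= M%:E)%E.
Proof.
move=> f0 fM; apply: ub_ereal_sup => _ [A [finA _] <-].
rewrite fsbig_finite//= sumEFin lee_fin.
have [n An] := sub_zball (finmap.enum_fset (fset_set A)).
apply: le_trans (fM n); apply: ler_sum_subset => //.
  exact: finmap.fset_uniq.
exact: zball_uniq.
Qed.

Lemma psum_le_esum f n : (forall x, 0 <= f x) ->
  ((psum f n)%:E <= \esum_(x in [set: Z3]) (f x)%:E)%E.
Proof.
move=> f0; apply: esum_ge; exists [set` zball n].
  by split => //; exact: finite_seq.
rewrite fsbig_seq ?zball_uniq//= /psum -sumEFin.
by rewrite -fsbig_seq ?zball_uniq// -?fsbig_seq ?zball_uniq.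
Qed.

Lemma zsummableP f : zsummable f <-> exists M, forall n, psum (fun x => `|f x|) n <= M.
Proof.
split=> [fs|[M fM]]; last first.
  by rewrite /zsummable (le_lt_trans (esum_le_psum _ fM)) ?ltry.
exists (fine (\esum_(x in [set: Z3]) (`|f x|)%:E)) => n.
rewrite -lee_fin fineK ?psum_le_esum// ge0_fin_numE//.
by apply: esum_ge0 => x _; rewrite lee_fin.
Qed.

Lemma psum_cvg_fine f : (forall x, 0 <= f x) -> zsummable f ->
  psum f @ \oo --> fine (\esum_(x in [set: Z3]) (f x)%:E).
Proof.
move=> f0 /zsummableP[M fM].
have {}fM n : psum f n <= M.
  by apply: le_trans (fM n); apply: psum_le => x; exact: ler_norm.
have cf : cvgn (psum f) := nondecreasing_is_cvgn (psum_nd f0) (ex_intro _ M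
  (fun _ '(ex_intro2 n _ e) => eq_ind _ (fun z => z <= M) (fM n) _ e)).
suff -> : fine (\esum_(x in [set: Z3]) (f x)%:E) = limn (psum f) by [].
have lf n : psum f n <= limn (psum f) by apply: nondecreasing_cvgn_le => //; exact: psum_nd.
have fin : (\esum_(x in [set: Z3]) (f x)%:E \is a fin_num)%E.
  rewrite ge0_fin_numE ?(le_lt_trans (esum_le_psum f0 lf)) ?ltry//.
  by apply: esum_ge0 => x _; rewrite lee_fin.
apply/eqP; rewrite eq_le; apply/andP; split.
  by rewrite -lee_fin fineK// esum_le_psum.
by apply: limr_le => //; apply: nearW => n; rewrite -lee_fin fineK// psum_le_esum.
Qed.

Lemma zsummable_norm_le f g : zsummable g -> (forall x, `|f x| <= `|g x|) -> zsummable f.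
Proof.
move=> /zsummableP[M gM] fg; apply/zsummableP; exists M => n.
by apply: le_trans (gM n); apply: psum_le => x; exact: fg.
Qed.

Lemma zsummable_le f g : zsummable g -> (forall x, `|f x| <= g x) -> zsummable f.
Proof.
move=> gs fg; apply: zsummable_norm_le gs _ => x; rewrite (le_trans (fg x))//.
exact: ler_norm.
Qed.

Lemma zsummable_abs f : zsummable f -> zsummable (fun x => `|f x|).
Proof. by move=> fs; apply: zsummable_norm_le fs _ => x; rewrite normr_id. Qed.

(** The bridge from the definition by positive and negative parts to limits of finite sums;
    linearity, monotonicity and uniqueness of [zsum] all follow from it. *)
Lemma psum_cvg f : zsummable f -> psum f @ \oo --> zsum f.
Proof.
move=> fs.
have p0 x : 0 <= Num.max (f x) 0 by rewrite le_max lexx orbT.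
have m0 x : 0 <= Num.max (- f x) 0 by rewrite le_max lexx orbT.
have pl x : `|Num.max (f x) 0| <= `|f x|.
  by rewrite ger0_norm// ge_max ler_norm normr_ge0.
have ml x : `|Num.max (- f x) 0| <= `|f x|.
  by rewrite ger0_norm// ge_max -normrN ler_norm normr_ge0.
have fa := zsummable_abs fs.
have -> : psum f = (fun n => psum (fun x => Num.max (f x) 0) n
     - psum (fun x => Num.max (- f x) 0) n).
  apply/funext => n; rewrite /psum -sumrB; apply: eq_bigr => x _.
  by rewrite !maxEle; case: ifPn => h1; case: ifPn => h2; lra.
by apply: cvgB; apply: psum_cvg_fine => //; apply: zsummable_le fa _.
Qed.

Lemma eq_zsum f g : f =1 g -> zsum f = zsum g.
Proof. by move=> /funext ->. Qed.

Lemma zsummable0 : zsummable (fun=> 0 : R).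
Proof.
by apply/zsummableP; exists 0 => n; rewrite /psum big1// => x _; rewrite normr0.
Qed.

Lemma zsummableD f g : zsummable f -> zsummable g -> zsummable (fun x => f x + g x).
Proof.
move=> /zsummableP[M fM] /zsummableP[N gN]; apply/zsummableP; exists (M + N) => n.
apply: le_trans (lerD (fM n) (gN n)); rewrite -psumD; apply: psum_le => x.
exact: ler_normD.
Qed.

Lemma zsummableZ c f : zsummable f -> zsummable (fun x => c * f x).
Proof.
move=> /zsummableP[M fM]; apply/zsummableP; exists (`|c| * M) => n.
apply: le_trans (ler_wpM2l (normr_ge0 c) (fM n)); rewrite -psumZ; apply: psum_le => x.
by rewrite normrM.
Qed.

Lemma zsummableN f : zsummable f -> zsummable (fun x => - f x).
Proof. by move=> fs; apply: zsummable_norm_le fs _ => x; rewrite normrN. Qed.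

Lemma zsummableB f g : zsummable f -> zsummable g -> zsummable (fun x => f x - g x).
Proof. by move=> fs gs; apply: zsummableD => //; exact: zsummableN. Qed.

Lemma zsum_unique f l : zsummable f -> psum f @ \oo --> l -> zsum f = l.
Proof.
by move=> /psum_cvg fs fl; rewrite -(cvg_lim _ fs)// -(cvg_lim _ fl).
Qed.

Lemma zsumD f g : zsummable f -> zsummable g ->
  zsum (fun x => f x + g x) = zsum f + zsum g.
Proof.
move=> fs gs; apply: zsum_unique; first exact: zsummableD.
rewrite (_ : psum _ = (fun n => psum f n + psum g n)); last first.
  by apply/funext => n; rewrite psumD.
by apply: cvgD; exact: psum_cvg.
Qed.

Lemma zsumZ c f : zsummable f -> zsum (fun x => c * f x) = c * zsum f.
Proof.
move=> fs; apply: zsum_unique; first exact: zsummableZ.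
rewrite (_ : psum _ = (fun n => c * psum f n)); last first.
  by apply/funext => n; rewrite psumZ.
by apply: cvgMr; exact: psum_cvg.
Qed.

Lemma zsumN f : zsummable f -> zsum (fun x => - f x) = - zsum f.
Proof.
by move=> fs; rewrite -mulN1r -zsumZ//; apply: eq_zsum => x; rewrite mulN1r.
Qed.

Lemma zsumB f g : zsummable f -> zsummable g ->
  zsum (fun x => f x - g x) = zsum f - zsum g.
Proof. by move=> fs gs; rewrite zsumD ?zsumN//; exact: zsummableN. Qed.

Lemma zsum_le_bound f M : zsummable f -> (forall n, psum f n <= M) -> zsum f <= M.
Proof.
move=> /psum_cvg fs fM; rewrite -(cvg_lim _ fs)//; apply: limr_le.
  by apply/cvg_ex; exists (zsum f).
exact: nearW.
Qed.

Lemma le_zsum f g : zsummable f -> zsummable g -> (forall x, f x <= g x) ->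
  zsum f <= zsum g.
Proof.
move=> fs gs fg; have cf := psum_cvg fs; have cg := psum_cvg gs.
rewrite -(cvg_lim _ cf)// -(cvg_lim _ cg)//; apply: ler_lim.
- by apply/cvg_ex; exists (zsum f).
- by apply/cvg_ex; exists (zsum g).
- by apply: nearW => n; exact: psum_le.
Qed.

Lemma zsum0 : zsum (fun=> 0 : R) = 0.
Proof.
apply: zsum_unique; first exact: zsummable0.
rewrite (_ : psum _ = fun=> 0); first exact: cvg_cst.
by apply/funext => n; rewrite /psum big1.
Qed.

Lemma zsum_ge0 f : zsummable f -> (forall x, 0 <= f x) -> 0 <= zsum f.
Proof. by move=> fs f0; rewrite -zsum0; apply: le_zsum => //; exact: zsummable0. Qed.

Lemma ler_norm_zsum f : zsummable f -> `|zsum f| <= zsum (fun x => `|f x|).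
Proof.
move=> fs; have fa := zsummable_abs fs; rewrite ler_norml lerNl -zsumN//.
apply/andP; split; apply: le_zsum => //; first exact: zsummableN.
- by move=> x; rewrite -normrN ler_norm.
- by move=> x; exact: ler_norm.
Qed.

Lemma psum_le_zsum f n : zsummable f -> (forall x, 0 <= f x) -> psum f n <= zsum f.
Proof.
move=> fs f0; have cf := psum_cvg fs; rewrite -(cvg_lim _ cf)//.
apply: nondecreasing_cvgn_le; first exact: psum_nd.
by apply/cvg_ex; exists (zsum f).
Qed.

Lemma sum_le_zsum (s : seq Z3) f : uniq s -> zsummable f -> (forall x, 0 <= f x) ->
  \sum_(x <- s) f x <= zsum f.
Proof.
move=> us fs f0; have [n sn] := sub_zball s.
by apply: le_trans (psum_le_zsum n fs f0); apply: ler_sum_subset => //; exact: zball_uniq.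
Qed.

Lemma le_zsum1 f z : zsummable f -> (forall x, 0 <= f x) -> f z <= zsum f.
Proof.
by move=> fs f0; have := @sum_le_zsum [:: z] f isT fs f0; rewrite big_seq1.
Qed.

Lemma zsummable1 f z : (forall x, x != z -> f x = 0) -> zsummable f.
Proof.
move=> fz; apply/zsummableP; exists `|f z| => n; rewrite /psum.
case: (boolP (z \in zball n)) => zn.
  rewrite (bigD1_seq z) ?zball_uniq//= big1 ?addr0// => x xz.
  by rewrite fz ?normr0.
rewrite big_seq big1// => x xn; rewrite fz ?normr0//.
by apply: contraNneq zn => <-.
Qed.

Lemma zsum1 f z : (forall x, x != z -> f x = 0) -> zsum f = f z.
Proof.
move=> fz; apply: zsum_unique; first exact: zsummable1 fz.
apply: cvg_near_cst; exists (pickle z).+1 => // n /= zn.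
have zb : z \in zball n by rewrite mem_zball.
by rewrite /psum (bigD1_seq z) ?zball_uniq//= big1 ?addr0// => x xz; rewrite fz.
Qed.

Lemma zsum_eq0 f : zsummable f -> (forall x, 0 <= f x) -> zsum f = 0 -> forall x, f x = 0.
Proof.
move=> fs f0 f00 x; apply/eqP; rewrite eq_le f0 andbT -f00; exact: le_zsum1.
Qed.

Lemma zsummable_reindex (s : Z3 -> Z3) f : bijective s -> zsummable f ->
  zsummable (fun x => f (s x)).
Proof.
move=> bs; rewrite /zsummable.
rewrite (@reindex_esum _ _ _ [set: Z3] [set: Z3] s)//.
by rewrite setTT_bijective.
Qed.

Lemma zsum_reindex (s : Z3 -> Z3) f : bijective s -> zsum (fun x => f (s x)) = zsum f.
Proof.
move=> bs; have bsT : set_bij [set: Z3] [set: Z3] s by rewrite setTT_bijective.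
rewrite /zsum; congr (fine _ - fine _); symmetry.
  exact: (@reindex_esum R _ _ _ _ s (fun y => (Num.max (f y) 0)%:E)).
exact: (@reindex_esum R _ _ _ _ s (fun y => (Num.max (- f y) 0)%:E)).
Qed.

(** The norms summed up to [n] are within [e] of their total, and any finite part of the tail fits
    in the difference. *)
Lemma zsum_tail f (e : R) : zsummable f -> 0 < e ->
  exists n, zsum (fun x => if x \in zball n then 0 else `|f x|) <= e.
Proof.
move=> fs e0; have fa := zsummable_abs fs.
have := psum_cvg fa => /cvgrPdist_le /(_ e e0) [n _ /(_ n)] /= h.
exists n; apply: le_trans (le_trans (ler_norm _) (h _)) => //.
have zs m : zsummable (fun x => if x \in zball m then 0 else `|f x|).
  by apply: zsummable_norm_le fs _ => x; case: ifP; rewrite ?normr0 ?normr_id.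
apply: zsum_le_bound => // m; rewrite lerBrDr.
(* A range containing both [zball m] and [zball n], so that the tail up to [m] and the head up to
   [n] add up inside one partial sum. *)
apply: le_trans (psum_le_zsum (maxn m n) fa _) => //.
have le1 : psum (fun x => if x \in zball n then 0 else `|f x|) m <=
    psum (fun x => if x \in zball n then 0 else `|f x|) (maxn m n).
  by apply: psum_nd; rewrite ?leq_maxl// => x; case: ifP.
apply: le_trans (lerD le1 (lexx _)) _.
have -> : psum (fun x => `|f x|) n =
    psum (fun x => if x \in zball n then `|f x| else 0) (maxn m n).
  rewrite /psum -big_mkcond /= -[RHS]big_filter; apply: perm_big; apply: uniq_perm.
  - exact: zball_uniq.
  - by rewrite filter_uniq// zball_uniq.
  - move=> x; rewrite mem_filter !mem_zball; case: ltnP => //= xn.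
    by rewrite (leq_trans xn)// leq_maxr.
by rewrite -psumD; apply: psum_le => x; case: ifP; rewrite ?add0r ?addr0.
Qed.

End Sums.

(** * The Green function of the fractional Laplacian *)

Section Singularity.
Variable R : realType.
Implicit Types k b g : R.

Lemma quarter_gt0 k : 0 < k < 2 * pi -> 0 < sin (k / 4) /\ 0 < cos (k / 4) :> R.
Proof.
move=> /andP[k0 k2]; have p0 := pi_gt0 R; split.
  by apply: sin_gt0_pihalf; apply/andP; split; lra.
by apply: cos_gt0_pihalf; apply/andP; split; lra.
Qed.

(** The left side vanishes at both ends of [0, 2 pi]. Quarter angles separate the two zeros: on this
    interval sin (k/4) vanishes only at 0 and cos (k/4) only at 2 pi. *)
Lemma cos_quarter k : 2 * (1 - cos k) = 16 * (sin (k / 4) * cos (k / 4)) ^+ 2.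
Proof.
have -> : k = ((k / 4) *+ 2) *+ 2 by rewrite -mulrnA; field.
set t := k / 4; rewrite !cos_mulr2n.
have -> : (t *+ 2 *+ 2) / 4 = t by rewrite -mulrnA; field.
have := cos2Dsin2 t; rewrite exprMn => e.
have -> : sin t ^+ 2 = 1 - cos t ^+ 2 by lra.
by ring.
Qed.

(** Each summand is singular at one end only and is a power of a function times its derivative up to
    a factor, whence the elementary primitive [edgeP]. *)
Definition edge b k : R :=
  sin (k / 4) `^ (- b) * cos (k / 4) + cos (k / 4) `^ (- b) * sin (k / 4).

Lemma edge_ge0 b k : 0 < k < 2 * pi -> 0 <= edge b k.
Proof.
move=> /quarter_gt0[s0 c0].
by rewrite addr_ge0// mulr_ge0 ?powR_ge0// ltW.
Qed.

(* Since s^2 + c^2 = 1 and 1 + b <= 2, s^(1+b) + c^(1+b) >= 1. *)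
Lemma edge_ge b k : 0 <= b <= 1 -> 0 < k < 2 * pi ->
  (2 * (1 - cos k)) `^ (- (b / 2)) <= edge b k.
Proof.
move=> /andP[b0 b1] kI; have [s0 c0] := quarter_gt0 kI.
rewrite cos_quarter /edge; set s := sin _ in s0 *; set c := cos _ in c0 *.
have s1 : s <= 1 := sin_le1 _. have c1 : c <= 1 := cos_le1 _.
have sc0 : 0 < s * c by exact: mulr_gt0.
have -> : - (b / 2) = 2^-1 * - b by field.
rewrite powRrM powR12_sqrt; last by rewrite mulr_ge0// sqr_ge0.
have -> : 16 * (s * c) ^+ 2 = (4 * (s * c)) ^+ 2 by ring.
rewrite sqrtr_sqr gtr0_norm; last by rewrite mulr_gt0.
apply: (@le_trans _ _ ((s * c) `^ (- b))).
  rewrite !powRN lef_pV2 ?posrE ?powR_gt0// ?mulr_gt0//.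
  by apply: ge0_ler_powR => //; rewrite ?nnegrE; lra.
have pw (x : R) : 0 < x <= 1 -> x ^+ 2 <= x `^ b * x.
  move=> /andP[x0 x1]; rewrite expr2 ler_pM2r//.
  by rewrite ger1_powR// x0 x1.
have hs := pw s (introT andP (conj s0 s1)); have hc := pw c (introT andP (conj c0 c1)).
have e := cos2Dsin2 (k / 4).
rewrite powRM; [|exact: ltW|exact: ltW]; rewrite !powRN.
have S0 : 0 < s `^ b by exact: powR_gt0.
have C0 : 0 < c `^ b by exact: powR_gt0.
have -> : (s `^ b)^-1 * c + (c `^ b)^-1 * s = (s `^ b)^-1 * (c `^ b)^-1 * (c `^ b * c + s `^ b * s).
  by field; rewrite !gt_eqF.
set A := (s `^ b)^-1 * _; have A0 : 0 <= A by rewrite mulr_ge0// invr_ge0 ltW.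
rewrite -[leLHS]mulr1 ler_wpM2l// -e.
by apply: lerD; [exact: hc|exact: hs].
Qed.

Definition edgeP b k : R :=
  4 / (1 - b) * (sin (k / 4) `^ (1 - b) - cos (k / 4) `^ (1 - b)).

Lemma edgeP_derive b k : b < 1 -> 0 < k < 2 * pi -> is_derive k 1 (edgeP b) (edge b k).
Proof.
move=> b1 kI; have [s0 c0] := quarter_gt0 kI.
rewrite /edgeP.
have d4 : is_derive k 1 (fun x : R => x / 4) (4^-1).
  have -> : (fun x : R => x / 4) = (id : R -> R) * cst (4^-1) by apply/funext.
  by apply: is_derive_eq; rewrite /GRing.scale /= mulr0 mulr1 add0r.
have ds : is_derive k 1 (fun x : R => sin (x / 4)) (cos (k / 4) * 4^-1).
  exact: (@is_derive1_comp R (@sin R) (fun x : R => x / 4)).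
have dc : is_derive k 1 (fun x : R => cos (x / 4)) (- sin (k / 4) * 4^-1).
  exact: (@is_derive1_comp R (@cos R) (fun x : R => x / 4)).
have dsp : is_derive k 1 (fun x : R => sin (x / 4) `^ (1 - b))
    ((1 - b) * sin (k / 4) `^ (1 - b - 1) * (cos (k / 4) * 4^-1)).
  apply: (@is_derive1_comp R (@powR R ^~ (1 - b)) (fun x : R => sin (x / 4))).
  exact: is_derive1_powR.
have dcp : is_derive k 1 (fun x : R => cos (x / 4) `^ (1 - b))
    ((1 - b) * cos (k / 4) `^ (1 - b - 1) * (- sin (k / 4) * 4^-1)).
  apply: (@is_derive1_comp R (@powR R ^~ (1 - b)) (fun x : R => cos (x / 4))).
  exact: is_derive1_powR.
have d := is_deriveZ (4 / (1 - b)) (is_deriveB dsp dcp).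
have -> : edge b k = 4 / (1 - b) *: ((1 - b) * sin (k / 4) `^ (1 - b - 1) * (cos (k / 4) * 4^-1)
    - (1 - b) * cos (k / 4) `^ (1 - b - 1) * (- sin (k / 4) * 4^-1)).
  rewrite /edge /GRing.scale /=.
  have -> : 1 - b - 1 = - b by ring.
  by field; rewrite subr_eq0 gt_eqF.
exact: d.
Qed.

Lemma edgeP_bound b k : b < 1 -> 0 < k < 2 * pi -> `|edgeP b k| <= 4 / (1 - b).
Proof.
move=> b1 kI; have [s0 c0] := quarter_gt0 kI.
have q0 : 0 < 4 / (1 - b) by rewrite divr_gt0 ?subr_gt0.
rewrite normrM (gtr0_norm q0); apply: ler_piMr; first exact: ltW.
have pw (x : R) : 0 < x -> x <= 1 -> 0 <= x `^ (1 - b) <= 1.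
  move=> x0 x1; rewrite powR_ge0/=.
  have b1' : 0 <= 1 - b by lra.
  have := @ge0_ler_powR R _ b1' x 1; rewrite powR1 !nnegrE; apply=> //; exact: ltW.
have /andP[? ?] := pw _ s0 (sin_le1 _); have /andP[? ?] := pw _ c0 (cos_le1 _).
by rewrite ler_norml; apply/andP; split; lra.
Qed.

Lemma edge_continuous b k : 0 < k < 2 * pi -> {for k, continuous (edge b)}.
Proof.
move=> kI; have [s0 c0] := quarter_gt0 kI.
have d4 : {for k, continuous (fun x : R => x / 4)}.
  by apply: cvgMl; exact: cvg_id.
have cs : {for k, continuous (fun x : R => sin (x / 4))}.
  by apply: continuous_comp d4 _; exact: continuous_sin.
have cc : {for k, continuous (fun x : R => cos (x / 4))}.
  by apply: continuous_comp d4 _; exact: continuous_cos.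
have cp (x : R) : 0 < x -> {for x, continuous (@powR R ^~ (- b))}.
  move=> x0; apply/differentiable_continuous/derivable1_diffP.
  by have := is_derive1_powR (- b) x0 => -[].
apply: cvgD; apply: cvgM => //.
- exact: (@continuous_comp _ _ _ (fun x : R => sin (x / 4)) (@powR R ^~ (- b)) k cs (cp _ s0)).
- exact: (@continuous_comp _ _ _ (fun x : R => cos (x / 4)) (@powR R ^~ (- b)) k cc (cp _ c0)).
Qed.

Lemma edge_integral b (u v : R) : b < 1 -> 0 < u -> u < v -> v < 2 * pi ->
  (\int[@lebesgue_measure R]_(k in `[u, v]) (edge b k)%:E = (edgeP b v)%:E - (edgeP b u)%:E)%E.
Proof.
move=> b1 u0 uv v2.
have I k : k \in `[u, v] -> 0 < k < 2 * pi.
  rewrite in_itv/= => /andP[uk kv]; apply/andP; split; lra.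
have d k : k \in `[u, v] -> is_derive k 1 (edgeP b) (edge b k).
  by move=> /I; exact: edgeP_derive.
have cP k : k \in `[u, v] -> {for k, continuous (edgeP b)}.
  move=> /d dk; apply/differentiable_continuous/derivable1_diffP.
  exact: ex_derive.
apply: continuous_FTC2 => //.
- apply: continuous_in_subspaceT => k; rewrite inE => /I; exact: edge_continuous.
- split.
  + by move=> k kI; have [] := d k (subset_itv_oo_cc kI).
  + by apply: cvg_at_right_filter; apply: cP; rewrite in_itv/= lexx ltW.
  + by apply: cvg_at_left_filter; apply: cP; rewrite in_itv/= lexx ltW.
- by move=> k kI; rewrite derive1E; have [_ ->] := d k (subset_itv_oo_cc kI).
Qed.

Lemma measurable_edge b : measurable_fun [set: R] (edge b).
Proof.
have m4 : measurable_fun [set: R] (fun x : R => x / 4).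
  by apply: measurable_funM => //.
have ms : measurable_fun [set: R] (fun x : R => sin (x / 4)).
  by apply: measurableT_comp m4; apply: continuous_measurable_fun; exact: continuous_sin.
have mc : measurable_fun [set: R] (fun x : R => cos (x / 4)).
  by apply: measurableT_comp m4; apply: continuous_measurable_fun; exact: continuous_cos.
by apply: measurable_funD; apply: measurable_funM => //;
  apply: (measurableT_comp (measurable_powR _)).
Qed.

(** The primitive is bounded by 4 / (1 - b) throughout the open interval, so the integrals over an
    exhaustion by compact intervals stay below 8 / (1 - b); monotone convergence does the rest. *)
Lemma edge_integral_lty b : b < 1 ->
  (\int[@lebesgue_measure R]_(k in `]0%R, (2 * pi)%R[) (edge b k)%:E < +oo)%E.
Proof.
move=> b1; have p2 := pi_ge2 R.
(* The bound 1, together with pi >= 2, keeps every interval [e n, 2 pi - e n] nondegenerate. *)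
have [e [n1 ed es]] : exists e : nat -> R, [/\ forall n, 0 < e n <= 1,
    forall m n, (m <= n)%N -> e n <= e m & forall d, 0 < d -> exists n, e n < d].
  exists (fun n => n.+1%:R^-1); split => [n|m n mn|d d0].
  - by rewrite invr_gt0 ltr0n/= invf_le1 ?ler1n.
  - by rewrite lef_pV2 ?posrE ?ltr0n// ler_nat.
  - have [n _ /(_ n (leqnn n)) dn] := near_infty_natSinv_lt (PosNum d0).
    by exists n.
pose F n : set R := `[e n, 2 * pi - e n]%classic.
have sub n k : F n k -> 0 < k < 2 * pi.
  by rewrite /F/= in_itv/=; have /andP[? ?] := n1 n; move=> /andP[? ?]; apply/andP; split; lra.
have -> : `]0%R, (2 * pi)%R[%classic = \bigcup_n F n.
  apply/seteqP; split => [k /=|k [n _ /sub]]; rewrite /= in_itv//= => /andP[k0 k2].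
  have d0 : 0 < Num.min k (2 * pi - k) by rewrite lt_min k0 subr_gt0.
  have [n dn] := es _ d0; exists n => //; rewrite /F/= in_itv/=.
  by move: dn; rewrite lt_min => /andP[? ?]; apply/andP; split; lra.
have mF n : measurable (F n) by exact: measurable_itv.
have me n : measurable_fun (F n) (fun k => (edge b k)%:E).
  by apply/measurable_EFinP; apply: measurable_funTS; exact: measurable_edge.
apply: (@le_lt_trans _ _ ((8 / (1 - b))%:E)%E); last exact: ltry.
have nd : nondecreasing_seq F.
  move=> m n /ed mn; apply/subsetPset => k; rewrite /F/= !in_itv/= => /andP[? ?].
  by apply/andP; split; lra.
have e0 n x : F n x -> (0 <= (edge b x)%:E)%E.
  by move=> /sub xI; rewrite lee_fin edge_ge0.
have cv : (\int[@lebesgue_measure R]_(x in F i) (edge b x)%:E @[i --> \oo] -->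
    \int[@lebesgue_measure R]_(x in \bigcup_i F i) (edge b x)%:E)%E.
  exact: ge0_nondecreasing_set_cvg_integral.
have ccv : cvgn (fun i => \int[@lebesgue_measure R]_(x in F i) (edge b x)%:E)%E.
  by apply/cvg_ex; eexists; exact: cv.
rewrite -(cvg_lim (@ereal_hausdorff R) cv); apply: lime_le; first exact: ccv.
apply: nearW => n; have /andP[n0 n1'] := n1 n.
rewrite /F edge_integral//; [|lra|lra].
rewrite -EFinB lee_fin.
have h1 : `|edgeP b (2 * pi - e n)| <= 4 / (1 - b).
  by apply: edgeP_bound => //; apply/andP; split; lra.
have h2 : `|edgeP b (e n)| <= 4 / (1 - b).
  by apply: edgeP_bound => //; apply/andP; split; lra.
have -> : 8 / (1 - b) = 4 / (1 - b) + 4 / (1 - b) by field; rewrite subr_eq0 gt_eqF.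
move: h1 h2; rewrite !ler_norml => /andP[_ ?] /andP[? _]; lra.
Qed.

End Singularity.

(** * Cosine kernels defined by a weight: positivity, Bessel bound, decay *)

Section WeightedForms.
Context d (T : measurableType d) (R : realType) (mu : {measure set T -> \bar R}).
Variables (D : set T) (mD : measurable D).
Implicit Types (g h : T -> R).

Lemma integrable_bounded_mul g h (C : R) : measurable_fun D h ->
  (forall k, `|h k| <= C) -> mu.-integrable D (EFin \o g) ->
  mu.-integrable D (EFin \o (fun k => h k * g k)).
Proof.
move=> mh hC ig.
apply: (le_integrable mD _ _ (integrableZl mD C ig)).
  apply/measurable_EFinP; apply: measurable_funM => //.
  by apply/measurable_EFinP; exact: measurable_int ig.
move=> x Dx /=; rewrite lee_fin !normrM ler_wpM2r//.
by rewrite (le_trans (hC x))// ler_norm.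
Qed.

Lemma Rintegral_sum (I : Type) (s : seq I) (f : I -> T -> R) :
  (forall i, mu.-integrable D (EFin \o f i)) ->
  \int[mu]_(k in D) (\sum_(i <- s) f i k) = \sum_(i <- s) \int[mu]_(k in D) f i k.
Proof.
move=> fi.
have is_ t : mu.-integrable D (EFin \o (fun k => \sum_(i <- t) f i k)).
  have -> : EFin \o (fun k => \sum_(i <- t) f i k) =
      (fun k => \sum_(i <- t) (EFin \o f i) k)%E.
    by apply/funext => k /=; rewrite sumEFin.
  by apply: integrable_sum.
elim: s => [|i s IH].
  rewrite big_nil -[RHS](_ : \int[mu]_(k in D) (0 : R) = 0).
    by apply: eq_Rintegral => k _; rewrite big_nil.
  by rewrite Rintegral_cst// mul0r.
rewrite big_cons -IH -RintegralD//.
by apply: eq_Rintegral => k _; rewrite big_cons.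
Qed.

Variable ph : Z3 -> T -> R.
Hypothesis mph : forall x, measurable_fun D (ph x).

(** With linear phases this is the Fourier coefficient of the weight at x - y. An arbitrary phase
    keeps the geometry of the torus out of the argument. *)
Definition wform g (x y : Z3) : R := \int[mu]_(k in D) (cos (ph x k - ph y k) * g k).

Let mcos (f : T -> R) : measurable_fun D f -> measurable_fun D (fun k => cos (f k)).
Proof.
move=> mf; apply: measurableT_comp mf; apply: continuous_measurable_fun.
exact: continuous_cos.
Qed.

Let iwf g x y : mu.-integrable D (EFin \o g) ->
  mu.-integrable D (EFin \o (fun k => cos (ph x k - ph y k) * g k)).
Proof.
move=> ig; apply: (@integrable_bounded_mul g _ 1) => //.
  by apply: mcos; exact: measurable_funB.
by move=> k; exact: cos_max.
Qed.

Lemma wformC g x y : wform g x y = wform g y x.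
Proof.
by apply: eq_Rintegral => k _; rewrite -cosN opprB.
Qed.

Lemma wform_bound g x y : mu.-integrable D (EFin \o g) -> (forall k, D k -> 0 <= g k) ->
  `|wform g x y| <= \int[mu]_(k in D) g k.
Proof.
move=> ig g0; apply: le_trans (le_normr_Rintegral mD (iwf x y ig)) _.
apply: le_Rintegral => //; first exact: integrable_norm (iwf x y ig).
move=> k Dk; rewrite normrM (ger0_norm (g0 k Dk)) ler_piMl ?g0//; exact: cos_max.
Qed.

(** By the addition formula for the cosine, the double sum is the integral against [g] of the
    squared modulus of the exponential sum with coefficients [p.1] and phases [ph p.2]. *)
Lemma wform_sumE g (s : seq (R * Z3)) : mu.-integrable D (EFin \o g) ->
  \sum_(p <- s) \sum_(q <- s) p.1 * q.1 * wform g p.2 q.2 =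
  \int[mu]_(k in D) (((\sum_(p <- s) p.1 * cos (ph p.2 k)) ^+ 2
    + (\sum_(p <- s) p.1 * sin (ph p.2 k)) ^+ 2) * g k).
Proof.
move=> ig.
have ii (p q : R * Z3) : mu.-integrable D
   (EFin \o (fun k => p.1 * q.1 * (cos (ph p.2 k - ph q.2 k) * g k))).
  have -> : EFin \o (fun k => p.1 * q.1 * (cos (ph p.2 k - ph q.2 k) * g k)) =
     (fun k => (p.1 * q.1)%:E * (EFin \o (fun k => (cos (ph p.2 k - ph q.2 k) * g k)%R)) k)%E by [].
  by apply: integrableZl => //; exact: iwf.
transitivity (\sum_(p <- s) \sum_(q <- s)
    \int[mu]_(k in D) (p.1 * q.1 * (cos (ph p.2 k - ph q.2 k) * g k))).
  by apply: eq_bigr => p _; apply: eq_bigr => q _; rewrite RintegralZl//; exact: iwf.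
transitivity (\sum_(p <- s) \int[mu]_(k in D) (\sum_(q <- s)
    (p.1 * q.1 * (cos (ph p.2 k - ph q.2 k) * g k)))).
  by apply: eq_bigr => p _; rewrite Rintegral_sum.
rewrite -Rintegral_sum; last first.
  move=> p; have -> : EFin \o (fun k => \sum_(q <- s) p.1 * q.1 * (cos (ph p.2 k - ph q.2 k) * g k))
      = (fun k => \sum_(q <- s) (EFin \o (fun k => (p.1 * q.1 * (cos (ph p.2 k - ph q.2 k) * g k))%R)) k)%E.
    by apply/funext => k /=; rewrite sumEFin.
  by apply: integrable_sum.
apply: eq_Rintegral => k _.
rewrite !expr2 !big_distrlr/= -big_split/= mulr_suml; apply: eq_bigr => p _.
rewrite -big_split/= mulr_suml; apply: eq_bigr => q _.
by rewrite cosB; ring.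
Qed.

Lemma wform_ge0 g (s : seq (R * Z3)) : mu.-integrable D (EFin \o g) ->
  (forall k, D k -> 0 <= g k) ->
  0 <= \sum_(p <- s) \sum_(q <- s) p.1 * q.1 * wform g p.2 q.2.
Proof.
move=> ig g0; rewrite wform_sumE//; apply: Rintegral_ge0 => k Dk.
by rewrite mulr_ge0 ?g0// addr_ge0// sqr_ge0.
Qed.

Lemma wform_le g g' (s : seq (R * Z3)) : mu.-integrable D (EFin \o g) ->
  mu.-integrable D (EFin \o g') -> (forall k, D k -> g k <= g' k) ->
  \sum_(p <- s) \sum_(q <- s) p.1 * q.1 * wform g p.2 q.2 <=
  \sum_(p <- s) \sum_(q <- s) p.1 * q.1 * wform g' p.2 q.2.
Proof.
move=> ig ig' gg'.
have igg : mu.-integrable D (EFin \o (fun k => g' k - g k)).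
  have -> : EFin \o (fun k => g' k - g k) = ((EFin \o g') \- (EFin \o g))%E by [].
  exact: integrableB.
rewrite -subr_ge0 -sumrB.
rewrite (eq_bigr (fun p => \sum_(q <- s) p.1 * q.1 * wform (fun k => g' k - g k) p.2 q.2)).
  by apply: wform_ge0 => // k Dk; rewrite subr_ge0 gg'.
move=> p _; rewrite -sumrB; apply: eq_bigr => q _.
rewrite -mulrBr; congr (_ * _); rewrite /wform -RintegralB//; try exact: iwf.
by apply: eq_Rintegral => k _; rewrite mulrBr.
Qed.

(* Bessel's inequality for the weight [g]: test [wform_ge0] on [t delta_x - wform g x]
   with [t = V M], where [g <= M] bounds the form by [V M] times the l^2 norm. *)
Lemma wform_bessel g (M V : R) x (S : seq Z3) : uniq S -> 0 < M -> 0 < V ->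
  (forall k, D k -> 0 <= g k <= M) -> mu.-integrable D (EFin \o g) ->
  mu.-integrable D (EFin \o (fun=> M)) ->
  (forall y z, wform (fun=> M) y z = if y == z then V * M else 0) ->
  \sum_(y <- S) wform g x y ^+ 2 <= V * M * wform g x x.
Proof.
move=> uS M0 V0 gM ig i1 orth; set X := \sum_(y <- S) _.
set G := wform g x; pose s := [seq (- G y, y) | y <- S].
have VM0 : 0 < V * M by exact: mulr_gt0.
have inner : \sum_(p <- s) \sum_(q <- s) p.1 * q.1 * wform g p.2 q.2 <= V * M * X.
  apply: le_trans (wform_le s ig i1 _) _; first by move=> k /gM /andP[].
  rewrite big_map /X mulr_sumr [leLHS]big_seq [leRHS]big_seq; apply: ler_sum => y yS.
  rewrite big_map (bigD1_seq y)//= big1 ?addr0 ?orth ?eqxx//.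
    by rewrite mulrNN le_eqVlt; apply/orP; left; apply/eqP; rewrite /G; ring.
  by move=> z zy; rewrite orth eq_sym (negbTE zy) mulr0.
have := @wform_ge0 g ((V * M, x) :: s) ig (fun k Dk => (andP (gM k Dk)).1).
rewrite big_cons big_cons /=.
rewrite [X in _ + X](eq_bigr (fun p => p.1 * (V * M) * wform g p.2 x +
   \sum_(q <- s) p.1 * q.1 * wform g p.2 q.2)); last by move=> p _; rewrite big_cons.
rewrite big_split /= -/G.
have -> : \sum_(p <- s) V * M * p.1 * wform g x p.2 = - (V * M * X).
  rewrite big_map /X mulr_sumr -sumrN; apply: eq_bigr => y _ /=; rewrite /G; ring.
have -> : \sum_(p <- s) p.1 * (V * M) * wform g p.2 x = - (V * M * X).
  rewrite big_map /X mulr_sumr -sumrN; apply: eq_bigr => y _ /=.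
  by rewrite (wformC g y x) /G; ring.
move=> h.
have : V * M * X <= V * M * (V * M * wform g x x).
  by move: h inner; rewrite /G; set A := \sum_(p <- s) _; set B := wform g x x; lra.
by rewrite ler_pM2l.
Qed.

(** At each point the truncations at n + 1 are eventually equal to [w], and [w] dominates them
    all. *)
Lemma Rintegral_truncation w (e : R) : mu.-integrable D (EFin \o w) ->
  (forall k, D k -> 0 <= w k) -> 0 < e ->
  exists2 M : R, 0 < M & \int[mu]_(k in D) (w k - Num.min (w k) M) <= e.
Proof.
move=> iw w0 e0; have mw : measurable_fun D w.
  by apply/measurable_EFinP; exact: measurable_int iw.
pose f_ (n : nat) := EFin \o (fun k => Num.min (w k) n.+1%:R).
have mf_ n : measurable_fun D (f_ n).
  by apply/measurable_EFinP; apply: measurable_minr.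
have f_f : {ae mu, forall k, D k -> f_ ^~ k @ \oo --> (EFin \o w) k}.
  apply: aeW => k Dk; apply: cvg_near_cst.
  exists (Num.bound (w k)) => // n /= nw; congr EFin; apply/min_idPl.
  by rewrite (le_trans (ltW (archi_boundP (w0 k Dk))))// ler_nat leqW.
have f_g : {ae mu, forall k n, D k -> (`|f_ n k| <= (EFin \o w) k)%E}.
  apply: aeW => k n Dk; rewrite /f_/= lee_fin ger0_norm; first by rewrite ge_min lexx.
  by rewrite le_min w0//=.
have [_ + _] := dominated_convergence mD mf_ (measurable_int mu iw) f_f iw f_g.
move=> /fine_cvgP[_] /cvgrPdist_le/(_ e e0)[n _ /(_ n (leqnn n))] /=.
rewrite sub0r normrN => h; exists n.+1%:R => //.
apply: le_trans (le_trans (ler_norm _) h).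
rewrite le_eqVlt; apply/orP; left; apply/eqP; congr fine.
apply: eq_integral => k kD; rewrite /f_ /=; congr EFin; rewrite distrC ger0_norm//.
by rewrite subr_ge0 ge_min lexx.
Qed.

Lemma wform_decay w (V e : R) x : mu.-integrable D (EFin \o w) ->
  (forall k, D k -> 0 <= w k) -> mu.-integrable D (EFin \o (fun=> 1)) -> 0 < V ->
  (forall y z, wform (fun=> 1) y z = if y == z then V else 0) -> 0 < e ->
  exists n, forall y, y \notin zball n -> `|wform w x y| <= e.
Proof.
move=> iw w0 i1 V0 orth e0; have e2 : 0 < e / 2 by rewrite divr_gt0.
have [M M0 wM] := Rintegral_truncation iw w0 e2.
pose g k := Num.min (w k) M.
have g0 k : D k -> 0 <= g k <= M.
  by move=> Dk; rewrite /g le_min w0//= ltW//= ge_min lexx orbT.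
have ig : mu.-integrable D (EFin \o g).
  apply: (le_integrable mD _ _ iw).
    apply/measurable_EFinP; apply: measurable_minr => //.
    by apply/measurable_EFinP; exact: measurable_int iw.
  move=> k Dk /=; have /andP[gk _] := g0 k Dk.
  by rewrite lee_fin (ger0_norm gk) (ger0_norm (w0 k Dk)) /g ge_min lexx.
have iM : mu.-integrable D (EFin \o (fun=> M)).
  have -> : EFin \o (fun=> M) = (fun k : T => M%:E * (EFin \o (fun=> 1%R)) k)%E.
    by apply/funext => k /=; rewrite mule1.
  exact: integrableZl.
have orthM y z : wform (fun=> M) y z = if y == z then V * M else 0.
  transitivity (M * wform (fun=> 1) y z); last by rewrite orth; case: ifP; rewrite ?mulr0// mulrC.
  rewrite /wform -RintegralZl//; last exact: iwf.
  by apply: eq_Rintegral => k _; rewrite mulr1 mulrC.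
have sG : zsummable (fun y => wform g x y ^+ 2).
  apply/zsummableP; exists (V * M * wform g x x) => n.
  rewrite /psum (eq_bigr (fun y => wform g x y ^+ 2)).
    by apply: wform_bessel => //; exact: zball_uniq.
  by move=> y _; rewrite ger0_norm// sqr_ge0.
(* The tail of the squares is asked to be at most (e/2)^2, so each single coefficient outside
   [zball n] is at most e/2. *)
have [n tn] := zsum_tail sG (exprn_gt0 2 e2).
exists n => y yn.
have -> : wform w x y = wform g x y + wform (fun k => w k - g k) x y.
  rewrite /wform -RintegralD//; first by apply: eq_Rintegral => k _; ring.
  - exact: iwf.
  - apply: iwf; have -> : EFin \o (fun k => w k - g k) = ((EFin \o w) \- (EFin \o g))%E by [].
    exact: integrableB.
apply: le_trans (ler_normD _ _) _; rewrite [leRHS](splitr e); apply: lerD.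
  rewrite -(@ler_sqr R) ?nnegrE ?normr_ge0 ?(ltW e2)// real_normK ?num_real//.
  apply: le_trans tn; set F := fun z => _.
  have -> : wform g x y ^+ 2 = F y by rewrite /F (negbTE yn) ger0_norm// sqr_ge0.
  apply: le_zsum1 => [|z]; last by rewrite /F; case: ifP.
  by apply: zsummable_norm_le sG _ => z; rewrite /F; case: ifP; rewrite ?normr0 ?normr_id.
apply: le_trans (wform_bound _ _ _ _) wM.
- have -> : EFin \o (fun k => w k - g k) = ((EFin \o w) \- (EFin \o g))%E by [].
  exact: integrableB.
- by move=> k Dk; rewrite subr_ge0 /g ge_min lexx.
Qed.

End WeightedForms.

(** * Iterated integrals over product spaces *)

Section ProductIntegrals.
Context d1 d2 (T1 : measurableType d1) (T2 : measurableType d2) (R : realType).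
Variable m1 : {sigma_finite_measure set T1 -> \bar R}.
Variable m2 : {sigma_finite_measure set T2 -> \bar R}.

Lemma ge0_integral_prod (f : T1 -> R) (g : T2 -> R) :
  measurable_fun [set: T1] f -> measurable_fun [set: T2] g ->
  (forall x, 0 <= f x) -> (forall y, 0 <= g y) ->
  (\int[m1 \x m2]_z (f z.1 * g z.2)%:E = \int[m1]_x (f x)%:E * \int[m2]_y (g y)%:E)%E.
Proof.
move=> mf mg f0 g0; rewrite fubini_tonelli1; last 2 first.
- apply/measurable_EFinP; apply: measurable_funM.
    exact: measurableT_comp mf measurable_fst.
  exact: measurableT_comp mg measurable_snd.
- by move=> z; rewrite lee_fin mulr_ge0.
rewrite /fubini_F /=.
transitivity (\int[m1]_x ((f x)%:E * \int[m2]_y (g y)%:E))%E.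
  apply: eq_integral => x _; under eq_integral do rewrite EFinM.
  rewrite ge0_integralZl//.
  - exact/measurable_EFinP.
  - by move=> t _; rewrite lee_fin.
  - by rewrite lee_fin.
apply: ge0_integralZr => //.
- exact/measurable_EFinP.
- by move=> x _; rewrite lee_fin.
- by apply: integral_ge0 => y _; rewrite lee_fin.
Qed.

Lemma integral_prod_inner (f : T1 * T2 -> R) (F : T1 -> R) :
  (m1 \x m2)%E.-integrable setT (EFin \o f) ->
  (forall x, (\int[m2]_y (f (x, y))%:E = (F x)%:E)%E) ->
  (\int[m1 \x m2]_z (f z)%:E = \int[m1]_x (F x)%:E)%E.
Proof.
move=> fi fF; rewrite -(integral12_prod_meas1 fi).
by apply: eq_integral => x _; rewrite /fubini_F /= fF.
Qed.

End ProductIntegrals.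

Section LebesguePlane.
Variable R : realType.
Local Notation leb := (@lebesgue_measure R).

(* The library declares the product measure sigma-finite only for subprobabilities;
   this alias of the planar Lebesgue measure carries the missing instance. *)
Definition leb2 : set (measurableTypeR R * measurableTypeR R) -> \bar R := (leb \x leb)%E.

Let leb2_sigma_finite : sigma_finite setT leb2.
Proof.
have /sigma_finiteP[F [TF ndF Foo]] := sigma_finiteT leb.
exists (fun n => F n `*` F n).
  rewrite -setXTT TF; apply/seteqP; split => -[x y].
    move=> [/= [n _ Fnx] [k _ Fky]]; exists (maxn n k) => //; split.
      by move: x Fnx; exact/subsetPset/ndF/leq_maxl.
    by move: y Fky; exact/subsetPset/ndF/leq_maxr.
  by move=> [n _ []/= ? ?]; split; exists n.
move=> k; have [? ?] := Foo k.
split; first exact: measurableX.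
rewrite /leb2 product_measure1E//; apply: lte_mul_pinfty => //.
by rewrite ge0_fin_numE.
Qed.

HB.instance Definition _ := Measure.on leb2.
HB.instance Definition _ := Measure_isSigmaFinite.Build _ _ _ leb2 leb2_sigma_finite.

End LebesguePlane.

(** * The torus and integrability of the singular weight *)

Section Torus.
Variable R : realType.
Local Notation leb := (@lebesgue_measure R).
Local Notation mu3 := ((leb \x leb) \x leb)%E.
Implicit Types (k : R * R * R).

Definition phase (x : Z3) k : R :=
  x.1.1%:~R * k.1.1 + x.1.2%:~R * k.1.2 + x.2%:~R * k.2.

Lemma T3E : @T3 R = (`[0, 2 * pi] `*` `[0, 2 * pi]) `*` `[0, 2 * pi].
Proof. by apply/seteqP; split => -[[u v] t] /=; [move=> [? [? ?]]|move=> [[? ?] ?]]. Qed.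

Lemma measurable_T3 : measurable (@T3 R).
Proof.
by rewrite T3E; apply: measurableX; [apply: measurableX|]; exact: measurable_itv.
Qed.

Lemma measurable_coord1 : measurable_fun [set: R * R * R] (fun k => k.1.1).
Proof. exact: measurableT_comp measurable_fst measurable_fst. Qed.
Lemma measurable_coord2 : measurable_fun [set: R * R * R] (fun k => k.1.2).
Proof. exact: measurableT_comp measurable_snd measurable_fst. Qed.
Lemma measurable_coord3 : measurable_fun [set: R * R * R] (fun k => k.2).
Proof. exact: measurable_snd. Qed.

Lemma measurable_phase x : measurable_fun [set: R * R * R] (phase x).
Proof.
have h (z : int) (f : R * R * R -> R) : measurable_fun [set: R * R * R] f ->
    measurable_fun [set: R * R * R] (fun k => z%:~R * f k).
  by move=> mf; apply: measurable_funM.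
apply: measurable_funD; first apply: measurable_funD; apply: h.
- exact: measurable_coord1.
- exact: measurable_coord2.
- exact: measurable_coord3.
Qed.

Lemma measurable_symb : measurable_fun [set: R * R * R] (@symb R).
Proof.
have mc : measurable_fun [set: R] (@cos R).
  by apply: continuous_measurable_fun; exact: continuous_cos.
apply: measurable_funB => //; apply: measurable_funM => //.
apply: measurable_funD; first apply: measurable_funD; apply: measurableT_comp mc _.
- exact: measurable_coord1.
- exact: measurable_coord2.
- exact: measurable_coord3.
Qed.

Lemma symb_ge0 k : 0 <= symb k.
Proof.
rewrite /symb; have := cos_le1 k.1.1; have := cos_le1 k.1.2; have := cos_le1 k.2; lra.
Qed.

Lemma symb_le k : symb k <= 12.
Proof.
rewrite /symb; have := cos_geN1 k.1.1; have := cos_geN1 k.1.2; have := cos_geN1 k.2; lra.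
Qed.

Lemma measurable_symb_powR (s : R) : measurable_fun [set: R * R * R] (fun k => symb k `^ s).
Proof. exact: measurableT_comp (measurable_powR s) measurable_symb. Qed.

Lemma lebesgue3_box (I : set R) : measurable I -> mu3 ((I `*` I) `*` I) = (leb I * leb I * leb I)%E.
Proof.
move=> mI; rewrite product_measure1E//; last exact: measurableX.
by congr (_ * _)%E; exact: product_measure1E.
Qed.

Lemma lebesgue3_T3_lty : (mu3 (@T3 R) < +oo)%E.
Proof.
rewrite T3E lebesgue3_box; last exact: measurable_itv.
by rewrite lebesgue_measure_itv/=; case: ifP => _; rewrite -?EFinB -?EFinM ?ltry// !mule0 ltry.
Qed.

Lemma integrable_T3_bounded (f : R * R * R -> R) (C : R) :
  measurable_fun [set: R * R * R] f -> (forall k, `|f k| <= C) ->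
  mu3.-integrable (@T3 R) (EFin \o f).
Proof.
move=> mf fC; apply: measurable_bounded_integrable.
- exact: measurable_T3.
- exact: lebesgue3_T3_lty.
- exact: measurable_funTS.
- by exists C; split; [exact: num_real|] => M CM k _ /=; exact: le_trans (fC k) (ltW CM).
Qed.

(** Extension by zero makes the majorant nonnegative on the whole line, as the product formula
    [ge0_integral_prod] requires. *)
Definition edge0 (b t : R) : R := edge b t * \1_(`]0%R, (2 * pi)%R[%classic) t.

Lemma measurable_edge0 b : measurable_fun [set: R] (edge0 b).
Proof.
apply: measurable_funM; first exact: measurable_edge.
by apply: measurable_indic; exact: measurable_itv.
Qed.

Lemma edge0_ge0 b t : 0 <= edge0 b t.
Proof.
rewrite /edge0 indicE; case: (boolP (t \in _)) => [|_]; last by rewrite mulr0.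
by rewrite inE/= in_itv/= => h; rewrite mulr1 edge_ge0.
Qed.

Lemma edge0_integral_fin b : b < 1 -> (\int[leb]_t (edge0 b t)%:E \is a fin_num)%E.
Proof.
move=> b1; rewrite ge0_fin_numE; last first.
  by apply: integral_ge0 => t _; rewrite lee_fin edge0_ge0.
apply: le_lt_trans (edge_integral_lty b1).
rewrite [leRHS]integral_mkcond le_eqVlt; apply/orP; left; apply/eqP.
apply: eq_integral => t _; rewrite patchE /edge0 indicE.
by case: ifP => _; rewrite ?mulr1 ?mulr0.
Qed.

Lemma edge0_prod_integral_lty b : b < 1 ->
  (\int[mu3]_k (edge0 b k.1.1 * edge0 b k.1.2 * edge0 b k.2)%:E < +oo)%E.
Proof.
move=> b1; have mE := measurable_edge0 b; have E0 := edge0_ge0 b.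
have fE := edge0_integral_fin b1; set c := (X in X \is a fin_num) in fE.
have c0 : (0 <= c)%E by apply: integral_ge0 => t _; rewrite lee_fin.
have m12 : measurable_fun [set: R * R] (fun x => edge0 b x.1 * edge0 b x.2).
  apply: measurable_funM.
    exact: measurableT_comp mE measurable_fst.
  exact: measurableT_comp mE measurable_snd.
have e2 := ge0_integral_prod leb leb mE mE E0 E0.
have m0 x : 0 <= edge0 b x.1 * edge0 b x.2 by exact: mulr_ge0.
have e3 : (\int[mu3]_k (edge0 b k.1.1 * edge0 b k.1.2 * edge0 b k.2)%:E =
    \int[leb \x leb]_x (edge0 b x.1 * edge0 b x.2)%:E * \int[leb]_y (edge0 b y)%:E)%E.
  exact: (ge0_integral_prod (@leb2 R) leb m12 mE m0 E0).
rewrite [X in (X < _)%E](_ : _ = (c * c * c)%E).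
  by rewrite -(fineK fE) -!EFinM ltry.
by apply: (etrans e3); congr (_ * _)%E; exact: e2.
Qed.

(** The exponent is shared equally: the left side is the cube of [symb k] to the power -b/2, and
    since [symb k] is at least each 2 (1 - cos k_j), one factor is estimated by each coordinate.
    With alpha = 3 b the condition b < 1 becomes alpha < 3. *)
Lemma symb_le_edge (b : R) k : 0 <= b < 1 ->
  0 < k.1.1 < 2 * pi -> 0 < k.1.2 < 2 * pi -> 0 < k.2 < 2 * pi ->
  symb k `^ (- (b / 2 * 3)) <= edge b k.1.1 * edge b k.1.2 * edge b k.2.
Proof.
move=> /andP[b0 b1] I1 I2 I3; have b01 : 0 <= b <= 1 by rewrite b0 ltW.
have pos (t : R) : 0 < t < 2 * pi -> 0 < 2 * (1 - cos t).
  move=> /quarter_gt0[s0 c0]; rewrite cos_quarter mulr_gt0// exprn_gt0// mulr_gt0//.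
have h (t : R) : 0 < t < 2 * pi -> 2 * (1 - cos t) <= symb k ->
    symb k `^ (- (b / 2)) <= edge b t.
  move=> tI ts; apply: le_trans (edge_ge b01 tI).
  rewrite !powRN lef_pV2 ?posrE ?powR_gt0 ?pos//; last exact: lt_le_trans (pos t tI) ts.
  have m0 := ltW (pos t tI).
  by apply: ge0_ler_powR => //; rewrite ?nnegrE ?symb_ge0//; lra.
have c1 := cos_le1 k.1.1; have c2 := cos_le1 k.1.2; have c3 := cos_le1 k.2.
rewrite -mulNr powRrM powR_mulrn ?powR_ge0//.
have p0 : 0 <= symb k `^ (- (b / 2)) by exact: powR_ge0.
have -> : (symb k `^ (- (b / 2))) ^+ 3 =
  symb k `^ (- (b / 2)) * symb k `^ (- (b / 2)) * symb k `^ (- (b / 2)) by ring.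
apply: ler_pM => //; [exact: mulr_ge0| apply: ler_pM => //|];
  apply: h => //; rewrite /symb; lra.
Qed.

Definition openT3 : set (R * R * R) :=
  (`]0%R, (2 * pi)%R[ `*` `]0%R, (2 * pi)%R[) `*` `]0%R, (2 * pi)%R[.

Lemma measurable_openT3 : measurable openT3.
Proof. by apply: measurableX; [apply: measurableX|]; exact: measurable_itv. Qed.

Lemma openT3_sub : openT3 `<=` @T3 R.
Proof.
by rewrite T3E => k /= [[h1 h2] h3]; split; [split|]; exact: subset_itv_oo_cc.
Qed.

Lemma lebesgue3_boundary : mu3 (@T3 R `\` openT3) = 0%E.
Proof.
have mT := measurable_T3; have mO := measurable_openT3.
have fO : (mu3 openT3 < +oo)%E.
  by apply: le_lt_trans lebesgue3_T3_lty; apply: le_measure; rewrite ?inE//; exact: openT3_sub.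
have e : mu3 (@T3 R) = mu3 openT3.
  rewrite T3E lebesgue3_box; last exact: measurable_itv.
  rewrite lebesgue3_box; last exact: measurable_itv.
  by rewrite !lebesgue_measure_itv.
rewrite measureD//; last by rewrite -e in fO.
have -> : @T3 R `&` openT3 = openT3 by apply/setIidPr; exact: openT3_sub.
rewrite [X in (X - _)%E]e subee// ge0_fin_numE//.
Qed.

Lemma integrable_symb (alpha : R) : 0 < alpha < 3 ->
  mu3.-integrable (@T3 R) (EFin \o (fun k => symb k `^ (- (alpha / 2)))).
Proof.
move=> /andP[a0 a3].
have mw := measurable_symb_powR (- (alpha / 2)).
have mT := measurable_T3; have mO := measurable_openT3.
have mD : measurable (@T3 R `\` openT3) by exact: measurableD.
have mwT : measurable_fun (@T3 R) (EFin \o (fun k => symb k `^ (- (alpha / 2)))).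
  by apply/measurable_EFinP; exact: measurable_funTS.
(* The majorant is available only inside the open cube; the boundary is discarded as a null set. *)
have Q := @negligible_integrable _ _ R mu3 _ _ _ mD mT mwT lebesgue3_boundary.
refine (proj2 Q _).
have -> : @T3 R `\` (@T3 R `\` openT3) = openT3.
  by rewrite setDD; apply/setIidPr; exact: openT3_sub.
apply/integrableP; split.
  by apply/measurable_EFinP; exact: measurable_funTS.
have b1 : alpha / 3 < 1 by lra.
apply: le_lt_trans (edge0_prod_integral_lty b1).
rewrite integral_mkcond; apply: ge0_le_integral => //.
- by move=> k _; apply: erestrict_ge0 => x Ox; exact: abse_ge0.
- apply/(measurable_restrictT _ mO); apply: measurableT_comp => //.
  by apply/measurable_EFinP; exact: measurable_funTS.
- apply/measurable_EFinP; have mE := measurable_edge0 (alpha / 3).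
  apply: measurable_funM; last exact: measurableT_comp mE measurable_coord3.
  apply: measurable_funM; first exact: measurableT_comp mE measurable_coord1.
  exact: measurableT_comp mE measurable_coord2.
move=> k _; rewrite patchE; case: ifPn => [|_]; last first.
  by rewrite lee_fin; apply: mulr_ge0; [apply: mulr_ge0|]; exact: edge0_ge0.
rewrite inE => -[[h1 h2] h3] /=.
rewrite lee_fin ger0_norm ?powR_ge0//.
have -> : alpha / 2 = alpha / 3 / 2 * 3 by field.
have e t : `]0%R, (2 * pi)%R[%classic t -> edge0 (alpha / 3) t = edge (alpha / 3) t.
  by move=> tI; rewrite /edge0 indicE mem_set// mulr1.
rewrite !e//; apply: symb_le_edge; first by apply/andP; split; lra.
- by move: h1; rewrite /= in_itv.
- by move: h2; rewrite /= in_itv.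
- by move: h3; rewrite /= in_itv.
Qed.

End Torus.

(** * Orthogonality of the characters on the torus *)

Section Orthogonality.
Variable R : realType.
Local Notation leb := (@lebesgue_measure R).
Local Notation mu3 := ((leb \x leb) \x leb)%E.
Local Notation I := (`[0%R, (2 * pi)%R]%classic : set R).

Lemma leb_period : leb I = (2 * pi)%:E.
Proof.
rewrite lebesgue_measure_itv/= lte_fin mulr_gt0 ?pi_gt0// -EFinB.
by rewrite subr0.
Qed.

Lemma sin_int_period (n : int) (A : R) : sin (A + n%:~R * (2 * pi)) = sin A.
Proof.
have hn (m : nat) : cos (m%:R * (2 * pi)) = 1 :> R /\ sin (m%:R * (2 * pi)) = 0 :> R.
  have -> : m%:R * (2 * pi) = 0 + (pi *+ 2) *+ m :> R.
    by rewrite add0r -[RHS]mulr_natl (mulr2n pi); ring.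
  by rewrite (periodicn (@cosD2pi R)) (periodicn (@sinD2pi R)) cos0 sin0.
rewrite sinD; case: n => m.
  by rewrite -pmulrn; have [-> ->] := hn m; ring.
have -> : (Negz m)%:~R * (2 * pi) = - (m.+1%:R * (2 * pi)) :> R.
  by rewrite NegzE mulrNz mulNr.
by rewrite cosN sinN; have [-> ->] := hn m.+1; ring.
Qed.

Definition period_coef (n : int) : R := if n == 0 then 2 * pi else 0.

(** The period is cut out by an indicator factor instead of the domain of integration, so that
    Fubini can be applied on the full product spaces. *)
Lemma integrable_line (n : int) (A : R) :
  leb.-integrable setT (EFin \o (fun t => cos (A + n%:~R * t) * \1_I t)).
Proof.
have mf : measurable_fun [set: R] (fun t : R => cos (A + n%:~R * t)).
  apply: continuous_measurable_fun => t.
  apply: (@continuous_comp _ _ _ (fun t : R => A + n%:~R * t) (@cos R)).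
    by apply: cvgD; [exact: cvg_cst|apply: cvgMr; exact: cvg_id].
  exact: continuous_cos.
have -> : EFin \o (fun t => cos (A + n%:~R * t) * \1_I t) =
    (EFin \o (fun t => cos (A + n%:~R * t))) \_ I.
  by apply/funext => t /=; rewrite patchE indicE; case: ifP => _; rewrite ?mulr1 ?mulr0.
have h : leb.-integrable I (EFin \o (fun t => cos (A + n%:~R * t))).
  apply: measurable_bounded_integrable.
  - exact: measurable_itv.
  - rewrite [X in (X < _)%E](_ : _ = (2 * pi)%:E) ?ltry//; exact: leb_period.
  - exact: measurable_funTS.
  - exists 1; split; [exact: num_real|] => M CM t _ /=; exact: le_trans (cos_max _) (ltW CM).
exact: (proj1 (@integrable_mkcond _ _ R leb I (EFin \o (fun t => cos (A + n%:~R * t)))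
  (measurable_itv _)) h).
Qed.

(** The offset [A] stands for the part of the phase that comes from the other coordinates, so this
    one formula serves for each of the three successive integrations. *)
Lemma integral_line (n : int) (A : R) :
  (\int[leb]_t (cos (A + n%:~R * t) * \1_I t)%:E = (period_coef n * cos A)%:E)%E.
Proof.
transitivity (\int[leb]_(t in I) (cos (A + n%:~R * t))%:E)%E.
  rewrite [RHS]integral_mkcond; apply: eq_integral => t _.
  by rewrite patchE indicE; case: ifP => _; rewrite ?mulr1 ?mulr0.
have p0 : 0 < 2 * pi :> R by rewrite mulr_gt0// pi_gt0.
have cf (g : R -> R) : continuous g -> continuous (fun t : R => g (A + n%:~R * t)).
  move=> cg t; apply: (@continuous_comp _ _ _ (fun t : R => A + n%:~R * t) g); last exact: cg.
  by apply: cvgD; [exact: cvg_cst|apply: cvgMr; exact: cvg_id].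
rewrite /period_coef; case: eqVneq => [->|n0].
  under eq_integral do rewrite mul0r addr0.
  rewrite integral_cst; last exact: measurable_itv.
  by rewrite [(2 * pi * cos A)%R]mulrC EFinM; congr (_ * _)%E; exact: leb_period.
rewrite mul0r.
have nR : (n%:~R : R) != 0 by rewrite intr_eq0.
have d (t : R) : is_derive t 1 (fun t : R => sin (A + n%:~R * t) / n%:~R) (cos (A + n%:~R * t)).
  have d1 : is_derive t 1 (fun t : R => A + n%:~R * t) (n%:~R).
    have -> : (fun t : R => A + n%:~R * t) = cst A + (cst (n%:~R) * id : R -> R).
      by apply/funext.
    by apply: is_derive_eq; rewrite /GRing.scale /= mulr1 mulr0 add0r addr0.
  have d2 := @is_derive1_comp R (@sin R) (fun t : R => A + n%:~R * t) t _ _ (is_derive_sin _) d1.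
  have -> : (fun t : R => sin (A + n%:~R * t) / n%:~R) =
     (n%:~R)^-1 \*: (@sin R \o (fun t : R => A + n%:~R * t)).
    by apply/funext => x /=; rewrite mulrC.
  have -> : cos (A + n%:~R * t) = (n%:~R)^-1 *: (cos (A + n%:~R * t) * n%:~R).
    by rewrite /GRing.scale /= [X in _ = _ * X]mulrC mulKf.
  exact: is_deriveZ.
rewrite (@continuous_FTC2 R _ (fun t : R => sin (A + n%:~R * t) / n%:~R))//.
- by rewrite sin_int_period mulr0 addr0 -EFinB subrr.
- by apply: continuous_subspaceT; apply: cf; exact: continuous_cos.
- have cF : continuous (fun t : R => sin (A + n%:~R * t) / n%:~R).
    move=> t; apply: cvgMl; apply: (cf (@sin R)); exact: continuous_sin.
  split.
  + by move=> t _; have [] := d t.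
  + by apply: cvg_at_right_filter; exact: cF.
  + by apply: cvg_at_left_filter; exact: cF.
- by move=> t _; rewrite derive1E; have [_ ->] := d t.
Qed.

Lemma integrable_plane (m n : int) (A : R) : (leb \x leb)%E.-integrable setT
    (EFin \o (fun x => cos (A + m%:~R * x.1 + n%:~R * x.2) * (\1_I x.1 * \1_I x.2))).
Proof.
have mI : measurable (I `*` I) by apply: measurableX; exact: measurable_itv.
have mph : measurable_fun [set: R * R] (fun x => A + m%:~R * x.1 + n%:~R * x.2).
  apply: measurable_funD; first apply: measurable_funD => //; apply: measurable_funM => //.
have -> : EFin \o (fun x => cos (A + m%:~R * x.1 + n%:~R * x.2) * (\1_I x.1 * \1_I x.2)) =
  (EFin \o (fun x : R * R => cos (A + m%:~R * x.1 + n%:~R * x.2))) \_ (I `*` I).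
  apply/funext => x /=; rewrite patchE !indicE in_setX.
  by case: (_ \in _); case: (_ \in _); rewrite /= ?mulr1 ?mulr0.
have h : (leb \x leb)%E.-integrable (I `*` I)
    (EFin \o (fun x : R * R => cos (A + m%:~R * x.1 + n%:~R * x.2))).
  apply: measurable_bounded_integrable => //.
  - rewrite [X in (X < _)%E](_ : _ = ((2 * pi) * (2 * pi))%:E) ?ltry//.
    apply: (etrans (product_measure1E leb leb (measurable_itv _) (measurable_itv _))).
    by rewrite EFinM; congr (_ * _)%E; exact: leb_period.
  - apply: measurable_funTS; apply: measurableT_comp mph.
    by apply: continuous_measurable_fun; exact: continuous_cos.
  - exists 1; split; [exact: num_real|] => M CM t _ /=; exact: le_trans (cos_max _) (ltW CM).
exact: (proj1 (@integrable_mkcond _ _ R (leb \x leb)%E (I `*` I)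
  (EFin \o (fun x : R * R => cos (A + m%:~R * x.1 + n%:~R * x.2))) mI) h).
Qed.

Lemma integral_plane (m n : int) (A : R) :
  (\int[leb \x leb]_x (cos (A + m%:~R * x.1 + n%:~R * x.2) * (\1_I x.1 * \1_I x.2))%:E
   = (period_coef m * period_coef n * cos A)%:E)%E.
Proof.
transitivity (\int[leb]_t (period_coef n * (cos (A + m%:~R * t) * \1_I t))%:E)%E.
  apply: (integral_prod_inner (integrable_plane m n A)) => t.
  transitivity (\int[leb]_s ((\1_I t)%:E * (cos (A + m%:~R * t + n%:~R * s) * \1_I s)%:E))%E.
    by apply: eq_integral => s _; rewrite -EFinM; congr EFin => /=; ring.
  rewrite integralZl//=; last exact: integrable_line.
  by rewrite integral_line -EFinM; congr EFin; ring.
under eq_integral do rewrite EFinM.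
rewrite integralZl//=; last exact: integrable_line.
by rewrite integral_line -EFinM; congr EFin; ring.
Qed.

Lemma integral_torus (z : Z3) :
  \int[mu3]_(k in @T3 R) cos (phase z k) = period_coef z.1.1 * period_coef z.1.2 * period_coef z.2.
Proof.
have i1 : mu3.-integrable (@T3 R) (EFin \o (fun k => cos (phase z k))).
  apply: (@integrable_T3_bounded R _ 1); last by move=> k; exact: cos_max.
  apply: measurableT_comp (measurable_phase z).
  by apply: continuous_measurable_fun; exact: continuous_cos.
rewrite /Rintegral integral_mkcond.
have E : (EFin \o (fun k => cos (phase z k))) \_ (@T3 R) =
    EFin \o (fun k => cos (phase z k) * ((\1_I k.1.1 * \1_I k.1.2) * \1_I k.2)).
  apply/funext => k /=; rewrite patchE T3E !indicE !in_setX.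
  by case: (_ \in _); case: (_ \in _); case: (_ \in _); rewrite /= ?mulr1 ?mulr0 ?mul0r ?mulr0.
rewrite [X in fine X](_ : _ = (period_coef z.1.1 * period_coef z.1.2 * period_coef z.2)%:E)//.
rewrite [X in (\int[_]_x X x)%E]E.
have i2 := proj1 (@integrable_mkcond _ _ R mu3 (@T3 R) (EFin \o (fun k => cos (phase z k)))
    (@measurable_T3 R)) i1.
rewrite E in i2.
transitivity (\int[leb \x leb]_x (period_coef z.2 * (cos (0 + z.1.1%:~R * x.1 + z.1.2%:~R * x.2)
   * (\1_I x.1 * \1_I x.2)))%:E)%E.
  apply: (@integral_prod_inner _ _ _ _ R (@leb2 R) leb _ _ i2) => x.
  transitivity (\int[leb]_s ((\1_I x.1 * \1_I x.2)%:E *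
      (cos (z.1.1%:~R * x.1 + z.1.2%:~R * x.2 + z.2%:~R * s) * \1_I s)%:E))%E.
    by apply: eq_integral => s _; rewrite -EFinM; congr EFin; rewrite /phase /=; ring.
  rewrite integralZl//=; last exact: integrable_line.
  by rewrite integral_line -EFinM add0r; congr EFin; ring.
under eq_integral do rewrite EFinM.
rewrite integralZl//=; last exact: integrable_plane.
by rewrite integral_plane cos0 -EFinM; congr EFin; ring.
Qed.

End Orthogonality.

(** * Bounds, symmetry, positivity and decay of [Ralpha] *)

Section Kernel.
Variable R : realType.
Local Notation leb := (@lebesgue_measure R).
Local Notation mu3 := ((leb \x leb) \x leb)%E.
Implicit Types (k : R * R * R).

Lemma symb_ge6 k : pi / 2 <= k.1.1 <= 3 * pi / 2 -> pi / 2 <= k.1.2 <= 3 * pi / 2 ->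
  pi / 2 <= k.2 <= 3 * pi / 2 -> 6 <= symb k.
Proof.
have c (t : R) : pi / 2 <= t <= 3 * pi / 2 -> cos t <= 0.
  move=> /andP[t1 t2]; rewrite -(subrK pi t) cosDpi oppr_le0.
  by apply: cos_ge0_pihalf; apply/andP; split; lra.
move=> /c c1 /c c2 /c c3; rewrite /symb; lra.
Qed.

(** On the central cube [pi/2, 3 pi/2]^3, of volume pi^3, no cosine is positive, so [symb] is at
    least 6 and [g] at least [c]. This serves both for [Kalpha] and for the diagonal of the
    kernel. *)
Lemma Rintegral_T3_gt0 (g : R * R * R -> R) (c : R) : 0 < c ->
  measurable_fun [set: R * R * R] g -> (forall k, 0 <= g k) ->
  mu3.-integrable (@T3 R) (EFin \o g) -> (forall k, 6 <= symb k -> c <= g k) ->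
  0 < \int[mu3]_(k in @T3 R) g k.
Proof.
move=> c0 mg g0 ig gc; have p0 := pi_gt0 R.
pose J : set R := `[pi / 2, 3 * pi / 2]%classic.
pose B : set (R * R * R) := (J `*` J) `*` J.
have mJ : measurable J by exact: measurable_itv.
have mB : measurable B by apply: measurableX => //; exact: measurableX.
have lJ : leb J = pi%:E.
  rewrite lebesgue_measure_itv/= lte_fin; have -> : pi / 2 < 3 * pi / 2 :> R by lra.
  by rewrite -EFinB; congr EFin; field.
have BT : B `<=` @T3 R.
  rewrite T3E => k /= [[]]; rewrite /J /= !in_itv/= => /andP[? ?] /andP[? ?] /andP[? ?].
  by split; [split|]; apply/andP; split; lra.
apply: fine_gt0; apply/andP; split; last first.
  have /integrableP[_] := ig; apply: le_lt_trans.
  rewrite le_eqVlt; apply/orP; left; apply/eqP; apply: eq_integral => k _ /=.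
  by rewrite ger0_norm.
apply: (@lt_le_trans _ _ (\int[mu3]_(k in B) (c%:E))%E).
  rewrite integral_cst// [X in (_ < _ * X)%E](_ : _ = (pi * pi * pi)%:E).
    by rewrite -EFinM lte_fin !mulr_gt0.
  by apply: (etrans (lebesgue3_box mJ)); rewrite lJ.
apply: (@le_trans _ _ (\int[mu3]_(k in B) (g k)%:E)%E).
  apply: ge0_le_integral => //.
  - by move=> k _; rewrite lee_fin ltW.
  - by apply/measurable_EFinP; exact: measurable_funTS.
  - move=> k [[]]; rewrite /J /= !in_itv/= => k1 k2 k3; rewrite lee_fin gc//.
    exact: symb_ge6.
apply: ge0_subset_integral => //.
- exact: measurable_T3.
- by apply/measurable_EFinP; exact: measurable_funTS.
- by move=> k _; rewrite lee_fin.
Qed.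

Variable alpha : R.
Hypothesis halpha : 0 < alpha < 3.

Lemma Kalpha_gt0 : 0 < Kalpha alpha.
Proof.
have p0 := pi_gt0 R.
have /andP[a0 a3] := halpha.
rewrite /Kalpha mulr_gt0//; first by rewrite invr_gt0 exprn_gt0// mulr_gt0.
apply: (@Rintegral_T3_gt0 _ (6 `^ (alpha / 2))).
- exact: powR_gt0.
- exact: measurable_symb_powR.
- by move=> k; exact: powR_ge0.
- apply: (@integrable_T3_bounded R _ (12 `^ (alpha / 2))).
    exact: measurable_symb_powR.
  move=> k; rewrite ger0_norm ?powR_ge0//; apply: ge0_ler_powR; rewrite ?nnegrE//.
  + lra.
  + exact: symb_ge0.
  + exact: symb_le.
- move=> k k6; apply: ge0_ler_powR; rewrite ?nnegrE//; first lra.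
  exact: symb_ge0.
Qed.

Let w k := symb k `^ (- (alpha / 2)).
Let C := Kalpha alpha / (2 * pi) ^+ 3.

Let C0 : 0 < C.
Proof. by rewrite divr_gt0 ?Kalpha_gt0// exprn_gt0// mulr_gt0// pi_gt0. Qed.

Lemma RalphaE x y : Ralpha alpha x y = C * wform mu3 (@T3 R) (@phase R) w x y.
Proof.
rewrite /Ralpha /wform /Rintegral /leb3; congr (_ * fine _); apply: eq_integral => k _.
congr (cos _ * _)%:E; rewrite /phase /Zcoord /= !rmorphB /=; ring.
Qed.

Lemma mphase_T3 x : measurable_fun (@T3 R) (@phase R x).
Proof. by apply: measurable_funTS; exact: measurable_phase. Qed.

Let iw : mu3.-integrable (@T3 R) (EFin \o w).
Proof. exact: integrable_symb. Qed.

Let w0 k : (@T3 R) k -> 0 <= w k.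
Proof. by move=> _; exact: powR_ge0. Qed.

Lemma RalphaC x y : Ralpha alpha x y = Ralpha alpha y x.
Proof. by rewrite !RalphaE wformC. Qed.

Lemma Ralpha_translation x y x' y' : x.1.1 - y.1.1 = x'.1.1 - y'.1.1 ->
  x.1.2 - y.1.2 = x'.1.2 - y'.1.2 -> x.2 - y.2 = x'.2 - y'.2 ->
  Ralpha alpha x y = Ralpha alpha x' y'.
Proof. by move=> e1 e2 e3; rewrite /Ralpha /Zcoord /= e1 e2 e3. Qed.

Lemma Ralpha_bounded : exists2 r0, 0 < r0 & forall x y, `|Ralpha alpha x y| <= r0.
Proof.
exists (C * \int[mu3]_(k in @T3 R) w k + 1).
  by rewrite ltr_wpDl// mulr_ge0 ?(ltW C0)//; exact: Rintegral_ge0.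
move=> x y; rewrite RalphaE normrM (gtr0_norm C0).
apply: (@le_trans _ _ (C * \int[mu3]_(k in @T3 R) w k)); last by rewrite lerDl.
by rewrite ler_wpM2l ?(ltW C0)//; apply: wform_bound => //; [exact: measurable_T3|exact: mphase_T3].
Qed.

Lemma Ralpha_psd (s : seq (R * Z3)) :
  0 <= \sum_(p <- s) \sum_(q <- s) p.1 * q.1 * Ralpha alpha p.2 q.2.
Proof.
have -> : \sum_(p <- s) \sum_(q <- s) p.1 * q.1 * Ralpha alpha p.2 q.2 =
   C * \sum_(p <- s) \sum_(q <- s) p.1 * q.1 * wform mu3 (@T3 R) (@phase R) w p.2 q.2.
  rewrite mulr_sumr; apply: eq_bigr => p _; rewrite mulr_sumr; apply: eq_bigr => q _.
  by rewrite RalphaE; ring.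
rewrite mulr_ge0 ?(ltW C0)//.
by apply: wform_ge0 => //; [exact: measurable_T3|exact: mphase_T3].
Qed.

Lemma Ralpha_diag_gt0 x : 0 < Ralpha alpha x x.
Proof.
rewrite RalphaE mulr_gt0//.
have -> : wform mu3 (@T3 R) (@phase R) w x x = \int[mu3]_(k in @T3 R) w k.
  by apply: eq_Rintegral => k _; rewrite subrr cos0 mul1r.
have /andP[a0 a3] := halpha.
apply: (@Rintegral_T3_gt0 _ (12 `^ (- (alpha / 2)))); [| | |exact: iw|].
- exact: powR_gt0.
- exact: measurable_symb_powR.
- by move=> k; exact: powR_ge0.
- move=> k k6; have s0 : 0 < symb k by exact: lt_le_trans k6.
  rewrite /w !powRN lef_pV2 ?posrE ?powR_gt0//; apply: ge0_ler_powR; rewrite ?nnegrE//.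
  + lra.
  + exact: symb_ge0.
  + exact: symb_le.
Qed.

Lemma Ralpha_decay x (e : R) : 0 < e ->
  exists n, forall y, y \notin zball n -> `|Ralpha alpha x y| <= e.
Proof.
move=> e0; have p0 := pi_gt0 R.
have i1 : mu3.-integrable (@T3 R) (EFin \o (fun=> 1)).
  by apply: (@integrable_T3_bounded R _ 1) => // k; rewrite normr1.
have V0 : 0 < (2 * pi) ^+ 3 :> R by rewrite exprn_gt0// mulr_gt0.
have orth y z : wform mu3 (@T3 R) (@phase R) (fun=> 1) y z =
    if y == z then (2 * pi) ^+ 3 else 0.
  pose d : Z3 := (y.1.1 - z.1.1, y.1.2 - z.1.2, y.2 - z.2).
  transitivity (\int[mu3]_(k in @T3 R) cos (phase d k)).
    apply: eq_Rintegral => k _; rewrite mulr1; congr cos.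
    by rewrite /phase /d /= !rmorphB /=; ring.
  rewrite integral_torus /d /= /period_coef !subr_eq0.
  case: y z {d} => [[y1 y2] y3] [[z1 z2] z3].
  have -> : ((y1, y2, y3) == (z1, z2, z3) :> Z3) = [&& y1 == z1, y2 == z2 & y3 == z3].
    by rewrite !xpair_eqE andbA.
  by case: (y1 == z1); case: (y2 == z2); case: (y3 == z3) => /=; ring.
have [n hn] : exists n, forall y, y \notin zball n ->
    `|wform mu3 (@T3 R) (@phase R) w x y| <= e / C.
  apply: (wform_decay _ _ _ _ _ _ V0 orth (divr_gt0 e0 C0)) => //.
  - exact: measurable_T3.
  - exact: mphase_T3.
exists n => y /hn; rewrite RalphaE normrM (gtr0_norm C0).
by rewrite ler_pdivlMr// mulrC.
Qed.

End Kernel.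

(** * The quadratic form of the kernel *)

Section SumsMore.
Variable R : realType.
Implicit Types (f g w : Z3 -> R).

Lemma zsummable_bmul w f (C : R) : (forall x, `|w x| <= C) -> zsummable f ->
  zsummable (fun x => w x * f x).
Proof.
move=> wC fs; apply: (@zsummable_le _ _ (fun x => C * `|f x|)).
  by apply: zsummableZ; exact: zsummable_abs.
by move=> x; rewrite normrM ler_wpM2r.
Qed.

Lemma zsum_bmul_le w f (C : R) : (forall x, `|w x| <= C) -> zsummable f ->
  `|zsum (fun x => w x * f x)| <= C * zsum (fun x => `|f x|).
Proof.
move=> wC fs; have wf := zsummable_bmul wC fs.
apply: le_trans (ler_norm_zsum wf) _; rewrite -zsumZ; last exact: zsummable_abs.
apply: le_zsum => [||x]; first exact: zsummable_abs.
  by apply: zsummableZ; exact: zsummable_abs.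
by rewrite normrM ler_wpM2r.
Qed.

Lemma zsummable_sum (I : Type) (s : seq I) (F : I -> Z3 -> R) :
  (forall i, zsummable (F i)) -> zsummable (fun x => \sum_(i <- s) F i x).
Proof.
move=> Fs; elim: s => [|i s IH].
  rewrite (_ : (fun x => _) = (fun=> 0)); first exact: zsummable0.
  by apply/funext => x; rewrite big_nil.
rewrite (_ : (fun x => _) = (fun x => F i x + \sum_(i <- s) F i x)); first exact: zsummableD.
by apply/funext => x; rewrite big_cons.
Qed.

Lemma zsum_sum (I : Type) (s : seq I) (F : I -> Z3 -> R) :
  (forall i, zsummable (F i)) ->
  zsum (fun x => \sum_(i <- s) F i x) = \sum_(i <- s) zsum (F i).
Proof.
move=> Fs; elim: s => [|i s IH].
  rewrite big_nil; apply: (etrans _ (@zsum0 R)).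
  by apply: eq_zsum => x; rewrite big_nil.
rewrite big_cons -IH -zsumD//; last exact: zsummable_sum.
by apply: eq_zsum => x; rewrite big_cons.
Qed.

Definition ztrunc f n : Z3 -> R := fun x => if x \in zball n then f x else 0.

Lemma zsum_ztrunc f n : zsummable (ztrunc f n) /\ zsum (ztrunc f n) = psum f n.
Proof.
have -> : ztrunc f n = fun x => \sum_(y <- zball n) (if x == y then f y else 0).
  apply/funext => x; rewrite /ztrunc; case: ifPn => xn.
    rewrite (bigD1_seq x) ?zball_uniq//= eqxx big1 ?addr0// => y yx.
    by rewrite eq_sym (negbTE yx).
  rewrite big_seq big1// => y yn; case: eqP => // xy.
  by move: xn; rewrite xy yn.
have z1 y : forall x, x != y -> (if x == y then f y else 0) = 0 by move=> x /negbTE ->.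
split; first by apply: zsummable_sum => y; exact: zsummable1 (z1 y).
rewrite zsum_sum; last by move=> y; exact: zsummable1 (z1 y).
by apply: eq_bigr => y _; rewrite (zsum1 (z1 y)) eqxx.
Qed.

Lemma ztrunc_approx f (e : R) : zsummable f -> 0 < e ->
  exists n, zsum (fun x => `|f x - ztrunc f n x|) <= e.
Proof.
move=> fs e0; have [n hn] := zsum_tail fs e0; exists n.
apply: le_trans hn; rewrite le_eqVlt; apply/orP; left; apply/eqP; apply: eq_zsum => x.
by rewrite /ztrunc; case: ifP; rewrite ?subrr ?normr0 ?subr0.
Qed.

(** Convergence to 0 along the cofinite filter of the lattice: every finite set lies in some
    [zball n]. *)
Definition vanishing w := forall e, 0 < e -> exists n, forall x, x \notin zball n -> `|w x| <= e.

Section Filter.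
Variables (U : set_system nat) (UF : ProperFilter U).

Lemma cvg_psum (g_ : nat -> Z3 -> R) g n : (forall x, g_ i x @[i --> U] --> g x) ->
  psum (g_ i) n @[i --> U] --> psum g n.
Proof.
move=> gg; rewrite /psum; elim: (zball n) => [|y s IH].
  rewrite big_nil (_ : (fun i => _) = fun=> 0); first exact: cvg_cst.
  by apply/funext => i; rewrite big_nil.
rewrite big_cons (_ : (fun i => _) = fun i => g_ i y + \sum_(x <- s) g_ i x).
  by apply: cvgD => //; exact: gg.
by apply/funext => i; rewrite big_cons.
Qed.

Lemma cvg_le_lim (a b : nat -> R) (la lb : R) : a i @[i --> U] --> la ->
  b i @[i --> U] --> lb -> (forall i, a i <= b i) -> la <= lb.
Proof.
move=> ca cb ab; rewrite -(cvg_lim _ ca)// -(cvg_lim _ cb)//; apply: ler_lim.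
- by apply/cvg_ex; exists la.
- by apply/cvg_ex; exists lb.
- by apply: nearW.
Qed.

(** Finite partial sums pass to the limit along any proper filter. The usual sequential argument
    would not cover an ultrafilter, which need not have a countable base. *)
Lemma fatou_zsum (g_ : nat -> Z3 -> R) g (L : nat -> R) l :
  (forall x, g_ i x @[i --> U] --> g x) -> (forall i x, 0 <= g_ i x) ->
  (forall i, zsummable (g_ i)) -> (forall i, zsum (g_ i) <= L i) ->
  L i @[i --> U] --> l -> zsummable g /\ zsum g <= l.
Proof.
move=> gg g0 gs gL Ll.
have g0' x : 0 <= g x.
  by apply: (@cvg_le_lim (fun=> 0) (fun i => g_ i x)) => //; exact: cvg_cst.
have pl n : psum g n <= l.
  apply: (@cvg_le_lim (fun i => psum (g_ i) n) L) => //; first exact: cvg_psum.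
  by move=> i; apply: le_trans (gL i); exact: psum_le_zsum.
have sg : zsummable g.
  apply/zsummableP; exists l => n; apply: le_trans (pl n).
  by apply: psum_le => x; rewrite ger0_norm.
by split => //; exact: zsum_le_bound.
Qed.

(** Weak-star convergence of a sequence bounded in l^1, tested against a weight in c_0: finitely
    many sites converge pointwise, and far away the weight is small against a bounded mass. *)
Lemma weak_cvg_zsum w (C M : R) (g_ : nat -> Z3 -> R) g :
  (forall x, `|w x| <= C) -> vanishing w ->
  (forall x, g_ i x @[i --> U] --> g x) -> (forall i, zsummable (g_ i)) ->
  (forall i, zsum (fun x => `|g_ i x|) <= M) -> zsummable g ->
  zsum (fun x => w x * g_ i x) @[i --> U] --> zsum (fun x => w x * g x).
Proof.
move=> wC wv gg gs gM sg; apply/cvgrPdist_le => e e0.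
pose S := zsum (fun x => `|g x|).
have S0 : 0 <= S by apply: zsum_ge0 => //; exact: zsummable_abs.
have M0 : 0 <= M by apply: le_trans (gM 0%N); apply: zsum_ge0 => //; exact: zsummable_abs.
have MS0 : 0 < M + S + 1 by rewrite ltr_wpDl// addr_ge0.
(* M + S bounds the l^1 norm of [g] minus [g_ i]; the added 1 keeps the divisor positive. *)
have [n hn] := wv (e / 2 / (M + S + 1)) (divr_gt0 (divr_gt0 e0 (ltr0n _ 2)) MS0).
have cp : psum (fun x => w x * g_ i x) n @[i --> U] --> psum (fun x => w x * g x) n.
  by apply: cvg_psum => x; apply: cvgMr; exact: gg.
move/cvgrPdist_le : cp => /(_ (e / 2) (divr_gt0 e0 (ltr0n _ 2))).
apply: filterS => i hi.
pose w' x := if x \in zball n then 0 else w x.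
have w'C x : `|w' x| <= e / 2 / (M + S + 1).
  rewrite /w'; case: ifPn => [_|/hn//]; rewrite normr0.
  by rewrite divr_ge0// ?ltW// divr_gt0.
have split_ f : zsummable f ->
    zsum (fun x => w x * f x) = psum (fun x => w x * f x) n + zsum (fun x => w' x * f x).
  move=> fs; have [st <-] := zsum_ztrunc (fun x => w x * f x) n.
  rewrite -zsumD//; last exact: (zsummable_bmul w'C).
  by apply: eq_zsum => x; rewrite /ztrunc /w'; case: ifP; rewrite ?mul0r ?addr0 ?add0r.
rewrite !split_// opprD addrACA; apply: le_trans (ler_normD _ _) _.
rewrite [leRHS](splitr e); apply: lerD => //.
rewrite -zsumB; [|exact: (zsummable_bmul w'C)|exact: (zsummable_bmul w'C)].
rewrite (@eq_zsum _ _ (fun x => w' x * (g x - g_ i x))); last by move=> x; rewrite mulrBr.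
apply: le_trans (zsum_bmul_le w'C _) _; first exact: zsummableB.
apply: (@le_trans _ _ (e / 2 / (M + S + 1) * (M + S))).
  apply: ler_wpM2l; first by rewrite divr_ge0// ?ltW// divr_gt0.
  rewrite addrC; apply: (@le_trans _ _ (S + zsum (fun x => `|g_ i x|))); last by rewrite lerD2l.
  rewrite /S -zsumD; [|exact: zsummable_abs|exact: zsummable_abs].
  apply: le_zsum => [||x]; last exact: ler_normB.
  - by apply: zsummable_abs; exact: zsummableB.
  - by apply: zsummableD; exact: zsummable_abs.
rewrite -mulrA ler_piMr ?ltW ?divr_gt0//.
by rewrite mulrC ltr_pdivrMr// mul1r ltrDl.
Qed.

End Filter.

End SumsMore.

(** * The bilinear form of the kernel on summable functions *)

Section Form.
Variables (R : realType) (alpha : R).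
Hypothesis halpha : 0 < alpha < 3.
Implicit Types (f g : Z3 -> R).
Local Notation K := (Ralpha alpha).
Local Notation conv := (Rconv alpha).

Definition kform f g := zsum (fun x => conv f x * g x).

Lemma conv_summable f x : zsummable f -> zsummable (fun y => K x y * f y).
Proof. by have [r0 _ Kr] := Ralpha_bounded halpha; exact: zsummable_bmul. Qed.

Lemma convD f g x : zsummable f -> zsummable g ->
  conv (fun y => f y + g y) x = conv f x + conv g x.
Proof.
move=> fs gs; rewrite /Rconv -zsumD; try exact: conv_summable.
by apply: eq_zsum => y; rewrite mulrDr.
Qed.

Lemma convZ c f x : zsummable f -> conv (fun y => c * f y) x = c * conv f x.
Proof.
move=> fs; rewrite /Rconv -zsumZ; last exact: conv_summable.
by apply: eq_zsum => y; rewrite mulrCA.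
Qed.

Lemma conv_bound : exists2 r0, 0 < r0 &
  forall f x, zsummable f -> `|conv f x| <= r0 * zsum (fun y => `|f y|).
Proof.
have [r0 r00 Kr] := Ralpha_bounded halpha; exists r0 => // f x fs.
exact: (zsum_bmul_le (Kr x)).
Qed.

Lemma bil_summable f g : zsummable f -> zsummable g -> zsummable (fun x => conv f x * g x).
Proof.
move=> fs gs; have [r0 r00 cb] := conv_bound.
by apply: zsummable_bmul gs => x; exact: cb.
Qed.

Lemma bil_bound : exists2 r0, 0 < r0 & forall f g, zsummable f -> zsummable g ->
  `|kform f g| <= r0 * zsum (fun y => `|f y|) * zsum (fun y => `|g y|).
Proof.
have [r0 r00 cb] := conv_bound; exists r0 => // f g fs gs.
by apply: zsum_bmul_le => // x; exact: cb.
Qed.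

Lemma bilDl f g k : zsummable f -> zsummable g -> zsummable k ->
  kform (fun x => f x + g x) k = kform f k + kform g k.
Proof.
move=> fs gs ks; rewrite /kform -zsumD; try exact: bil_summable.
by apply: eq_zsum => x; rewrite convD// mulrDl.
Qed.

Lemma bilDr f g k : zsummable f -> zsummable g -> zsummable k ->
  kform k (fun x => f x + g x) = kform k f + kform k g.
Proof.
move=> fs gs ks; rewrite /kform -zsumD; try exact: bil_summable.
by apply: eq_zsum => x; rewrite mulrDr.
Qed.

Lemma bilZl c f g : zsummable f -> zsummable g ->
  kform (fun x => c * f x) g = c * kform f g.
Proof.
move=> fs gs; rewrite /kform -zsumZ; last exact: bil_summable.
by apply: eq_zsum => x; rewrite convZ// mulrA.
Qed.

Lemma bilZr c f g : zsummable f -> zsummable g ->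
  kform f (fun x => c * g x) = c * kform f g.
Proof.
move=> fs gs; rewrite /kform -zsumZ; last exact: bil_summable.
by apply: eq_zsum => x; rewrite mulrCA.
Qed.

Lemma conv_ztrunc f n x : conv (ztrunc f n) x = \sum_(y <- zball n) K x y * f y.
Proof.
rewrite /Rconv -[RHS](zsum_ztrunc (fun y => K x y * f y) n).2; apply: eq_zsum => y.
by rewrite /ztrunc; case: ifP; rewrite ?mulr0.
Qed.

Lemma ztrunc_summable f n : zsummable (ztrunc f n).
Proof. exact: (zsum_ztrunc f n).1. Qed.

Lemma bil_ztrunc_l f g n : zsummable g ->
  kform (ztrunc f n) g = \sum_(x <- zball n) f x * conv g x.
Proof.
move=> gs; rewrite /kform.
transitivity (zsum (fun y => \sum_(x <- zball n) f x * (K x y * g y))).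
  apply: eq_zsum => y; rewrite conv_ztrunc mulr_suml; apply: eq_bigr => x _.
  by rewrite RalphaC; ring.
rewrite zsum_sum; last by move=> x; apply: zsummableZ; exact: conv_summable.
by apply: eq_bigr => x _; rewrite zsumZ//; exact: conv_summable.
Qed.

Lemma bil_ztrunc_r f g n : kform g (ztrunc f n) = \sum_(x <- zball n) f x * conv g x.
Proof.
rewrite /kform -[RHS](zsum_ztrunc (fun x => f x * conv g x) n).2.
by apply: eq_zsum => x; rewrite /ztrunc; case: ifP; rewrite ?mulr0// mulrC.
Qed.

(** The error depends on [k] only through its l^1 norm. The uniformity matters in [bil_ge0], where
    [k] is a truncation that itself depends on [n]. *)
Lemma bil_approx f g (e : R) : zsummable f -> zsummable g -> 0 < e ->
  exists n, forall k, zsummable k -> zsum (fun x => `|k x|) <= zsum (fun x => `|g x|) ->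
    `|kform (fun x => f x - ztrunc f n x) k| <= e /\
    `|kform k (fun x => f x - ztrunc f n x)| <= e.
Proof.
move=> fs gs e0; have [r0 r00 bb] := bil_bound.
have g0 : 0 <= zsum (fun x => `|g x|) by apply: zsum_ge0 => //; exact: zsummable_abs.
have c0 : 0 < r0 * (zsum (fun x => `|g x|) + 1) by rewrite mulr_gt0// ltr_wpDl.
have [n hn] := ztrunc_approx fs (divr_gt0 e0 c0); exists n => k ks kg.
have ds : zsummable (fun x => f x - ztrunc f n x).
  by apply: zsummableB => //; exact: ztrunc_summable.
have d0 : 0 <= zsum (fun x => `|f x - ztrunc f n x|).
  by apply: zsum_ge0 => //; exact: zsummable_abs.
have k0 : 0 <= zsum (fun x => `|k x|) by apply: zsum_ge0 => //; exact: zsummable_abs.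
have key : r0 * zsum (fun x => `|k x|) * zsum (fun x => `|f x - ztrunc f n x|) <= e.
  move: hn; rewrite ler_pdivlMr// => hn; apply: le_trans hn.
  rewrite [leRHS]mulrC; apply: ler_wpM2r => //; apply: ler_wpM2l; first exact: ltW.
  by rewrite (le_trans kg)// lerDl.
split; last exact: le_trans (bb _ _ ks ds) key.
apply: le_trans (bb _ _ ds ks) _; rewrite mulrAC; exact: key.
Qed.

Lemma ztrunc_decomp f n : f = fun x => ztrunc f n x + (f x - ztrunc f n x).
Proof. by apply/funext => x; rewrite addrC subrK. Qed.

(** An exchange of two infinite sums. When [f] is truncated, both sides reduce to the same finite
    sum of f(x) times the convolution of [g] at x, by symmetry of the kernel; the truncation error
    is arbitrarily small. *)
Lemma bilC f g : zsummable f -> zsummable g -> kform f g = kform g f.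
Proof.
move=> fs gs; apply/eqP; rewrite -subr_eq0 -normr_le0; apply/ler_addgt0Pr => e e0.
rewrite add0r; have [n /(_ g gs (lexx _)) [h1 h2]] := bil_approx fs gs (divr_gt0 e0 (ltr0n _ 2)).
have ts := ztrunc_summable f n.
have ds : zsummable (fun x => f x - ztrunc f n x) by exact: zsummableB.
have -> : kform f g = kform (ztrunc f n) g + kform (fun x => f x - ztrunc f n x) g.
  by rewrite -bilDl// -ztrunc_decomp.
have -> : kform g f = kform g (ztrunc f n) + kform g (fun x => f x - ztrunc f n x).
  by rewrite -bilDr// -ztrunc_decomp.
rewrite bil_ztrunc_l// bil_ztrunc_r opprD addrACA subrr add0r.
by apply: le_trans (ler_normB _ _) _; rewrite [leRHS](splitr e) lerD.
Qed.

(** Semidefiniteness is known for finite families, that is for the truncation of [f]; restoring [f]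
    in one argument after the other costs at most e/2 each time. *)
Lemma bil_ge0 f : zsummable f -> 0 <= kform f f.
Proof.
move=> fs; apply/ler_addgt0Pr => e e0.
have [n hn] := bil_approx fs fs (divr_gt0 e0 (ltr0n _ 2)).
have ts := ztrunc_summable f n.
have ds : zsummable (fun x => f x - ztrunc f n x) by exact: zsummableB.
have [h1 _] := hn f fs (lexx _).
have tf : zsum (fun x => `|ztrunc f n x|) <= zsum (fun x => `|f x|).
  apply: le_zsum => [||x]; [exact: zsummable_abs|exact: zsummable_abs|].
  by rewrite /ztrunc; case: ifP; rewrite ?normr0.
have [_ h2] := hn _ ts tf.
have t0 : 0 <= kform (ztrunc f n) (ztrunc f n).
  rewrite bil_ztrunc_l//; have := Ralpha_psd halpha [seq (f x, x) | x <- zball n].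
  rewrite big_map => h; apply: le_trans h _; rewrite le_eqVlt; apply/orP; left; apply/eqP.
  apply: eq_bigr => x _; rewrite big_map conv_ztrunc mulr_sumr; apply: eq_bigr => y _ /=.
  by ring.
have -> : kform f f = kform (ztrunc f n) (ztrunc f n) + kform (ztrunc f n) (fun x => f x - ztrunc f n x)
   + kform (fun x => f x - ztrunc f n x) f.
  rewrite -bilDr// -ztrunc_decomp -bilDl//; congr (kform _ f); exact: ztrunc_decomp.
move: h1 h2; rewrite !ler_norml => /andP[? _] /andP[? _]; lra.
Qed.

Lemma Ralpha_vanishing_seq (s : seq Z3) (e : R) : 0 < e ->
  exists n, forall x, x \notin zball n -> forall y, y \in s -> `|K x y| <= e.
Proof.
move=> e0; elim: s => [|y s [n hn]]; first by exists 0%N.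
have [m hm] := Ralpha_decay halpha y e0; exists (maxn n m) => x xn z.
have xn' : x \notin zball n by apply: contra xn; apply: zball_leq; rewrite leq_maxl.
have xm' : x \notin zball m by apply: contra xn; apply: zball_leq; rewrite leq_maxr.
by rewrite inE => /orP[/eqP ->|/hn]; [rewrite RalphaC; exact: hm|apply].
Qed.

Lemma Ralpha_vanishing x : vanishing (K x).
Proof. by move=> e e0; exact: Ralpha_decay. Qed.

(** The truncated part is a finite combination of kernels, each tending to 0; the remainder is
    uniformly small because the kernel is bounded. *)
Lemma conv_vanishing f : zsummable f -> vanishing (conv f).
Proof.
move=> fs e e0; have [r0 r00 cb] := conv_bound.
have e2 : 0 < e / 2 by rewrite divr_gt0.
have [m hm] := ztrunc_approx fs (divr_gt0 e2 r00).
have f0 : 0 <= zsum (fun x => `|f x|) by apply: zsum_ge0 => //; exact: zsummable_abs.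
have F0 : 0 < zsum (fun x => `|f x|) + 1 by rewrite ltr_wpDl.
have [n hn] := Ralpha_vanishing_seq (zball m) (divr_gt0 e2 F0).
exists n => x xn.
have ts := ztrunc_summable f m.
have ds : zsummable (fun x => f x - ztrunc f m x) by exact: zsummableB.
rewrite (ztrunc_decomp f m) convD//; apply: le_trans (ler_normD _ _) _.
rewrite [leRHS](splitr e); apply: lerD; last first.
  by apply: le_trans (cb _ x ds) _; rewrite mulrC -ler_pdivlMr.
rewrite conv_ztrunc; apply: le_trans (ler_norm_sum _ _ _) _.
apply: (@le_trans _ _ (\sum_(y <- zball m) e / 2 / (zsum (fun x => `|f x|) + 1) * `|f y|)).
  rewrite big_seq [leRHS]big_seq; apply: ler_sum => y ym.
  by rewrite normrM ler_wpM2r// hn.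
rewrite -mulr_sumr mulrAC ler_pdivrMr//; apply: ler_wpM2l; first exact: ltW.
apply: (@le_trans _ _ (zsum (fun x => `|f x|))); last by rewrite lerDl.
exact: (psum_le_zsum m (zsummable_abs fs)).
Qed.

End Form.

(** * Square-summable functions *)

Section SquareSummable.
Variable R : realType.
Implicit Types (u v : Z3 -> R).

(** The working form of the space H: for a weight between two positive constants both describe the
    same functions, see [inHP]. *)
Definition l2 u := zsummable (fun x => u x ^+ 2).

Lemma l2_le u v (C : R) : l2 v -> (forall x, `|u x| <= C * `|v x|) -> l2 u.
Proof.
move=> lv uv; apply: (@zsummable_le _ _ (fun x => C ^+ 2 * v x ^+ 2)); first exact: zsummableZ.
move=> x; rewrite ger0_norm ?sqr_ge0// -[u x ^+ 2]real_normK ?num_real//.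
rewrite -[v x ^+ 2]real_normK ?num_real// -exprMn lerXn2r ?nnegrE//.
exact: le_trans (uv x).
Qed.

Lemma l2_mul u v : l2 u -> l2 v -> zsummable (fun x => u x * v x).
Proof.
move=> lu lv; apply: (@zsummable_le _ _ (fun x => u x ^+ 2 + v x ^+ 2)); first exact: zsummableD.
move=> x; rewrite ler_norml; have := sqr_ge0 (u x + v x); have := sqr_ge0 (u x - v x).
have := sqr_ge0 (u x); have := sqr_ge0 (v x).
by rewrite sqrrB sqrrD => *; apply/andP; split; lra.
Qed.

Lemma l2Z c u : l2 u -> l2 (fun x => c * u x).
Proof. by move=> lu; apply: (l2_le lu (C := `|c|)) => x; rewrite normrM. Qed.

Lemma l2D u v : l2 u -> l2 v -> l2 (fun x => u x + v x).
Proof.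
move=> lu lv; apply: (@zsummable_le _ _ (fun x => 2 * u x ^+ 2 + 2 * v x ^+ 2)).
  by apply: zsummableD; apply: zsummableZ.
move=> x; rewrite ger0_norm ?sqr_ge0//; have := sqr_ge0 (u x - v x).
by rewrite sqrrB sqrrD; lra.
Qed.

Lemma l2N u : l2 u -> l2 (fun x => - u x).
Proof. by move=> lu; apply: (l2_le lu (C := 1)) => x; rewrite normrN mul1r. Qed.

Lemma l2B u v : l2 u -> l2 v -> l2 (fun x => u x - v x).
Proof. by move=> lu lv; apply: l2D => //; exact: l2N. Qed.

Lemma l2_sum (I : Type) (s : seq I) (F : I -> Z3 -> R) :
  (forall i, l2 (F i)) -> l2 (fun x => \sum_(i <- s) F i x).
Proof.
move=> Fs; elim: s => [|i s IH].
  rewrite (_ : (fun x => _) = (fun=> 0)); last by apply/funext => x; rewrite big_nil.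
  by rewrite /l2 (_ : (fun x => _) = (fun=> 0)) ?expr0n//; exact: zsummable0.
rewrite (_ : (fun x => _) = (fun x => F i x + \sum_(i <- s) F i x)); first exact: l2D.
by apply/funext => x; rewrite big_cons.
Qed.

Lemma l2_reindex (s : Z3 -> Z3) u : bijective s -> l2 u -> l2 (fun x => u (s x)).
Proof. by move=> bs lu; exact: (zsummable_reindex bs lu). Qed.

Lemma l2_bounded_by u (M : R) : l2 u -> 0 <= M -> zsum (fun x => u x ^+ 2) <= M ^+ 2 ->
  forall x, `|u x| <= M.
Proof.
move=> lu M0 uM x; rewrite -(@ler_sqr R) ?nnegrE ?normr_ge0// real_normK ?num_real//.
apply: le_trans uM; apply: (@le_zsum1 R (fun x => u x ^+ 2)) => // y; exact: sqr_ge0.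
Qed.

Lemma l2_bounded u : l2 u -> exists2 M, 0 < M & forall x, `|u x| <= M.
Proof.
move=> lu; have s0 : 0 <= zsum (fun x => u x ^+ 2).
  by apply: zsum_ge0 => // x; exact: sqr_ge0.
exists (zsum (fun x => u x ^+ 2) + 1); first by rewrite ltr_wpDl.
apply: l2_bounded_by => //; first by rewrite addr_ge0.
rewrite sqrrD expr1n mulr1; have := sqr_ge0 (zsum (fun x => u x ^+ 2)); lra.
Qed.

Lemma powR_split (p t : R) : 2 < p -> `|t| `^ p = `|t| `^ (p - 2) * t ^+ 2.
Proof.
move=> p2; have [->|t0] := eqVneq t 0.
  by rewrite normr0 expr0n/= mulr0 powR0// gt_eqF//; lra.
rewrite -real_normK ?num_real// -powR_mulrn// -powRD; first by congr powR; ring.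
by rewrite normr_eq0 t0 implybT.
Qed.

Lemma powR_le_sqr (p t M : R) : 2 < p -> `|t| <= M -> `|t| `^ p <= M `^ (p - 2) * t ^+ 2.
Proof.
move=> p2 tM; rewrite powR_split// ler_wpM2r ?sqr_ge0//.
have M0 : 0 <= M by apply: le_trans tM.
by apply: ge0_ler_powR => //; rewrite ?nnegrE//; lra.
Qed.

Lemma l2_powR u (p : R) : 2 < p -> l2 u -> zsummable (fun x => `|u x| `^ p).
Proof.
move=> p2 lu; have [M M0 uM] := l2_bounded lu.
apply: (@zsummable_le _ _ (fun x => M `^ (p - 2) * u x ^+ 2)); first exact: zsummableZ.
by move=> x; rewrite ger0_norm ?powR_ge0//; exact: powR_le_sqr.
Qed.

Lemma ZshiftK (j : 'I_3) (t : int) : cancel (fun x => Zshift x j t) (fun x => Zshift x j (- t)).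
Proof.
by move=> [[x y] z]; rewrite /Zshift; case: (val j) => [|[|n]] /=; rewrite addrK.
Qed.

Lemma Zshift_bij (j : 'I_3) (t : int) : bijective (fun x => Zshift x j t).
Proof.
exists (fun x => Zshift x j (- t)); first exact: ZshiftK.
by move=> x; have := ZshiftK j (- t) x; rewrite opprK.
Qed.

Lemma sum_nbrs (F : Z3 -> R) x : \sum_(y <- nbrs x) F y =
  \sum_(j < 3) (F (Zshift x j 1) + F (Zshift x j (-1))).
Proof.
have E (G : 'I_3 -> R) : \sum_(j <- Finite.enum 'I_3) G j = \sum_(j < 3) G j.
  by rewrite -enumT big_enum.
by rewrite /nbrs big_cat !big_map big_split /= !E.
Qed.

Lemma gradsq_ge0 u x : 0 <= gradsq u x.
Proof.
by rewrite /gradsq mulr_ge0 ?invr_ge0// sumr_ge0// => y _; exact: sqr_ge0.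
Qed.

Let l2_shift u j t : l2 u -> l2 (fun x => u (Zshift x j t)).
Proof. by move=> lu; exact: l2_reindex (Zshift_bij j t) lu. Qed.

Lemma gradprod_summable u v : l2 u -> l2 v -> zsummable (gradprod u v).
Proof.
move=> lu lv; rewrite (_ : gradprod u v = fun x => 2^-1 * \sum_(j < 3)
    ((u (Zshift x j 1) - u x) * (v (Zshift x j 1) - v x) +
     (u (Zshift x j (-1)) - u x) * (v (Zshift x j (-1)) - v x))); last first.
  by apply/funext => x; rewrite /gradprod sum_nbrs.
apply: zsummableZ; apply: zsummable_sum => j.
by apply: zsummableD; apply: l2_mul; apply: l2B => //; exact: l2_shift.
Qed.

Lemma gradsq_summable u : l2 u -> zsummable (gradsq u).
Proof. by move=> lu; exact: (gradprod_summable lu lu). Qed.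

Lemma Lap_l2 u : l2 u -> l2 (Lap u).
Proof.
move=> lu; rewrite (_ : Lap u = fun x => \sum_(j < 3)
    ((u (Zshift x j 1) - u x) + (u (Zshift x j (-1)) - u x))); last first.
  by apply/funext => x; rewrite /Lap sum_nbrs.
by apply: l2_sum => j; apply: l2D; apply: l2B => //; exact: l2_shift.
Qed.

(** Every edge is seen from both of its ends. Translating the sum by one step moves [v] at the
    neighbour back to [v] at the centre, so each edge contributes twice, which the factor 1/2 in
    [gradprod] compensates. *)
Lemma sum_by_parts u v : l2 u -> l2 v ->
  zsum (gradprod u v) = - zsum (fun x => Lap u x * v x).
Proof.
move=> lu lv.
pose A j t := zsum (fun x => (u (Zshift x j t) - u x) * v x).
have sA j t : zsummable (fun x => (u (Zshift x j t) - u x) * v x).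
  by apply: l2_mul => //; apply: l2B => //; exact: l2_shift.
have sP j t : zsummable (fun x => (u (Zshift x j t) - u x) * (v (Zshift x j t) - v x)).
  by apply: l2_mul; apply: l2B => //; exact: l2_shift.
have P j t : zsum (fun x => (u (Zshift x j t) - u x) * (v (Zshift x j t) - v x)) =
    - (A j t + A j (- t)).
  rewrite (@eq_zsum _ _ (fun x => (u (Zshift x j t) - u x) * v (Zshift x j t)
      - (u (Zshift x j t) - u x) * v x)); last by move=> x; rewrite mulrBr.
  rewrite zsumB//; last by apply: l2_mul; [apply: l2B => //|]; exact: l2_shift.
  rewrite -(zsum_reindex _ (Zshift_bij j (- t))).
  rewrite (@eq_zsum _ _ (fun x => - ((u (Zshift x j (- t)) - u x) * v x))).
    by rewrite zsumN// /A; ring.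
  by move=> x; have := ZshiftK j (- t) x; rewrite opprK => ->; ring.
transitivity (2^-1 * \sum_(j < 3) (- (A j 1 + A j (-1)) - (A j (-1) + A j 1))).
  rewrite (@eq_zsum _ _ (fun x => 2^-1 * \sum_(j < 3)
    ((u (Zshift x j 1) - u x) * (v (Zshift x j 1) - v x) +
     (u (Zshift x j (-1)) - u x) * (v (Zshift x j (-1)) - v x)))); last first.
    by move=> x; rewrite /gradprod sum_nbrs.
  rewrite zsumZ; last by apply: zsummable_sum => j; exact: zsummableD.
  rewrite zsum_sum; last by move=> j; exact: zsummableD.
  by congr (_ * _); apply: eq_bigr => j _; rewrite zsumD// !P opprK.
rewrite (@eq_zsum _ (fun x => Lap u x * v x) (fun x => \sum_(j < 3)
    ((u (Zshift x j 1) - u x) * v x + (u (Zshift x j (-1)) - u x) * v x))); last first.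
  by move=> x; rewrite /Lap sum_nbrs mulr_suml; apply: eq_bigr => j _; rewrite mulrDl.
rewrite zsum_sum; last by move=> j; exact: zsummableD.
rewrite mulr_sumr -sumrN; apply: eq_bigr => j _; rewrite zsumD// -/(A j 1) -/(A j (-1)).
by field.
Qed.

(** From (s - t)^2 <= 2 s^2 + 2 t^2 on each edge, every one of the three directions contributes 4
    times the square sum. *)
Lemma zsum_gradsq_le u : l2 u -> zsum (gradsq u) <= 12 * zsum (fun x => u x ^+ 2).
Proof.
move=> lu; have ls j t : zsummable (fun x => u (Zshift x j t) ^+ 2) by exact: l2_shift.
have l3 j : zsummable (fun x => u (Zshift x j 1) ^+ 2 + u (Zshift x j (-1)) ^+ 2 + 2 * u x ^+ 2).
  by apply: zsummableD; [exact: zsummableD|exact: zsummableZ].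
apply: (@le_trans _ _ (zsum (fun x => \sum_(j < 3)
    (u (Zshift x j 1) ^+ 2 + u (Zshift x j (-1)) ^+ 2 + 2 * u x ^+ 2)))).
  apply: le_zsum; [exact: gradsq_summable|exact: zsummable_sum|] => x.
  rewrite /gradsq sum_nbrs mulr_sumr; apply: ler_sum => j _.
  have := sqr_ge0 (u (Zshift x j 1) + u x); have := sqr_ge0 (u (Zshift x j (-1)) + u x).
  by lra.
rewrite zsum_sum// (eq_bigr (fun=> 4 * zsum (fun x => u x ^+ 2))).
  by rewrite sumr_const card_ord; lra.
move=> j _; rewrite zsumD; [|exact: zsummableD|exact: zsummableZ].
rewrite zsumD// zsumZ// !(zsum_reindex (fun x => u x ^+ 2) (Zshift_bij j _)).
by ring.
Qed.

Lemma Lap_gradsq0 u x : gradsq u x = 0 -> Lap u x = 0.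
Proof.
rewrite /gradsq /Lap => /eqP; rewrite mulf_eq0 invr_eq0 pnatr_eq0/= psumr_eq0.
  move=> /allP h; rewrite big_seq big1// => y yn; apply/eqP.
  by have := h y yn; rewrite /= sqrf_eq0.
by move=> y _; exact: sqr_ge0.
Qed.

Variable h : Z3 -> R.
Variables (h0 h1 : R).
Hypothesis h00 : 0 < h0.
Hypothesis hlow : forall x, h0 <= h x.
Hypothesis hup : forall x, h x <= h1.

Lemma l2_weight u : l2 u -> zsummable (fun x => h x * u x ^+ 2).
Proof.
apply: zsummable_bmul (h1) _ => x.
by rewrite ger0_norm// (le_trans (ltW h00)).
Qed.

(** The lower bound on [h] gives one direction. For the other, the gradient is bounded on l^2, so
    truncations of [u] converge to [u] in the H^1 norm. *)
Lemma inHP u : inH h u <-> l2 u.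
Proof.
split=> [[_ hu]|lu].
  apply: (@zsummable_le _ _ (fun x => h0^-1 * (h x * u x ^+ 2))); first exact: zsummableZ.
  move=> x; rewrite ger0_norm ?sqr_ge0// mulrA ler_peMl ?sqr_ge0//.
  by rewrite mulrC ler_pdivlMr// mul1r.
split; last exact: l2_weight.
split; first by apply: zsummableD => //; exact: gradsq_summable.
exists (fun n => ztrunc u n); split=> [n|].
  apply: (@sub_finite_set _ _ [set` zball n]); last exact: finite_seq.
  by move=> x /=; rewrite /ztrunc; case: ifP => // _; rewrite eqxx.
have lt n : l2 (fun x => ztrunc u n x - u x).
  apply: (l2_le lu (C := 1)) => x; rewrite mul1r /ztrunc.
  by case: ifP; rewrite ?subrr ?normr0 ?sub0r ?normrN.
(* 13 = 12 + 1: the gradient bound plus the square itself. *)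
have bound n : 0 <= H1sq (fun x => ztrunc u n x - u x) <=
    13 * (zsum (fun x => u x ^+ 2) - psum (fun x => u x ^+ 2) n).
  rewrite /H1sq; have sg := gradsq_summable (lt n); apply/andP; split.
    apply: zsum_ge0 => [|x]; first exact: zsummableD sg (lt n).
    by rewrite addr_ge0 ?gradsq_ge0 ?sqr_ge0.
  have -> : zsum (fun x => u x ^+ 2) - psum (fun x => u x ^+ 2) n =
      zsum (fun x => (ztrunc u n x - u x) ^+ 2).
    have [st <-] := zsum_ztrunc (fun x => u x ^+ 2) n.
    rewrite -zsumB//; apply: eq_zsum => x.
    by rewrite /ztrunc; case: ifP; rewrite ?subrr ?expr0n// sub0r subr0 sqrrN.
  rewrite zsumD//; last exact: lt.
  by have := zsum_gradsq_le (lt n); lra.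
apply: (@squeeze_cvgr _ _ _ _ (fun=> 0)
  (fun n => 13 * (zsum (fun x => u x ^+ 2) - psum (fun x => u x ^+ 2) n))).
- exact: nearW.
- exact: cvg_cst.
- have c : 13 * (zsum (fun x => u x ^+ 2) - psum (fun x => u x ^+ 2) n) @[n --> \oo] -->
      13 * (zsum (fun x => u x ^+ 2) - zsum (fun x => u x ^+ 2)).
    by apply: cvgMr; apply: cvgB; [exact: cvg_cst|exact: psum_cvg].
  by rewrite subrr mulr0 in c.
Qed.

End SquareSummable.

(** * Energies and the Nehari manifold *)

Section PowR.
Variable R : realType.

(** Young's inequality with exponents r and r / (r - 1), applied to the product of [x] and 1. *)
Lemma bernoulli_powR (r x : R) : 1 < r -> 0 <= x -> 1 + r * (x - 1) <= x `^ r.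
Proof.
move=> r1 x0; have r0 : 0 < r by lra.
have rn : r != 0 by rewrite gt_eqF.
have r1n : r - 1 != 0 by rewrite subr_eq0 gt_eqF.
have q0 : 0 < r / (r - 1) by rewrite divr_gt0// subr_gt0.
have e : r^-1 + (r / (r - 1))^-1 = 1 by field; rewrite rn r1n.
have := conjugate_powR x0 ler01 r0 q0 e.
rewrite mulr1 powR1 div1r invf_div => h.
have : r * x <= r * (x `^ r / r + (r - 1) / r) by rewrite ler_pM2l.
have -> : r * (x `^ r / r + (r - 1) / r) = x `^ r + (r - 1) by field.
lra.
Qed.

Lemma norm_powR_continuous (r : R) : 0 < r -> continuous (fun x : R => `|x| `^ r).
Proof.
move=> r0 x; have [->|x0] := eqVneq x 0.
  apply/cvgrPdist_le => e e0; rewrite normr0 powR0 ?gt_eqF//.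
  have d0 : 0 < e `^ r^-1 by exact: powR_gt0.
  have ee : (e `^ r^-1) `^ r = e by rewrite -powRrM mulVf ?gt_eqF// powRr1// ltW.
  exists (e `^ r^-1) => // y; rewrite /ball_/= sub0r normrN => yd.
  rewrite sub0r normrN ger0_norm ?powR_ge0//.
  by rewrite -[leRHS]ee; apply: ge0_ler_powR; rewrite ?nnegrE//; exact: ltW.
have n0 : 0 < `|x| by rewrite normr_gt0.
apply: (@continuous_comp _ _ _ (fun x : R => `|x|) (fun t => t `^ r)).
  exact: norm_continuous.
apply/differentiable_continuous/derivable1_diffP.
by have := is_derive1_powR r n0 => -[].
Qed.

(* Young's inequality gives the tangent line below the convex function [|t|^p]. *)
Lemma powR_tangent (p x y : R) : 2 < p ->
  `|x| `^ p + p * (`|x| `^ (p - 2) * x) * (y - x) <= `|y| `^ p.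
Proof.
move=> p2; have p0 : 0 < p by lra.
have pn : p != 0 by rewrite gt_eqF.
have p1n : p - 1 != 0 by rewrite subr_eq0 gt_eqF//; lra.
have q0 : 0 < p / (p - 1) by rewrite divr_gt0// subr_gt0; lra.
have e : p^-1 + (p / (p - 1))^-1 = 1 by field; rewrite pn p1n.
have a0 : 0 <= `|x| `^ (p - 2) * `|x| by rewrite mulr_ge0// powR_ge0.
have := conjugate_powR (normr_ge0 y) a0 p0 q0 e.
have -> : (`|x| `^ (p - 2) * `|x|) `^ (p / (p - 1)) = `|x| `^ p.
  have -> : `|x| `^ (p - 2) * `|x| = `|x| `^ (p - 1).
    rewrite mulrC; have -> : p - 2 = p - 1 - 1 by ring.
    by rewrite mulr_powRB1// subr_gt0; lra.
  by rewrite -powRrM; congr powR; field.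
rewrite invf_div => h.
have h' : p * (`|y| * (`|x| `^ (p - 2) * `|x|)) <= `|y| `^ p + (p - 1) * `|x| `^ p.
  have -> : `|y| `^ p + (p - 1) * `|x| `^ p = p * (`|y| `^ p / p + `|x| `^ p * ((p - 1) / p)).
    by field.
  by rewrite ler_pM2l.
have xy : x * y <= `|y| * `|x| by rewrite mulrC -normrM ler_norm.
have w0 : 0 <= `|x| `^ (p - 2) by exact: powR_ge0.
have h2 : `|x| `^ (p - 2) * (x * y) <= `|x| `^ (p - 2) * (`|y| * `|x|) by rewrite ler_wpM2l.
have h3 : p * (`|x| `^ (p - 2) * (x * y)) <= p * (`|x| `^ (p - 2) * (`|y| * `|x|)).
  by rewrite ler_pM2l.
have sp := powR_split x p2.
have -> : p * (`|x| `^ (p - 2) * x) * (y - x) =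
   p * (`|x| `^ (p - 2) * (x * y)) - p * (`|x| `^ (p - 2) * x ^+ 2) by ring.
rewrite -sp.
have e3 : p * (`|y| * (`|x| `^ (p - 2) * `|x|)) = p * (`|x| `^ (p - 2) * (`|y| * `|x|)) by ring.
rewrite e3 in h'.
have e4 : (p - 1) * `|x| `^ p = p * `|x| `^ p - `|x| `^ p by ring.
rewrite e4 in h'; lra.
Qed.

End PowR.

(** * Energies, rays and the Nehari manifold *)

Section Energy.
Variables (R : realType) (a b alpha p : R) (h : Z3 -> R) (h0 h1 : R).
Hypothesis ha : 0 < a.
Hypothesis hb : 0 < b.
Hypothesis halpha : 0 < alpha < 3.
Hypothesis hp : 2 < p.
Hypothesis h00 : 0 < h0.
Hypothesis hlow : forall x, h0 <= h x.
Hypothesis hup : forall x, h x <= h1.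
Implicit Types (u v w : Z3 -> R).
Local Notation conv := (Rconv alpha).
Local Notation bil := (kform alpha).

Definition dens u : Z3 -> R := fun x => `|u x| `^ p.
Definition energy_N u := Hnormsq a h u.
Definition EG u := zsum (gradsq u).
Definition energy_D u := bil (dens u) (dens u).
Definition nehari_F u := energy_N u + b * EG u ^+ 2 - energy_D u.
Local Notation J := (Jfun a b alpha p h).
Local Notation NM := (Nehari a b alpha p h).

(** The energy, and below it the Nehari functional, along the ray through a function. As functions
    of three numbers they can also be evaluated at limits of energies, which need not be the
    energies of any function. *)
Definition fibre_J t N G D := t ^+ 2 / 2 * N + b / 4 * t ^+ 4 * G ^+ 2 - (2 * p)^-1 * (t `^ p) ^+ 2 * D.
Definition fibre_F t N G D := t ^+ 2 * N + b * t ^+ 4 * G ^+ 2 - (t `^ p) ^+ 2 * D.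

Let h_ge0 x : 0 <= h x. Proof. exact: le_trans (ltW h00) (hlow x). Qed.
Let sh u : l2 u -> zsummable (fun x => h x * u x ^+ 2).
Proof. exact: (l2_weight h00 hlow hup). Qed.

Lemma dens_summable u : l2 u -> zsummable (dens u).
Proof. exact: l2_powR. Qed.

Lemma dens_ge0 u x : 0 <= dens u x. Proof. exact: powR_ge0. Qed.

Lemma ENE u : l2 u -> energy_N u = a * EG u + zsum (fun x => h x * u x ^+ 2).
Proof.
move=> lu; rewrite /energy_N /Hnormsq zsumD; [|apply: zsummableZ; exact: gradsq_summable|exact: sh].
by rewrite zsumZ//; exact: gradsq_summable.
Qed.

Lemma EG_ge0 u : l2 u -> 0 <= EG u.
Proof.
by move=> lu; apply: zsum_ge0 => [|x]; [exact: gradsq_summable|exact: gradsq_ge0].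
Qed.

Lemma EN_ge u : l2 u -> h0 * zsum (fun x => u x ^+ 2) <= energy_N u.
Proof.
move=> lu; rewrite ENE//; have : 0 <= a * EG u by rewrite mulr_ge0 ?EG_ge0// ltW.
suff : h0 * zsum (fun x => u x ^+ 2) <= zsum (fun x => h x * u x ^+ 2) by lra.
rewrite -zsumZ//; apply: le_zsum => [||x]; [exact: zsummableZ|exact: sh|].
by rewrite ler_wpM2r ?sqr_ge0.
Qed.

Lemma EN_ge1 u z : l2 u -> h0 * u z ^+ 2 <= energy_N u.
Proof.
move=> lu; apply: le_trans (EN_ge lu); apply: ler_wpM2l; first exact: ltW.
by apply: (@le_zsum1 R (fun x => u x ^+ 2)) => // x; exact: sqr_ge0.
Qed.

Lemma EN_gt0 u z : l2 u -> u z != 0 -> 0 < energy_N u.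
Proof.
move=> lu uz; apply: lt_le_trans (EN_ge1 z lu); rewrite mulr_gt0//.
by rewrite lt_neqAle sqr_ge0 andbT eq_sym sqrf_eq0.
Qed.

Lemma EN_ge0 u : l2 u -> 0 <= energy_N u.
Proof.
move=> lu; apply: le_trans (EN_ge1 (0, 0, 0) lu); rewrite mulr_ge0 ?sqr_ge0//; exact: ltW.
Qed.

Lemma ED_ge0 u : l2 u -> 0 <= energy_D u.
Proof. by move=> lu; apply: bil_ge0 => //; exact: dens_summable. Qed.

(** The pointwise residual of the equation. The coefficient [A] is kept apart from [EG u] because
    the limit equation is first obtained with the limit of the gradient energies. *)
Definition EL A u x := - (a + b * A) * Lap u x + h x * u x
  - conv (dens u) x * `|u x| `^ (p - 2) * u x.

Lemma EL_summable u phi : l2 u -> l2 phi ->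
  [/\ zsummable (fun x => Lap u x * phi x), zsummable (fun x => h x * u x * phi x) &
   zsummable (fun x => conv (dens u) x * `|u x| `^ (p - 2) * u x * phi x)].
Proof.
move=> lu lphi; have up := l2_mul lu lphi; split.
- by apply: l2_mul => //; exact: Lap_l2.
- rewrite (_ : (fun x => _) = fun x => h x * (u x * phi x)); last by apply/funext => x; rewrite mulrA.
  by apply: zsummable_bmul (h1) _ up => x; rewrite ger0_norm.
have [r0 r00 cb] := conv_bound halpha; have [M M0 uM] := l2_bounded lu.
rewrite (_ : (fun x => _) = fun x => (conv (dens u) x * `|u x| `^ (p - 2)) * (u x * phi x)); last first.
  by apply/funext => x; rewrite !mulrA.
apply: zsummable_bmul (r0 * zsum (fun y => `|dens u y|) * M `^ (p - 2)) _ up => x.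
rewrite normrM ler_pM//; first by apply: cb; exact: dens_summable.
have p2 := hp; rewrite ger0_norm ?powR_ge0//.
by apply: ge0_ler_powR; rewrite ?nnegrE//; lra.
Qed.

Lemma dJE u phi : l2 u -> l2 phi ->
  dJ a b alpha p h u phi = zsum (fun x => EL (EG u) u x * phi x).
Proof.
move=> lu lphi; have [s1 s2 s3] := EL_summable lu lphi.
have sg := gradprod_summable lu lphi.
rewrite /dJ -/(dens u) -/(EG u) zsumD//; last exact: zsummableZ.
rewrite zsumZ// sum_by_parts//.
rewrite (@eq_zsum _ (fun x => EL (EG u) u x * phi x) (fun x => (- (a + b * EG u)) *
   (Lap u x * phi x) + h x * u x * phi x - conv (dens u) x * `|u x| `^ (p - 2) * u x * phi x)).
  rewrite zsumB//; last by apply: zsummableD => //; exact: zsummableZ.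
  by rewrite zsumD//; [rewrite zsumZ//; ring|exact: zsummableZ].
by move=> x; rewrite /EL; ring.
Qed.

Lemma EL_self A u : l2 u ->
  zsum (fun x => EL A u x * u x) = energy_N u + b * A * EG u - energy_D u.
Proof.
move=> lu; have [s1 s2 s3] := EL_summable lu lu.
rewrite (@eq_zsum _ _ (fun x => (- (a + b * A)) *
   (Lap u x * u x) + h x * u x * u x - conv (dens u) x * `|u x| `^ (p - 2) * u x * u x)).
  rewrite zsumB//; last by apply: zsummableD => //; exact: zsummableZ.
  rewrite zsumD//; last exact: zsummableZ.
  rewrite zsumZ// ENE//.
  have -> : zsum (fun x => Lap u x * u x) = - EG u.
    by apply/eqP; rewrite eq_sym eqr_oppLR; apply/eqP; exact: (sum_by_parts lu lu).
  have -> : zsum (fun x => h x * u x * u x) = zsum (fun x => h x * u x ^+ 2).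
    by apply: eq_zsum => x; rewrite -mulrA.
  have -> : zsum (fun x => conv (dens u) x * `|u x| `^ (p - 2) * u x * u x) = energy_D u.
    apply: eq_zsum => x; rewrite [dens u x]powR_split//; ring.
  by ring.
by move=> x; rewrite /EL; ring.
Qed.

Lemma dJ_self u : l2 u -> dJ a b alpha p h u u = nehari_F u.
Proof. by move=> lu; rewrite dJE// EL_self// /nehari_F; ring. Qed.

Lemma NehariP u : NM u <-> [/\ l2 u, (exists z, u z != 0) & nehari_F u = 0].
Proof.
split=> [[hu [u0 du]]|[lu [z uz] Fu]].
  have lu : l2 u by exact: (proj1 (inHP h00 hlow hup u) hu).
  split => //; last by rewrite -dJ_self.
  apply/not_existsP => /= un; apply: u0; apply/funext => z; apply/eqP.
  by apply: contra_notT (un z).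
split; first exact: (proj2 (inHP h00 hlow hup u) lu).
split; last by rewrite dJ_self.
by move=> e; rewrite e eqxx in uz.
Qed.

Lemma JE u : J u = 2^-1 * energy_N u + b / 4 * EG u ^+ 2 - (2 * p)^-1 * energy_D u.
Proof. by []. Qed.

Let gradsqZ t u x : gradsq (fun y => t * u y) x = t ^+ 2 * gradsq u x.
Proof.
rewrite /gradsq mulrCA; congr (_ * _); rewrite mulr_sumr; apply: eq_bigr => y _.
by rewrite -mulrBr exprMn.
Qed.

Lemma EG_scale t u : l2 u -> EG (fun x => t * u x) = t ^+ 2 * EG u.
Proof.
move=> lu; rewrite /EG -zsumZ; last exact: gradsq_summable.
by apply: eq_zsum => x; exact: gradsqZ.
Qed.

Lemma EN_scale t u : l2 u -> energy_N (fun x => t * u x) = t ^+ 2 * energy_N u.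
Proof.
move=> lu; rewrite !ENE//; last exact: l2Z.
have e : zsum (fun x => h x * (t * u x) ^+ 2) = t ^+ 2 * zsum (fun x => h x * u x ^+ 2).
  by rewrite -(zsumZ _ (sh lu)); apply: eq_zsum => x; ring.
by rewrite (EG_scale t lu) e; move: (EG u) (zsum _) => G V; ring.
Qed.

Lemma ED_scale t u : 0 <= t -> l2 u -> energy_D (fun x => t * u x) = (t `^ p) ^+ 2 * energy_D u.
Proof.
move=> t0 lu; have sd := dens_summable lu.
have -> : energy_D (fun x => t * u x) = bil (fun x => t `^ p * dens u x) (fun x => t `^ p * dens u x).
  have e : dens (fun x => t * u x) = fun x => t `^ p * dens u x.
    by apply/funext => x; rewrite /dens normrM (ger0_norm t0) powRM.
  by rewrite /energy_D e.
rewrite bilZl ?bilZr//; last exact: zsummableZ.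
by rewrite /energy_D; ring.
Qed.

Lemma J_scale t u : 0 <= t -> l2 u -> J (fun x => t * u x) = fibre_J t (energy_N u) (EG u) (energy_D u).
Proof.
move=> t0 lu; rewrite JE (EN_scale t lu) (EG_scale t lu) (ED_scale t0 lu) /fibre_J.
by move: (energy_N u) (EG u) (energy_D u) => N G D; ring.
Qed.

Lemma EF_scale t u : 0 <= t -> l2 u -> nehari_F (fun x => t * u x) = fibre_F t (energy_N u) (EG u) (energy_D u).
Proof.
move=> t0 lu; rewrite /nehari_F (EN_scale t lu) (EG_scale t lu) (ED_scale t0 lu) /fibre_F.
by move: (energy_N u) (EG u) (energy_D u) => N G D; ring.
Qed.

Definition kap := 4^-1 - (2 * p)^-1.

Lemma kap_gt0 : 0 < kap.
Proof.
by have p2 := hp; rewrite /kap subr_gt0 ltf_pV2 ?posrE//; lra.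
Qed.

(** A quarter of the Nehari functional absorbs the quartic gradient term. On the manifold this
    leaves a combination of nonnegative energies with positive coefficients, which gives boundedness
    and semicontinuity. *)
Lemma J_EF u : J u = 4^-1 * nehari_F u + 4^-1 * energy_N u + kap * energy_D u.
Proof.
have pn : p != 0 by rewrite gt_eqF//; exact: lt_trans hp.
by rewrite JE /nehari_F /kap; move: (energy_N u) (EG u) (energy_D u) => N G D; field.
Qed.

Lemma Psi_continuous N G D t : 0 < t -> {for t, continuous (fun t => fibre_F t N G D)}.
Proof.
move=> t0; rewrite /fibre_F.
have cp : {for t, continuous (fun t => t `^ p)}.
  apply/differentiable_continuous/derivable1_diffP.
  by have := is_derive1_powR p t0 => -[].
have ci : {for t, continuous (@id R)} by exact: cvg_id.
have c2 (f : R -> R) n : {for t, continuous f} -> {for t, continuous (fun t => f t ^+ n)}.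
  by move=> cf; apply: (@continuous_comp _ _ _ f (fun x => x ^+ n)) => //; exact: exprn_continuous.
apply: cvgB.
  apply: cvgD; first by apply: cvgMl; exact: (c2 id).
  by apply: cvgMl; apply: cvgMr; exact: (c2 id).
by apply: cvgMl; exact: c2.
Qed.

Lemma Nehari_ivt w t1 t2 : l2 w -> (exists z, w z != 0) -> 0 < t1 -> t1 <= t2 ->
  0 <= fibre_F t1 (energy_N w) (EG w) (energy_D w) -> fibre_F t2 (energy_N w) (EG w) (energy_D w) <= 0 ->
  exists2 t, t1 <= t <= t2 & NM (fun x => t * w x).
Proof.
move=> lw [z wz] t10 t12 P1 P2.
have cI : {within `[t1, t2], continuous (fun t => fibre_F t (energy_N w) (EG w) (energy_D w))}.
  apply: continuous_in_subspaceT => t; rewrite inE/= in_itv/= => /andP[t1t _].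
  by apply: Psi_continuous; exact: lt_le_trans t1t.
have mm : Num.min (fibre_F t1 (energy_N w) (EG w) (energy_D w)) (fibre_F t2 (energy_N w) (EG w) (energy_D w)) <= 0 <=
    Num.max (fibre_F t1 (energy_N w) (EG w) (energy_D w)) (fibre_F t2 (energy_N w) (EG w) (energy_D w)).
  by rewrite ge_min P2 orbT /= le_max P1.
have [t tI Pt] := IVT t12 cI mm.
exists t; first by move: tI; rewrite in_itv.
have t0 : 0 < t by move: tI; rewrite in_itv/= => /andP[t1t _]; exact: lt_le_trans t1t.
apply/NehariP; split; [exact: l2Z| |by rewrite EF_scale// ltW].
by exists z; rewrite mulf_neq0// gt_eqF.
Qed.

Let powR_le2 t : 0 < t -> t <= 1 -> t `^ p <= t ^+ 2.
Proof.
move=> t0 t1; rewrite -powR_mulrn ?(ltW t0)//; apply: ger_powR; first by rewrite t0 t1.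
exact: ltW.
Qed.

Lemma Nehari_project w : l2 w -> (exists z, w z != 0) -> nehari_F w <= 0 ->
  exists2 t, 0 < t <= 1 & NM (fun x => t * w x).
Proof.
move=> lw wn Fw; have [z wz] := wn; have N0 := EN_gt0 lw wz; have D0 := ED_ge0 lw.
(* This [t] satisfies t <= 1 and t D <= N. As p > 2, its power 2p is at most t^4, hence at most t^3,
   and so the nonlocal term is at most t^2 N. *)
pose t := energy_N w / (energy_N w + energy_D w).
have ND : 0 < energy_N w + energy_D w by rewrite ltr_wpDr.
have t0 : 0 < t by rewrite divr_gt0.
have t1 : t <= 1 by rewrite ler_pdivrMr// mul1r lerDl.
have tD : t * energy_D w <= energy_N w.
  have : t * (energy_N w + energy_D w) = energy_N w by rewrite divfK// gt_eqF.
  rewrite mulrDr; have : 0 <= t * energy_N w by rewrite mulr_ge0 ?ltW.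
  lra.
have P1 : 0 <= fibre_F t (energy_N w) (EG w) (energy_D w).
  have p2 := powR_le2 t0 t1; have pp : 0 <= t `^ p by exact: powR_ge0.
  have h2 : (t `^ p) ^+ 2 <= (t ^+ 2) ^+ 2 by rewrite lerXn2r ?nnegrE// sqr_ge0.
  have h3 : (t ^+ 2) ^+ 2 <= t ^+ 2 * t.
    by rewrite [leLHS]expr2 ler_wpM2l ?sqr_ge0// expr2 ler_piMr// ltW.
  have h4 : (t `^ p) ^+ 2 * energy_D w <= t ^+ 2 * energy_N w.
    apply: le_trans (ler_wpM2r D0 (le_trans h2 h3)) _.
    by rewrite -mulrA ler_wpM2l ?sqr_ge0.
  have h5 : 0 <= b * t ^+ 4 * EG w ^+ 2.
    apply: mulr_ge0; last exact: sqr_ge0.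
    by apply: mulr_ge0; [exact: ltW|apply: exprn_ge0; exact: ltW].
  by rewrite /fibre_F; lra.
have P2 : fibre_F 1 (energy_N w) (EG w) (energy_D w) <= 0.
  have -> : fibre_F 1 (energy_N w) (EG w) (energy_D w) = nehari_F w; last exact: Fw.
  by rewrite /fibre_F powR1 /nehari_F; move: (energy_N w) (EG w) (energy_D w) => N G D; ring.
have [t' /andP[tt' t'1] NMt] := Nehari_ivt lw wn t0 t1 P1 P2.
by exists t' => //; rewrite t'1 andbT (lt_le_trans t0).
Qed.

Definition zdelta z : Z3 -> R := fun x => if x == z then 1 else 0.

Lemma zdelta_l2 z : l2 (zdelta z).
Proof.
by apply: (zsummable1 (z := z)) => x xz; rewrite /zdelta (negbTE xz) expr0n.
Qed.

(** The delta function has nonlocal energy [Ralpha z z > 0]; a large multiple of it makes the term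
    of degree 2p dominate, and [Nehari_project] applies. *)
Lemma Nehari_nonempty : exists v, NM v.
Proof.
have p2 := hp; pose z : Z3 := (0, 0, 0); have ld := zdelta_l2 z.
have dens_incr : dens (zdelta z) = zdelta z.
  apply/funext => x; rewrite /dens /zdelta; case: eqP => _; first by rewrite normr1 powR1.
  by rewrite normr0 powR0// gt_eqF//; lra.
have D0 : 0 < energy_D (zdelta z).
  have z1 y : y != z -> zdelta z y = 0 by rewrite /zdelta => /negbTE ->.
  rewrite /energy_D dens_incr /kform (zsum1 (z := z)); last by move=> y /z1 ->; rewrite mulr0.
  rewrite /zdelta eqxx mulr1 /Rconv (zsum1 (z := z)); last by move=> y /negbTE ->; rewrite mulr0.
  by rewrite eqxx mulr1 Ralpha_diag_gt0.
have N0 := EN_ge0 ld.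
set N := energy_N (zdelta z) in N0; set G := EG (zdelta z); set D := energy_D (zdelta z) in D0.
pose Q := (N + b * G ^+ 2) / D.
have NG0 : 0 <= N + b * G ^+ 2 by rewrite addr_ge0// mulr_ge0 ?sqr_ge0// ltW.
have Q0 : 0 <= Q by rewrite divr_ge0// ltW.
have QD : Q * D = N + b * G ^+ 2 by rewrite divfK// gt_eqF.
(* Chosen so that the power 2p of [t] equals (1 + Q)^2 t^4. Expanding the square with Q D = N + b
   G^2 yields more than enough to absorb both positive terms. *)
pose t := (1 + Q) `^ (p - 2)^-1.
have t0 : 0 < t by apply: powR_gt0; lra.
have pn : p - 2 != 0 by rewrite subr_eq0 gt_eqF.
have tp : t `^ (p - 2) = 1 + Q by rewrite -powRrM mulVf// powRr1//; lra.
have t1 : 1 <= t.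
  rewrite -(powRr0 (1 + Q)); apply: ler_powR; first lra.
  by rewrite invr_ge0; lra.
have tpp : t `^ p = (1 + Q) * t ^+ 2.
  by have := powR_split t hp; rewrite (gtr0_norm t0) tp.
have Ft : nehari_F (fun x => t * zdelta z x) <= 0.
  rewrite EF_scale ?(ltW t0)// /fibre_F tpp -/N -/G -/D.
  have h2 : t ^+ 2 * N <= t ^+ 4 * N.
    apply: ler_wpM2r => //; have -> : t ^+ 4 = t ^+ 2 * t ^+ 2 by ring.
    by rewrite ler_peMr ?sqr_ge0// expr_ge1// ltW.
  have -> : ((1 + Q) * t ^+ 2) ^+ 2 * D = t ^+ 4 * (D + 2 * (Q * D) + Q * (Q * D)) by ring.
  rewrite QD.
  have h3 : 0 <= t ^+ 4 * (D + (N + b * G ^+ 2) + Q * (N + b * G ^+ 2)).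
    apply: mulr_ge0; first by apply: exprn_ge0; exact: ltW.
    by apply: addr_ge0; [apply: addr_ge0 => //; exact: ltW|exact: mulr_ge0].
  have -> : t ^+ 4 * (D + 2 * (N + b * G ^+ 2) + Q * (N + b * G ^+ 2)) =
     t ^+ 4 * (D + (N + b * G ^+ 2) + Q * (N + b * G ^+ 2)) + t ^+ 4 * N + b * t ^+ 4 * G ^+ 2 by ring.
  lra.
have [|t' _ NMt] := Nehari_project (l2Z t ld) _ Ft.
  by exists z; rewrite /zdelta eqxx mulr1 gt_eqF.
by exists (fun x => t' * (t * zdelta z x)).
Qed.

Lemma J_Nehari_ge0 v : NM v -> 0 <= J v.
Proof.
move=> /NehariP[lv _ Fv]; rewrite J_EF Fv mulr0 add0r; apply: addr_ge0.
  by apply: mulr_ge0 => //; exact: EN_ge0.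
by apply: mulr_ge0; [exact: ltW kap_gt0|exact: ED_ge0].
Qed.

Definition ground_level := inf [set J v | v in NM].

Lemma level_has_inf : has_inf [set J v | v in NM].
Proof.
split; first by have [v Nv] := Nehari_nonempty; exists (J v), v.
by exists 0 => _ [v Nv <-]; exact: J_Nehari_ge0.
Qed.

Lemma level_le v : NM v -> ground_level <= J v.
Proof.
move=> Nv; apply: ge_inf; first by have [] := level_has_inf.
by exists v.
Qed.

Lemma level_ge0 : 0 <= ground_level.
Proof.
apply: lb_le_inf; first by have [] := level_has_inf.
by move=> _ [v Nv <-]; exact: J_Nehari_ge0.
Qed.

(* On the Nehari manifold [N <= D <= C sup|v|^(2(p-2)) N^2], so bounded energy forbids vanishing. *)
Lemma Nehari_nonvanishing (E : R) : 0 < E ->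
  exists2 s, 0 < s & forall v, NM v -> energy_N v <= E -> exists x, s <= `|v x|.
Proof.
move=> E0; have p2 := hp; have [r0 r00 bb] := bil_bound halpha.
(* This makes q < 1 and q r0 E < h0^2; a function on the manifold with |v|^(p-2) <= q everywhere
   would give h0^2 <= q r0 E. *)
pose q := h0 ^+ 2 / (h0 ^+ 2 + r0 * E).
have h2 : 0 < h0 ^+ 2 by rewrite exprn_gt0.
have rE : 0 < r0 * E by rewrite mulr_gt0.
have q0 : 0 < q by rewrite divr_gt0// addr_gt0.
have q1 : q < 1 by rewrite ltr_pdivrMr ?addr_gt0// mul1r ltrDl.
have qE : q * (r0 * E) < h0 ^+ 2.
  have : q * (h0 ^+ 2 + r0 * E) = h0 ^+ 2 by rewrite divfK// gt_eqF// addr_gt0.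
  have : 0 < q * h0 ^+ 2 by rewrite mulr_gt0.
  rewrite mulrDr; lra.
pose s := q `^ (p - 2)^-1.
have s0 : 0 < s by exact: powR_gt0.
have pn : p - 2 != 0 by rewrite subr_eq0 gt_eqF.
have sp : s `^ (p - 2) = q by rewrite -powRrM mulVf// powRr1// ltW.
exists s => // v /NehariP[lv [z vz] Fv] vE; apply/not_existsP => /= vs.
have vM x : `|v x| <= s by rewrite ltW// ltNge; apply/negP; exact: vs.
have N0 := EN_gt0 lv vz.
pose Z := zsum (fun x => v x ^+ 2).
have Z0 : 0 <= Z by apply: zsum_ge0 => // x; exact: sqr_ge0.
have sd := dens_summable lv.
have dZ : zsum (fun x => `|dens v x|) <= q * Z.
  rewrite -zsumZ//; apply: le_zsum => [||x]; [exact: zsummable_abs|exact: zsummableZ|].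
  by rewrite ger0_norm ?dens_ge0// -sp; exact: powR_le_sqr.
have d0 : 0 <= zsum (fun x => `|dens v x|).
  by apply: zsum_ge0 => //; exact: zsummable_abs.
have DZ : energy_D v <= r0 * (q * Z) ^+ 2.
  apply: le_trans (le_trans (ler_norm _) (bb _ _ sd sd)) _.
  rewrite -mulrA -expr2; apply: ler_wpM2l; first exact: ltW.
  by apply: lerXn2r; rewrite ?nnegrE//; apply: mulr_ge0 => //; exact: ltW.
have ND : energy_N v <= energy_D v.
  move: Fv; rewrite /nehari_F; have : 0 <= b * EG v ^+ 2 by rewrite mulr_ge0 ?sqr_ge0// ltW.
  lra.
have NZ : h0 * Z <= energy_N v := EN_ge lv.
have Z2 : (h0 * Z) ^+ 2 <= energy_N v ^+ 2.
  by rewrite lerXn2r ?nnegrE ?mulr_ge0 ?(ltW h00) ?(ltW N0).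
have c1 : h0 ^+ 2 * energy_N v <= r0 * q ^+ 2 * energy_N v ^+ 2.
  apply: le_trans (ler_wpM2l (ltW h2) (le_trans ND DZ)) _.
  have -> : h0 ^+ 2 * (r0 * (q * Z) ^+ 2) = r0 * q ^+ 2 * (h0 * Z) ^+ 2 by ring.
  by rewrite ler_wpM2l// mulr_ge0 ?sqr_ge0// ltW.
have c2 : h0 ^+ 2 <= r0 * q ^+ 2 * energy_N v.
  by move: c1; rewrite expr2 mulrA ler_pM2r.
have c3 : r0 * q ^+ 2 * energy_N v <= r0 * q * E.
  apply: ler_pM => //; [by rewrite mulr_ge0 ?sqr_ge0// ltW|exact: ltW|].
  by rewrite ler_wpM2l ?(ltW r00)// expr2 ler_piMr// ltW.
have : r0 * q * E = q * (r0 * E) by ring.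
lra.
Qed.

End Energy.

(** * Translations and one-site variations *)

Section Periodicity.
Variables (R : realType) (a b alpha p : R) (h : Z3 -> R) (tau : int).
Hypothesis htau : tau != 0.
Hypothesis hper : forall (x : Z3) (j : 'I_3), h (Zshift x j tau) = h x.

Lemma ZshiftD (x : Z3) (j : 'I_3) (s t : int) : Zshift (Zshift x j s) j t = Zshift x j (s + t).
Proof. by rewrite /Zshift; case: (val j) => [|[|n]] /=; rewrite addrA. Qed.

Lemma h_Zshift (x : Z3) (j : 'I_3) (n : int) : h (Zshift x j (n * tau)) = h x.
Proof.
have hn (m : nat) y : h (Zshift y j (m%:Z * tau)) = h y.
  elim: m y => [|m IH] y.
    by rewrite mul0r; congr h; case: y => [[y1 y2] y3]; rewrite /Zshift; case: (val j) => [|[|k]] /=; rewrite addr0.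
  have -> : m.+1%:Z * tau = m%:Z * tau + tau by rewrite -addn1 PoszD mulrDl mul1r.
  by rewrite -ZshiftD hper.
case: n => m; first exact: hn.
rewrite -(hn m.+1 (Zshift x j (Negz m * tau))) ZshiftD -mulrDl NegzE addNr mul0r.
congr h; case: x => [[x1 x2] x3]; rewrite /Zshift.
by case: (val j) => [|[|k]] /=; rewrite addr0.
Qed.

Definition tshift (q x : Z3) : Z3 :=
  (x.1.1 + q.1.1 * tau, x.1.2 + q.1.2 * tau, x.2 + q.2 * tau).

Lemma h_tshift q x : h (tshift q x) = h x.
Proof.
pose j0 := @Ordinal 3 0 isT; pose j1 := @Ordinal 3 1 isT; pose j2 := @Ordinal 3 2 isT.
have := h_Zshift (Zshift (Zshift x j0 (q.1.1 * tau)) j1 (q.1.2 * tau)) j2 q.2.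
by rewrite !h_Zshift.
Qed.

Lemma tshift_bij q : bijective (tshift q).
Proof.
exists (tshift (- q.1.1, - q.1.2, - q.2)) => -[[x y] z]; rewrite /tshift /= !mulNr.
  by rewrite !addrK.
by rewrite !subrK.
Qed.

Lemma Zshift_tshift q x j t : Zshift (tshift q x) j t = tshift q (Zshift x j t).
Proof.
by rewrite /Zshift /tshift; case: (val j) => [|[|k]] /=; rewrite addrAC.
Qed.

(** Coordinatewise Euclidean division. Finiteness of [Q] bounds [h], and it confines the sites where
    a minimizing sequence stays large to a fixed finite set. *)
Lemma fundamental_domain : exists Q : seq Z3, forall x, exists q y, y \in Q /\ x = tshift q y.
Proof.
pose I := [seq Posz i | i <- iota 0 `|tau|%N].
exists [seq (xy, z) | xy <- [seq (x, y) | x <- I, y <- I], z <- I] => x.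
have mI (n : int) : (n %% tau)%Z \in I.
  have m0 : (0 <= n %% tau)%Z by exact: modz_ge0.
  apply/mapP; exists `|(n %% tau)%Z|%N; last by rewrite gez0_abs.
  by rewrite mem_iota /= add0n -ltz_nat gez0_abs// abszE ltz_mod.
exists ((x.1.1 %/ tau)%Z, (x.1.2 %/ tau)%Z, (x.2 %/ tau)%Z).
exists ((x.1.1 %% tau)%Z, (x.1.2 %% tau)%Z, (x.2 %% tau)%Z); split.
  by apply: allpairs_f => //; exact: allpairs_f.
rewrite /tshift /= ![((_ %% _)%Z + _)]addrC -!divz_eq.
by case: x => [[]].
Qed.

Lemma periodic_bounded : exists h1, forall x, h x <= h1.
Proof.
have [Q hQ] := fundamental_domain; exists (\sum_(y <- Q) `|h y|) => x.
have [q [y [yQ ->]]] := hQ x; rewrite h_tshift (big_rem y)//=.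
by apply: le_trans (ler_norm _) _; rewrite lerDl sumr_ge0.
Qed.

Lemma gradsq_tshift q (u : Z3 -> R) x :
  gradsq (fun y => u (tshift q y)) x = gradsq u (tshift q x).
Proof.
rewrite /gradsq !sum_nbrs; congr (_ * _); apply: eq_bigr => j _.
by rewrite !Zshift_tshift.
Qed.

Lemma conv_tshift q (f : Z3 -> R) x :
  Rconv alpha (fun y => f (tshift q y)) x = Rconv alpha f (tshift q x).
Proof.
rewrite /Rconv -[RHS](zsum_reindex _ (tshift_bij q)); apply: eq_zsum => y.
congr (_ * _); apply: Ralpha_translation; rewrite /tshift /=; ring.
Qed.

Lemma EG_tshift q (u : Z3 -> R) : EG (fun x => u (tshift q x)) = EG u.
Proof.
rewrite /EG -[RHS](zsum_reindex _ (tshift_bij q)); apply: eq_zsum => x.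
exact: gradsq_tshift.
Qed.

Lemma EN_tshift q (u : Z3 -> R) : energy_N a h (fun x => u (tshift q x)) = energy_N a h u.
Proof.
rewrite /energy_N /Hnormsq -[RHS](zsum_reindex _ (tshift_bij q)); apply: eq_zsum => x.
by rewrite gradsq_tshift h_tshift.
Qed.

Lemma ED_tshift q (u : Z3 -> R) : energy_D alpha p (fun x => u (tshift q x)) = energy_D alpha p u.
Proof.
rewrite /energy_D /kform -[RHS](zsum_reindex _ (tshift_bij q)); apply: eq_zsum => x.
by rewrite -(conv_tshift q (dens p u)).
Qed.

End Periodicity.

(** * Limits along an ultrafilter *)

Section Ultra.
Variables (R : realType) (U : set_system nat) (UU : UltraFilter U).

(** Compactness of the segment gives a cluster point, and an ultrafilter converges to each of its
    cluster points. *)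
Lemma ultra_bounded (s : nat -> R) (C : R) : (forall n, `|s n| <= C) ->
  exists l : R, s n @[n --> U] --> l.
Proof.
move=> sC; have sU : \forall n \near U, `[- C, C]%classic (s n).
  by apply: nearW => n; have := sC n; rewrite /= in_itv/= ler_norml.
have PF : ProperFilter (s n @[n --> U]) by exact: fmap_proper_filter.
have [l [_ cl]] := @segment_compact R (- C) C (s n @[n --> U]) PF sU.
exists l => V Vl; have [//|nV] := in_ultra_setVsetC (s @^-1` V) UU.
have [y []] : (~` V) `&` V !=set0 by apply: cl.
by [].
Qed.

Lemma cvg_ge_near (x : nat -> R) (l c : R) : x n @[n --> U] --> l ->
  (\forall n \near U, c <= x n) -> c <= l.
Proof.
move=> xl cx; rewrite -(cvg_lim _ xl)//; apply: limr_ge => //.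
by apply/cvg_ex; exists l.
Qed.

End Ultra.

(** * The fibre maps as functions of one variable *)

Section OneDim.
Variables (R : realType) (b p : R).
Hypothesis hb : 0 < b.
Hypothesis hp : 2 < p.
Implicit Types (t N G D : R).
Local Notation Phi := (fibre_J b p).
Local Notation Psi := (fibre_F b p).

Section Cvg.
Variables (T : Type) (F : set_system T) (FF : ProperFilter F).
Variables (t_ T_ N_ G_ D_ : T -> R) (t N G D : R).
Hypothesis ct : t_ i @[i --> F] --> t.
Hypothesis cT : t_ i `^ p @[i --> F] --> t `^ p.
Hypothesis cN : N_ i @[i --> F] --> N.
Hypothesis cG : G_ i @[i --> F] --> G.
Hypothesis cD : D_ i @[i --> F] --> D.

Lemma cvgX (f_ : T -> R) (l : R) n : f_ i @[i --> F] --> l -> f_ i ^+ n @[i --> F] --> l ^+ n.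
Proof.
by move=> fl; apply: (@continuous_cvg _ _ _ _ FF f_ (fun x => x ^+ n)) fl; exact: exprn_continuous.
Qed.

Lemma Psi_cvg : Psi (t_ i) (N_ i) (G_ i) (D_ i) @[i --> F] --> Psi t N G D.
Proof.
rewrite /fibre_F; apply: cvgB; last by apply: cvgM => //; exact: cvgX.
apply: cvgD; first by apply: cvgM => //; exact: cvgX.
by apply: cvgM; [apply: cvgMr|]; exact: cvgX.
Qed.

Lemma Phi_cvg : Phi (t_ i) (N_ i) (G_ i) (D_ i) @[i --> F] --> Phi t N G D.
Proof.
rewrite /fibre_J; apply: cvgB.
  apply: cvgD; first by apply: cvgM => //; apply: cvgMl; exact: cvgX.
  by apply: cvgM; [apply: cvgMr|]; exact: cvgX.
by apply: cvgM => //; apply: cvgMr; exact: cvgX.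
Qed.

End Cvg.

(** Prepares Bernoulli's inequality in the variable t^4 with exponent p/2 > 1. *)
Let powR_sq t : 0 <= t -> (t `^ p) ^+ 2 = (t ^+ 4) `^ (p / 2).
Proof.
move=> t0; rewrite -powR_mulrn ?powR_ge0// -powRrM -(powR_mulrn 4)//.
by rewrite -powRrM; congr powR; field.
Qed.

(* Bernoulli's inequality: the Nehari point [t = 1] maximises the fibre energy. *)
Lemma Phi_le t N G : 0 <= N -> 0 <= t ->
  Phi t N G (N + b * G ^+ 2) <= Phi 1 N G (N + b * G ^+ 2).
Proof.
move=> N0 t0; have p2 := hp; rewrite /fibre_J powR1 !expr1n.
have p21 : 1 < p / 2 by lra.
have := bernoulli_powR p21 (exprn_ge0 4 t0); rewrite -powR_sq//.
set Y := (t `^ p) ^+ 2 => h.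
have p0 : 0 < p by lra.
have pn : p != 0 by rewrite gt_eqF.
have hY : (t ^+ 4 - 1) / 4 <= (2 * p)^-1 * (Y - 1).
  have -> : (t ^+ 4 - 1) / 4 = (2 * p)^-1 * (p / 2 * (t ^+ 4 - 1)) by field.
  by rewrite ler_wpM2l ?invr_ge0; lra.
have hX : (t ^+ 2 - 1) / 2 <= (2 * p)^-1 * (Y - 1).
  apply: le_trans hY; have := sqr_ge0 (t ^+ 2 - 1); lra.
have h1 : (t ^+ 2 - 1) / 2 * N <= (2 * p)^-1 * (Y - 1) * N by rewrite ler_wpM2r.
have G0 : 0 <= b * G ^+ 2 by rewrite mulr_ge0 ?sqr_ge0// ltW.
have h2 : (t ^+ 4 - 1) / 4 * (b * G ^+ 2) <= (2 * p)^-1 * (Y - 1) * (b * G ^+ 2).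
  by rewrite ler_wpM2r.
rewrite -subr_ge0.
have -> : 1 / 2 * N + b / 4 * 1 * G ^+ 2 - (2 * p)^-1 * 1 * (N + b * G ^+ 2) -
  (t ^+ 2 / 2 * N + b / 4 * t ^+ 4 * G ^+ 2 - (2 * p)^-1 * Y * (N + b * G ^+ 2)) =
  ((2 * p)^-1 * (Y - 1) * N - (t ^+ 2 - 1) / 2 * N) +
  ((2 * p)^-1 * (Y - 1) * (b * G ^+ 2) - (t ^+ 4 - 1) / 4 * (b * G ^+ 2)) by ring.
by rewrite addr_ge0// subr_ge0.
Qed.

(** Below 1 the powers 2, 4 and 2p of [t] are in decreasing order, above 1 in increasing order;
    strictness comes from the term in [N]. The sign change at t = 1 is therefore strict and survives
    small perturbations of the energies. *)
Lemma Psi_gt0 t N G : 0 < N -> 0 < t -> t < 1 -> 0 < Psi t N G (N + b * G ^+ 2).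
Proof.
move=> N0 t0 t1; have p2 := hp; rewrite /fibre_F.
have tp : t `^ p <= t ^+ 2.
  by rewrite -powR_mulrn ?(ltW t0)//; apply: ger_powR; [rewrite t0 ltW|exact: ltW].
have Y : (t `^ p) ^+ 2 <= t ^+ 4.
  have -> : t ^+ 4 = (t ^+ 2) ^+ 2 by ring.
  by apply: lerXn2r; rewrite ?nnegrE ?powR_ge0 ?sqr_ge0.
have X : t ^+ 4 < t ^+ 2.
  have -> : t ^+ 4 = t ^+ 2 * t ^+ 2 by ring.
  by rewrite gtr_pMl ?exprn_gt0// exprn_ilt1// ltW.
have G0 : 0 <= b * G ^+ 2 by rewrite mulr_ge0 ?sqr_ge0// ltW.
have h1 : (t `^ p) ^+ 2 * N < t ^+ 2 * N by rewrite ltr_pM2r//; exact: le_lt_trans X.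
have h2 : (t `^ p) ^+ 2 * (b * G ^+ 2) <= t ^+ 4 * (b * G ^+ 2) by rewrite ler_wpM2r.
have -> : b * t ^+ 4 * G ^+ 2 = t ^+ 4 * (b * G ^+ 2) by ring.
by rewrite mulrDr; lra.
Qed.

Lemma Psi_lt0 t N G : 0 < N -> 1 < t -> Psi t N G (N + b * G ^+ 2) < 0.
Proof.
move=> N0 t1; have p2 := hp; rewrite /fibre_F.
have t0 : 0 < t by exact: lt_trans t1.
have tp : t ^+ 2 <= t `^ p.
  by rewrite -powR_mulrn ?(ltW t0)//; apply: ler_powR; exact: ltW.
have Y : t ^+ 4 <= (t `^ p) ^+ 2.
  have -> : t ^+ 4 = (t ^+ 2) ^+ 2 by ring.
  by apply: lerXn2r; rewrite ?nnegrE ?powR_ge0 ?sqr_ge0.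
have X : t ^+ 2 < t ^+ 4.
  have -> : t ^+ 4 = t ^+ 2 * t ^+ 2 by ring.
  by rewrite ltr_pMl ?exprn_gt0// exprn_egt1.
have G0 : 0 <= b * G ^+ 2 by rewrite mulr_ge0 ?sqr_ge0// ltW.
have h1 : t ^+ 2 * N < (t `^ p) ^+ 2 * N by rewrite ltr_pM2r//; exact: lt_le_trans Y.
have h2 : t ^+ 4 * (b * G ^+ 2) <= (t `^ p) ^+ 2 * (b * G ^+ 2) by rewrite ler_wpM2r.
have -> : b * t ^+ 4 * G ^+ 2 = t ^+ 4 * (b * G ^+ 2) by ring.
by rewrite mulrDr; lra.
Qed.

End OneDim.

(** * The one-site variation *)

Section Variation.
Variables (R : realType) (a b alpha p : R) (h : Z3 -> R) (h0 h1 : R).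
Hypothesis ha : 0 < a.
Hypothesis hb : 0 < b.
Hypothesis halpha : 0 < alpha < 3.
Hypothesis hp : 2 < p.
Hypothesis h00 : 0 < h0.
Hypothesis hlow : forall x, h0 <= h x.
Hypothesis hup : forall x, h x <= h1.
Local Notation conv := (Rconv alpha).
Local Notation NM := (Nehari a b alpha p h).
Local Notation Phi := (fibre_J b p).
Local Notation Psi := (fibre_F b p).
Local Notation EN := (energy_N a h).
Local Notation ED := (energy_D alpha p).
Local Notation level := (ground_level a b alpha p h).
Variable z : Z3.
Implicit Types (u : Z3 -> R) (s t N G D L v C : R).

Let de : Z3 -> R := zdelta R z.
Let lde : l2 de := zdelta_l2 R z.

Definition bump u s : Z3 -> R := fun x => u x + s * de x.

Lemma bump_l2 u s : l2 u -> l2 (bump u s).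
Proof. by move=> lu; apply: l2D => //; exact: l2Z. Qed.

Let de0 x : x != z -> de x = 0. Proof. by rewrite /de /zdelta => /negbTE ->. Qed.
Let de1 : de z = 1. Proof. by rewrite /de /zdelta eqxx. Qed.

Let zsum_de (w : Z3 -> R) : zsum (fun x => w x * de x) = w z.
Proof. by rewrite (zsum1 (z := z)) ?de1 ?mulr1// => x /de0 ->; rewrite mulr0. Qed.

Lemma EG_bump u s : l2 u ->
  EG (bump u s) = EG u - 2 * s * Lap u z + s ^+ 2 * EG de.
Proof.
move=> lu; have sg := gradsq_summable lu; have sd := gradsq_summable lde.
have sp := gradprod_summable lu lde.
have e : zsum (gradprod u de) = - Lap u z by rewrite sum_by_parts// zsum_de.
rewrite /EG (@eq_zsum _ _ (fun x => gradsq u x + (2 * s) * gradprod u de x + s ^+ 2 * gradsq de x)).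
  rewrite zsumD; [|by apply: zsummableD => //; exact: zsummableZ|exact: zsummableZ].
  rewrite zsumD//; last exact: zsummableZ.
  by rewrite (zsumZ _ sp) (zsumZ _ sd) e; ring.
move=> x; rewrite /gradsq /gradprod /bump.
rewrite (eq_bigr (fun y => (u y - u x) ^+ 2 + (2 * s) * ((u y - u x) * (de y - de x))
   + s ^+ 2 * (de y - de x) ^+ 2)); last by move=> y _; ring.
by rewrite !big_split /= -!mulr_sumr; ring.
Qed.

(** The arguments [L], [v] and, in [bump_D], [C] stand for [Lap u z], [u z] and the convolution of
    [dens p u] at [z]. These are the local data through which the variation depends on [u], besides
    its energies. *)
Definition bump_N N L v s := N + s * (2 * h z * v - 2 * a * L) + s ^+ 2 * (a * EG de + h z).
Definition bump_G G L s := G - 2 * s * L + s ^+ 2 * EG de.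
Definition dens_incr v s := `|v + s| `^ p - `|v| `^ p.
Definition bump_D D C v s := D + 2 * dens_incr v s * C + dens_incr v s ^+ 2 * Ralpha alpha z z.

Lemma EN_bump u s : l2 u -> EN (bump u s) = bump_N (EN u) (Lap u z) (u z) s.
Proof.
move=> lu; have hw w := l2_weight h00 hlow hup (u := w).
have lb := bump_l2 s lu.
have e : zsum (fun x => h x * bump u s x ^+ 2) =
    zsum (fun x => h x * u x ^+ 2) + 2 * s * h z * u z + s ^+ 2 * h z.
  rewrite (@eq_zsum _ _ (fun x => h x * u x ^+ 2 +
     (2 * s * h x * u x + s ^+ 2 * h x * de x) * de x)); last by move=> x; rewrite /bump; ring.
  rewrite zsumD; [|exact: hw|]; last first.
    by apply: (zsummable1 (z := z)) => x /de0 ->; rewrite mulr0.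
  by rewrite zsum_de de1; ring.
rewrite (ENE a h00 hlow hup lb) (ENE a h00 hlow hup lu) e EG_bump// /bump_N.
by move: (EG u) (EG de) (zsum _) (Lap u z) => G g V L; ring.
Qed.

Lemma ED_bump u s : l2 u -> ED (bump u s) = bump_D (ED u) (conv (dens p u) z) (u z) s.
Proof.
move=> lu; have sd := dens_summable hp lu.
have sde : zsummable de by apply: (zsummable1 (z := z)) => x /de0.
have e : dens p (bump u s) = fun x => dens p u x + dens_incr (u z) s * de x.
  apply/funext => x; rewrite /dens /bump /dens_incr; have [->|xz] := eqVneq x z.
    by rewrite de1 !mulr1; ring.
  by rewrite de0// !mulr0 !addr0.
have szd := zsummableZ (dens_incr (u z) s) sde.
have bd f : zsummable f -> kform alpha f de = conv f z by move=> _; exact: zsum_de.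
have kd : conv de z = Ralpha alpha z z by exact: zsum_de.
rewrite /energy_D e; have sdd := zsummableD sd szd.
rewrite (bilDl halpha sd szd sdd) (bilDr halpha sd szd sd) (bilDr halpha sd szd szd).
rewrite (bilC halpha szd sd) (bilZr halpha _ sd sde) (bilZl halpha _ sde szd) (bilZr halpha _ sde sde).
by rewrite (bd _ sd) (bd _ sde) kd /bump_D; ring.
Qed.

Section Limits.
Variables (T : Type) (F : set_system T) (FF : ProperFilter F).
Variables (N_ G_ D_ L_ v_ C_ s_ : T -> R) (N G D L v C s : R).
Hypothesis cN : N_ i @[i --> F] --> N.
Hypothesis cG : G_ i @[i --> F] --> G.
Hypothesis cD : D_ i @[i --> F] --> D.
Hypothesis cL : L_ i @[i --> F] --> L.
Hypothesis cv : v_ i @[i --> F] --> v.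
Hypothesis cC : C_ i @[i --> F] --> C.
Hypothesis cs : s_ i @[i --> F] --> s.

Lemma cvg_npow (f_ : T -> R) l : f_ i @[i --> F] --> l -> `|f_ i| `^ p @[i --> F] --> `|l| `^ p.
Proof.
move=> fl; have p0 : 0 < p by exact: lt_trans hp.
apply: (@continuous_cvg _ _ _ _ FF f_ (fun x : R => `|x| `^ p)) fl.
exact: norm_powR_continuous.
Qed.

Lemma dens_incr_cvg : dens_incr (v_ i) (s_ i) @[i --> F] --> dens_incr v s.
Proof. by apply: cvgB; apply: cvg_npow => //; exact: cvgD. Qed.

Lemma qN_cvg : bump_N (N_ i) (L_ i) (v_ i) (s_ i) @[i --> F] --> bump_N N L v s.
Proof.
apply: cvgD; last by apply: cvgMl; exact: cvgX.
apply: cvgD => //; apply: cvgM => //; apply: cvgB; exact: cvgMr.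
Qed.

Lemma qG_cvg : bump_G (G_ i) (L_ i) (s_ i) @[i --> F] --> bump_G G L s.
Proof.
apply: cvgD; last by apply: cvgMl; exact: cvgX.
by apply: cvgB => //; apply: cvgM => //; exact: cvgMr.
Qed.

Lemma qD_cvg : bump_D (D_ i) (C_ i) (v_ i) (s_ i) @[i --> F] --> bump_D D C v s.
Proof.
have cd := dens_incr_cvg.
apply: cvgD; last by apply: cvgMl; exact: cvgX.
by apply: cvgD => //; apply: cvgM => //; exact: cvgMr.
Qed.

End Limits.

Lemma qN0 N L v : bump_N N L v 0 = N. Proof. by rewrite /bump_N; ring. Qed.
Lemma qG0 G L : bump_G G L 0 = G. Proof. by rewrite /bump_G; ring. Qed.
Lemma qD0 D C v : bump_D D C v 0 = D. Proof. by rewrite /bump_D /dens_incr addr0; ring. Qed.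

(** The tangent inequalities at [v] and at [v + s] enclose the increment between two linear
    functions of [s]. Continuity of [phi] then gives the derivative, the point 0 included. *)
Lemma dens_incr_tangent v s (phi := fun y => p * (`|y| `^ (p - 2) * y)) :
  `|dens_incr v s - phi v * s| <= `|phi (v + s) - phi v| * `|s|.
Proof.
have h1' := powR_tangent v (v + s) hp; have h2' := powR_tangent (v + s) v hp.
have e1 : v + s - v = s by ring.
have e2 : v - (v + s) = - s by ring.
rewrite e1 in h1'; rewrite e2 mulrN in h2'.
have a0 : 0 <= dens_incr v s - phi v * s by rewrite /dens_incr /phi; lra.
have a1 : dens_incr v s - phi v * s <= (phi (v + s) - phi v) * s by rewrite /dens_incr /phi mulrBl; lra.
by rewrite (ger0_norm a0) -normrM; apply: le_trans a1 (ler_norm _).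
Qed.

End Variation.

(** * The limit equation *)

Section LimitEquation.
Variables (R : realType) (a b alpha p : R) (h : Z3 -> R) (h0 h1 : R).
Hypothesis ha : 0 < a.
Hypothesis hb : 0 < b.
Hypothesis halpha : 0 < alpha < 3.
Hypothesis hp : 2 < p.
Hypothesis h00 : 0 < h0.
Hypothesis hlow : forall x, h0 <= h x.
Hypothesis hup : forall x, h x <= h1.
Local Notation conv := (Rconv alpha).
Local Notation NM := (Nehari a b alpha p h).
Local Notation Phi := (fibre_J b p).
Local Notation Psi := (fibre_F b p).
Local Notation EN := (energy_N a h).
Local Notation ED := (energy_D alpha p).
Local Notation J := (Jfun a b alpha p h).
Local Notation level := (ground_level a b alpha p h).
Local Notation qN := (bump_N a h).
Local Notation qD := (bump_D alpha p).

Lemma cvg_sumseq (T I : Type) (F : set_system T) (FF : ProperFilter F) (s : seq I)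
    (f_ : T -> I -> R) (f : I -> R) : (forall i, f_ t i @[t --> F] --> f i) ->
  \sum_(i <- s) f_ t i @[t --> F] --> \sum_(i <- s) f i.
Proof.
move=> ff; elim: s => [|y s IH].
  rewrite big_nil (_ : (fun i => _) = fun=> 0); first exact: cvg_cst.
  by apply/funext => i; rewrite big_nil.
rewrite big_cons (_ : (fun t => _) = fun t => f_ t y + \sum_(x <- s) f_ t x).
  by apply: cvgD => //; exact: ff.
by apply/funext => i; rewrite big_cons.
Qed.

Lemma cvg_of_le (x y : nat -> R) (l : R) : (forall n, `|x n - l| <= y n) ->
  y n @[n --> \oo] --> 0 -> x n @[n --> \oo] --> l.
Proof.
move=> xy y0; apply/cvgrPdist_le => e e0; move/cvgrPdist_le : y0 => /(_ e e0).
apply: filterS => n; rewrite sub0r normrN => yn.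
rewrite distrC; apply: le_trans (xy n) _; exact: le_trans (ler_norm _) yn.
Qed.

Lemma Lap_cvg (T : Type) (F : set_system T) (FF : ProperFilter F) (u_ : T -> Z3 -> R) u x :
  (forall x, u_ i x @[i --> F] --> u x) -> Lap (u_ i) x @[i --> F] --> Lap u x.
Proof. by move=> cu; apply: cvg_sumseq => y; apply: cvgB; exact: cu. Qed.

Lemma gradsq_cvg (T : Type) (F : set_system T) (FF : ProperFilter F) (u_ : T -> Z3 -> R) u x :
  (forall x, u_ i x @[i --> F] --> u x) -> gradsq (u_ i) x @[i --> F] --> gradsq u x.
Proof.
move=> cu; apply: cvgMr; apply: cvg_sumseq => y; apply: cvgX; apply: cvgB; exact: cu.
Qed.

(** All energies of the zero function vanish. This provides the nontriviality that [Nehari_ivt] asks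
    of a varied function. *)
Lemma Psi_nonzero t (w : Z3 -> R) : l2 w -> Psi t (EN w) (EG w) (ED w) != 0 ->
  exists z, w z != 0.
Proof.
move=> lw P0; apply/not_existsP => /= w0; move/eqP: P0; apply.
have e : w = fun x => 0 * w x.
  by apply/funext => x; rewrite mul0r; apply/eqP; apply: contra_notT (w0 x).
have p0 : p != 0 by have p2 := hp; rewrite gt_eqF//; lra.
have eN := EN_scale a h00 hlow hup 0 lw; have eG := EG_scale 0 lw.
have eD := ED_scale halpha hp (lexx (0 : R)) lw.
rewrite -e in eN; rewrite -e in eG; rewrite -e in eD.
rewrite powR0// in eD.
have -> : EN w = 0 by rewrite eN; ring.
have -> : EG w = 0 by rewrite eG; ring.
have -> : ED w = 0 by rewrite eD; ring.
by rewrite /fibre_F; ring.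
Qed.

Variables (U : set_system nat) (UU : UltraFilter U).
Variables (u_ : nat -> Z3 -> R) (u : Z3 -> R) (A Ni Di M1 : R).
Hypothesis NMu : forall n, NM (u_ n).
Hypothesis cu : forall x, u_ n x @[n --> U] --> u x.
Hypothesis lu : l2 u.
Hypothesis cN : EN (u_ n) @[n --> U] --> Ni.
Hypothesis cG : EG (u_ n) @[n --> U] --> A.
Hypothesis cD : ED (u_ n) @[n --> U] --> Di.
Hypothesis cJ : J (u_ n) @[n --> U] --> level.
Hypothesis Ni0 : 0 < Ni.
Hypothesis dM : forall n, zsum (fun x => `|dens p (u_ n) x|) <= M1.

Lemma Nehari_u n : [/\ l2 (u_ n), (exists x, u_ n x != 0) & nehari_F a b alpha p h (u_ n) = 0].
Proof. by apply/(NehariP a b halpha hp h00 hlow hup); exact: NMu. Qed.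

Lemma lu_ n : l2 (u_ n).
Proof. by have [] := Nehari_u n. Qed.

Lemma dens_cvg x : dens p (u_ n) x @[n --> U] --> dens p u x.
Proof. by apply: cvg_npow => //; exact: cu. Qed.

Lemma weak_dens (w : Z3 -> R) (C : R) : (forall x, `|w x| <= C) -> vanishing w ->
  zsum (fun x => w x * dens p (u_ n) x) @[n --> U] --> zsum (fun x => w x * dens p u x).
Proof.
move=> wC wv; apply: (weak_cvg_zsum _ wC wv dens_cvg _ dM).
- by move=> n; apply: dens_summable => //; exact: lu_.
- exact: dens_summable.
Qed.

Lemma conv_cvg z : conv (dens p (u_ n)) z @[n --> U] --> conv (dens p u) z.
Proof.
have [r0 _ Kr] := Ralpha_bounded halpha.
exact: (weak_dens (Kr z) (Ralpha_vanishing halpha z)).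
Qed.

Lemma limit_Nehari : Di = Ni + b * A ^+ 2.
Proof.
have c : EN (u_ n) + b * EG (u_ n) ^+ 2 @[n --> U] --> Ni + b * A ^+ 2.
  by apply: cvgD => //; apply: cvgMr; exact: cvgX.
rewrite -(cvg_lim _ cD)// -(cvg_lim _ c)//; congr (lim (_ @ U)).
apply/funext => n; have [_ _] := Nehari_u n.
by move=> /eqP; rewrite /nehari_F subr_eq0 => /eqP.
Qed.

Lemma limit_level : level = Phi 1 Ni A Di.
Proof.
have c : Phi 1 (EN (u_ n)) (EG (u_ n)) (ED (u_ n)) @[n --> U] --> Phi 1 Ni A Di.
  by apply: (@Phi_cvg _ b p _ _ _ (fun=> 1)) => //; exact: cvg_cst.
rewrite -(cvg_lim _ cJ)// -(cvg_lim _ c)//; congr (lim (_ @ U)).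
apply/funext => n; rewrite JE /fibre_J powR1.
by move: (EN _) (EG _) (ED _) => N G D; ring.
Qed.

Variable z : Z3.
Let L := Lap u z.
Let v := u z.
Let C := conv (dens p u) z.

(* Moving [u_n] along [delta_z] and rescaling back to the Nehari manifold cannot
   bring the energy below [level]; this survives the limit. *)
Lemma limit_bump (sg : R) (e : R) : 0 < e -> e < 1 -> exists st : R * R,
  [/\ 0 < st.1, st.1 <= e, `|st.2 - 1| <= e, 0 <= st.2 &
   level <= Phi st.2 (qN z Ni L v (sg * st.1)) (bump_G z A L (sg * st.1)) (qD z Di C v (sg * st.1))].
Proof.
move=> e0 e1.
have LN := limit_Nehari.
have P1 : 0 < Psi (1 - e) Ni A Di.
  by rewrite LN; apply: Psi_gt0 => //; lra.
have P2 : Psi (1 + e) Ni A Di < 0.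
  by rewrite LN; apply: Psi_lt0 => //; lra.
have cs : sg * s @[s --> 0^'+] --> 0.
  have c : sg * s @[s --> 0^'+] --> sg * 0.
    apply: cvgMr; apply: cvg_at_right_filter; exact: cvg_id.
  by rewrite mulr0 in c.
have cP t : Psi t (qN z Ni L v (sg * s)) (bump_G z A L (sg * s)) (qD z Di C v (sg * s))
    @[s --> 0^'+] --> Psi t Ni A Di.
  rewrite -[X in Psi _ X _ _](qN0 a h z Ni L v) -[X in Psi _ _ X _](qG0 z A L).
  rewrite -[X in Psi _ _ _ X](qD0 alpha p z Di C v).
  apply: (@Psi_cvg _ b p _ _ _ (fun=> t)); try exact: cvg_cst.
  - by apply: qN_cvg => //; exact: cvg_cst.
  - by apply: qG_cvg => //; exact: cvg_cst.
  - by apply: qD_cvg => //; exact: cvg_cst.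
have [s [s0 se Ps1 Ps2]] : exists s, [/\ 0 < s, s <= e,
    0 < Psi (1 - e) (qN z Ni L v (sg * s)) (bump_G z A L (sg * s)) (qD z Di C v (sg * s)) &
    Psi (1 + e) (qN z Ni L v (sg * s)) (bump_G z A L (sg * s)) (qD z Di C v (sg * s)) < 0].
  have n1 : \forall s \near 0^'+,
      0 < Psi (1 - e) (qN z Ni L v (sg * s)) (bump_G z A L (sg * s)) (qD z Di C v (sg * s)).
    exact: (cvgr_gt _ (cP (1 - e)) _ P1).
  have n2 : \forall s \near 0^'+,
      Psi (1 + e) (qN z Ni L v (sg * s)) (bump_G z A L (sg * s)) (qD z Di C v (sg * s)) < 0.
    exact: (cvgr_lt _ (cP (1 + e)) _ P2).
  have n3 : \forall s \near 0^'+, s <= e by exact: nbhs_right_le.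
  have n4 : \forall s \near 0^'+, 0 < s :> R by exact: nbhs_right_gt.
  have FR : Filter (0^'+ : set_system R) by exact: _.
  have nn := @filterI _ _ FR _ _ (@filterI _ _ FR _ _ n1 n2) (@filterI _ _ FR _ _ n3 n4).
  have [s [[? ?] [? ?]]] := @filter_ex _ _ (at_right_proper_filter _) _ nn.
  by exists s.
pose w n := bump z (u_ n) (sg * s).
have lw n : l2 (w n) by apply: bump_l2; exact: lu_.
have ss : (fun _ : nat => sg * s : R) n @[n --> U] --> (sg * s : R) by exact: cvg_cst.
have cL : Lap (u_ n) z @[n --> U] --> L by exact: Lap_cvg.
have cv : u_ n z @[n --> U] --> v by exact: cu.
have cC : conv (dens p (u_ n)) z @[n --> U] --> C by exact: conv_cvg.
have wN : EN (w n) @[n --> U] --> qN z Ni L v (sg * s).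
  rewrite (_ : (fun n => EN (w n)) = fun n => qN z (EN (u_ n)) (Lap (u_ n) z) (u_ n z) (sg * s)).
    exact: qN_cvg.
  by apply/funext => n; rewrite (EN_bump a h00 hlow hup)//; exact: lu_.
have wG : EG (w n) @[n --> U] --> bump_G z A L (sg * s).
  rewrite (_ : (fun n => EG (w n)) = fun n => bump_G z (EG (u_ n)) (Lap (u_ n) z) (sg * s)).
    exact: qG_cvg.
  by apply/funext => n; rewrite EG_bump//; exact: lu_.
have wD : ED (w n) @[n --> U] --> qD z Di C v (sg * s).
  rewrite (_ : (fun n => ED (w n)) =
     fun n => qD z (ED (u_ n)) (conv (dens p (u_ n)) z) (u_ n z) (sg * s)).
    exact: qD_cvg.
  by apply/funext => n; rewrite (ED_bump halpha hp)//; exact: lu_.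
have wP t : Psi t (EN (w n)) (EG (w n)) (ED (w n)) @[n --> U] -->
    Psi t (qN z Ni L v (sg * s)) (bump_G z A L (sg * s)) (qD z Di C v (sg * s)).
  by apply: (@Psi_cvg _ b p _ _ _ (fun=> t)) => //; exact: cvg_cst.
(* For almost every [n] along [U] the sign change of the limit is inherited by [w n], so its ray
   meets the manifold at some factor between 1 - e and 1 + e; outside these [n] the factor is set to
   1. *)
pose good n := 0 < Psi (1 - e) (EN (w n)) (EG (w n)) (ED (w n)) /\
  Psi (1 + e) (EN (w n)) (EG (w n)) (ED (w n)) < 0.
have gU : \forall n \near U, good n.
  by apply: filterI; [exact: (cvgr_gt _ (wP (1 - e)) _ Ps1)|exact: (cvgr_lt _ (wP (1 + e)) _ Ps2)].
have tn n : exists t, 1 - e <= t <= 1 + e /\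
    (good n -> level <= Phi t (EN (w n)) (EG (w n)) (ED (w n))).
  have [[g1 g2]|ng] := pselect (good n); last first.
    by exists 1; split => //; apply/andP; split; lra.
  have wz : exists x, w n x != 0 by apply: (Psi_nonzero (lw n) (t := 1 - e)); rewrite gt_eqF.
  have e1' : 0 < 1 - e by lra.
  have ee : 1 - e <= 1 + e by lra.
  have [t tI NMt] := Nehari_ivt halpha hp h00 hlow hup (lw n) wz e1' ee (ltW g1) (ltW g2).
  exists t; split => // _.
  have t0 : 0 <= t by move: tI => /andP[? _]; lra.
  rewrite -(J_scale a b halpha hp h00 hlow hup t0 (lw n)).
  exact: (level_le ha hb halpha hp h00 hlow hup).
have [t_ ht] := choice tn.
have tb n : `|t_ n| <= 2.
  by have [/andP[? ?] _] := ht n; rewrite ler_norml; apply/andP; split; lra.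
have [t ct] := ultra_bounded UU tb.
have tge : 1 - e <= t.
  by apply: cvg_ge_near ct _; apply: nearW => n; have [/andP[]] := ht n.
have tle : t <= 1 + e.
  have ct' : 2 - t_ n @[n --> U] --> 2 - t by apply: cvgB => //; exact: cvg_cst.
  have : 1 - e <= 2 - t.
    by apply: cvg_ge_near ct' _; apply: nearW => n; have [/andP[? ?] _] := ht n; lra.
  lra.
exists (s, t); split => //=.
- by rewrite ler_norml; apply/andP; split; lra.
- lra.
have cT : t_ n `^ p @[n --> U] --> t `^ p.
  have c : `|t_ n| `^ p @[n --> U] --> `|t| `^ p by apply: cvg_npow.
  rewrite (ger0_norm (_ : 0 <= t)) in c; last lra.
  apply: cvg_trans c; apply: near_eq_cvg; apply: nearW => n.
  by rewrite ger0_norm//; have [/andP[? _] _] := ht n; lra.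
have cF : Phi (t_ n) (EN (w n)) (EG (w n)) (ED (w n)) @[n --> U] -->
    Phi t (qN z Ni L v (sg * s)) (bump_G z A L (sg * s)) (qD z Di C v (sg * s)).
  exact: Phi_cvg.
apply: cvg_ge_near cF _.
by apply: filterS gU => n gn; have [_] := ht n; apply.
Qed.

(** Since t = 1 maximises the fibre energy of the limit scalars, [Phi t Ni A Di <= level], and
    [level] is at most the varied fibre energy at the same t. The difference is nonnegative; divided
    by the step it tends to sg times the residual as the step tends to 0 and t to 1. *)
Lemma EL_sign (sg : R) : sg != 0 -> 0 <= sg * EL a b alpha p h A u z.
Proof.
move=> sg0; have p2 := hp.
(* The index starts at 2 because [limit_bump] requires a tolerance strictly below 1. *)
have e01 n : 0 < (n.+2%:R^-1 : R) /\ (n.+2%:R^-1 : R) < 1.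
  by split; [rewrite invr_gt0 ltr0n|rewrite invf_lt1 ?ltr0n// ltr1n].
have he n := limit_bump sg (e01 n).1 (e01 n).2.
have [st hst] := choice he.
have e0 : (n.+2%:R^-1 : R) @[n --> \oo] --> 0.
  by have := @cvg_harmonic R; rewrite -cvg_shiftS.
pose s_ n := (st n).1; pose t_ n := (st n).2; pose r_ n := sg * s_ n.
have cs : s_ n @[n --> \oo] --> (0 : R).
  apply: cvg_of_le e0 => n; have [? ? _ _ _] := hst n.
  by rewrite subr0 gtr0_norm.
have ct : t_ n @[n --> \oo] --> (1 : R).
  by apply: cvg_of_le e0 => n; have [_ _ ? _ _] := hst n.
have cr : r_ n @[n --> \oo] --> (0 : R).
  have c : r_ n @[n --> \oo] --> sg * 0 by exact: cvgMr.
  by rewrite mulr0 in c.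
have r0 n : r_ n != 0 by rewrite mulf_neq0// gt_eqF//; have [] := hst n.
pose phi y := p * (`|y| `^ (p - 2) * y).
pose q_ n := dens_incr p v (r_ n) / r_ n.
have cvr : v + r_ n @[n --> \oo] --> v.
  have c : v + r_ n @[n --> \oo] --> v + 0 by apply: cvgD => //; exact: cvg_cst.
  by rewrite addr0 in c.
have p20 : 0 < p - 2 by lra.
have cphi : phi (v + r_ n) @[n --> \oo] --> phi v.
  apply: cvgMr; apply: cvgM => //.
  apply: (@continuous_cvg _ _ _ _ _ (fun n => v + r_ n) (fun x : R => `|x| `^ (p - 2))) cvr.
  exact: norm_powR_continuous.
have cq : q_ n @[n --> \oo] --> phi v.
  apply: (@cvg_of_le _ (fun n => `|phi (v + r_ n) - phi v|)).
    move=> n; have dt := dens_incr_tangent hp v (r_ n).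
    have rn : 0 < `|r_ n| by rewrite normr_gt0.
    rewrite -(ler_pM2r rn) -normrM mulrBl /q_ divfK//.
  have c : `|phi (v + r_ n) - phi v| @[n --> \oo] --> `|phi v - phi v|.
    by apply: cvg_norm; apply: cvgB => //; exact: cvg_cst.
  by rewrite subrr normr0 in c.
have cdd : dens_incr p v (r_ n) @[n --> \oo] --> (0 : R).
  have c : dens_incr p v (r_ n) @[n --> \oo] --> dens_incr p v 0.
    by apply: dens_incr_cvg => //; exact: cvg_cst.
  by rewrite /dens_incr addr0 subrr in c.
have cT : t_ n `^ p @[n --> \oo] --> (1 : R).
  have c : `|t_ n| `^ p @[n --> \oo] --> `|1 : R| `^ p by apply: cvg_npow.
  rewrite normr1 powR1 in c; apply: cvg_trans c; apply: near_eq_cvg; apply: nearW => n.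
  by rewrite ger0_norm//; have [] := hst n.
pose gd := EG (zdelta R z); pose k0 := Ralpha alpha z z.
(* The quotient by [r_ n] of the varied minus the unvaried fibre energy at [t_ n]; the gradient part
   is factored as a difference of two squares. *)
pose E_ n := t_ n ^+ 2 / 2 * (2 * h z * v - 2 * a * L + r_ n * (a * gd + h z))
  + b / 4 * t_ n ^+ 4 * ((- 2 * L + r_ n * gd) * (2 * A - 2 * r_ n * L + r_ n ^+ 2 * gd))
  - (2 * p)^-1 * (t_ n `^ p) ^+ 2 * (2 * q_ n * C + q_ n * dens_incr p v (r_ n) * k0).
have cE : E_ n @[n --> \oo] --> (1 : R) ^+ 2 / 2 * (2 * h z * v - 2 * a * L + 0 * (a * gd + h z))
  + b / 4 * 1 ^+ 4 * ((- 2 * L + 0 * gd) * (2 * A - 2 * 0 * L + 0 ^+ 2 * gd))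
  - (2 * p)^-1 * 1 ^+ 2 * (2 * phi v * C + phi v * 0 * k0).
  apply: cvgB.
    apply: cvgD.
      apply: cvgM; first by apply: cvgMl; exact: cvgX.
      by apply: cvgD; [exact: cvg_cst|exact: cvgMl].
    apply: cvgM; first by apply: cvgMr; exact: cvgX.
    apply: cvgM; first by apply: cvgD; [exact: cvg_cst|exact: cvgMl].
    apply: cvgD; last by apply: cvgMl; exact: cvgX.
    by apply: cvgB; [exact: cvg_cst|apply: cvgMl; exact: cvgMr].
  apply: cvgM; first by apply: cvgMr; exact: cvgX.
  apply: cvgD; first by apply: cvgMl; exact: cvgMr.
  by apply: cvgMl; exact: cvgM.
have EE : EL a b alpha p h A u z = 1 ^+ 2 / 2 * (2 * h z * v - 2 * a * L + 0 * (a * gd + h z))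
  + b / 4 * 1 ^+ 4 * ((- 2 * L + 0 * gd) * (2 * A - 2 * 0 * L + 0 ^+ 2 * gd))
  - (2 * p)^-1 * 1 ^+ 2 * (2 * phi v * C + phi v * 0 * k0).
  rewrite /EL /phi -/L -/v -/C; field; rewrite gt_eqF//; lra.
have csE : sg * E_ n @[n --> \oo] --> sg * EL a b alpha p h A u z.
  by rewrite EE; apply: cvgMr; exact: cE.
rewrite -(cvg_lim _ csE)//; apply: limr_ge.
  by apply/cvg_ex; eexists; exact: csE.
apply: nearW => n.
have [sn0 _ _ tn0 le] := hst n.
have := Phi_le hb hp A (ltW Ni0) tn0; rewrite -limit_Nehari -limit_level => le2.
have le3 := le_trans le2 le.
rewrite -(pmulr_rge0 _ sn0).
have -> : (st n).1 * (sg * E_ n) =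
  Phi (st n).2 (qN z Ni L v (sg * (st n).1)) (bump_G z A L (sg * (st n).1))
    (qD z Di C v (sg * (st n).1)) - Phi (st n).2 Ni A Di.
  have ddq : dens_incr p v (sg * (st n).1) = q_ n * (sg * (st n).1) by rewrite /q_ divfK.
  rewrite /E_ /fibre_J /bump_N /bump_G /bump_D -/gd -/k0 -/(r_ n) -/(s_ n) -/(t_ n) -?/(r_ n).
  have -> : dens_incr p v (r_ n) = q_ n * r_ n by exact: ddq.
  rewrite /r_.
  move: (q_ n) (s_ n) (t_ n `^ p) (t_ n) => q s T t.
  by field; rewrite gt_eqF//; lra.
by rewrite subr_ge0.
Qed.

Lemma EL_zero : EL a b alpha p h A u z = 0.
Proof.
have h1' := EL_sign (oner_neq0 R).
have h2' : 0 <= -1 * EL a b alpha p h A u z by apply: EL_sign; rewrite oppr_eq0 oner_eq0.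
by apply/eqP; rewrite eq_le; apply/andP; split; lra.
Qed.

End LimitEquation.

(** * Existence of a ground state *)

Section GroundState.
Variables (R : realType) (a b alpha p : R) (h : Z3 -> R) (h0 h1 : R) (tau : int).
Hypothesis ha : 0 < a.
Hypothesis hb : 0 < b.
Hypothesis halpha : 0 < alpha < 3.
Hypothesis hp : 2 < p.
Hypothesis h00 : 0 < h0.
Hypothesis hlow : forall x, h0 <= h x.
Hypothesis hup : forall x, h x <= h1.
Hypothesis htau : tau != 0.
Hypothesis hper : forall (x : Z3) (j : 'I_3), h (Zshift x j tau) = h x.
Local Notation conv := (Rconv alpha).
Local Notation NM := (Nehari a b alpha p h).
Local Notation EN := (energy_N a h).
Local Notation ED := (energy_D alpha p).
Local Notation EF := (nehari_F a b alpha p h).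
Local Notation J := (Jfun a b alpha p h).
Local Notation level := (ground_level a b alpha p h).

Lemma NM_P w : NM w <-> [/\ l2 w, (exists x, w x != 0) & EF w = 0].
Proof. exact: (NehariP a b halpha hp h00 hlow hup). Qed.

Lemma minimizing_sequence : exists Q : seq Z3, exists2 s : R, 0 < s &
  exists w : nat -> Z3 -> R, forall n,
    [/\ NM (w n), J (w n) < level + n.+1%:R^-1 & exists2 y, y \in Q & s <= `|w n y|].
Proof.
have l0 := level_ge0 ha hb halpha hp h00 hlow hup.
(* On the manifold N / 4 <= J, so J < level + 1 bounds [EN] by this number. *)
have E0 : 0 < 4 * (level + 1) by lra.
have [s s0 hs] := Nehari_nonvanishing ha hb halpha hp h00 hlow hup E0.
have [Q hQ] := fundamental_domain htau.
suff H n : exists w : Z3 -> R,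
    [/\ NM w, J w < level + n.+1%:R^-1 & exists2 y, y \in Q & s <= `|w y|].
  by have [w hw] := choice H; exists Q, s => //; exists w.
have n0 : 0 < (n.+1%:R^-1 : R) by rewrite invr_gt0 ltr0n.
have [_ [v NMv <-] Jv] := inf_adherent n0 (level_has_inf ha hb halpha hp h00 hlow hup).
have /NM_P[lv [x vx] Fv] := NMv.
have NE : EN v <= 4 * (level + 1).
  have n1 : (n.+1%:R^-1 : R) <= 1 by rewrite invf_le1 ?ltr0n// ler1n.
  have JE := J_EF a b alpha h hp v; rewrite Fv mulr0 add0r in JE.
  have kD : 0 <= kap p * ED v.
    by apply: mulr_ge0; [exact: ltW (kap_gt0 hp)|exact: ED_ge0].
  have Jl : J v < level + 1 by apply: lt_le_trans Jv _; rewrite lerD2l.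
  by rewrite JE in Jl; lra.
have [y sy] := hs v NMv NE.
have [q [y' [y'Q yy']]] := hQ y.
exists (fun x => v (tshift tau q x)); split.
- apply/NM_P; split; first exact: l2_reindex (tshift_bij tau q) lv.
  + exists (tshift tau (- q.1.1, - q.1.2, - q.2) x).
    have -> : tshift tau q (tshift tau (- q.1.1, - q.1.2, - q.2) x) = x; last exact: vx.
    by case: (x) => [[x1 x2] x3]; rewrite /tshift /= !mulNr !subrK.
  + rewrite /nehari_F (EN_tshift a hper) EG_tshift ED_tshift; exact: Fv.
- rewrite JE (EN_tshift a hper) EG_tshift ED_tshift -JE; exact: Jv.
- by exists y' => //; rewrite -yy'.
Qed.

Theorem ground_state : exists u : Z3 -> R, [/\ l2 u,
  forall x, EL a b alpha p h (EG u) u x = 0 & J u = level].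
Proof.
have [Q [s s0 [w hw]]] := minimizing_sequence.
have p2 := hp; have l0 := level_ge0 ha hb halpha hp h00 hlow hup.
(* [U] refines the filter at infinity, so the ordinary limit of the energies is also their limit
   along [U]. *)
have [U [UU oU]] := ultraFilterLemma eventually_filter.
have NMw n : NM (w n) by have [] := hw n.
have lw n : l2 (w n) by have /NM_P[] := NMw n.
have Fw n : EF (w n) = 0 by have /NM_P[] := NMw n.
have Jw n : J (w n) = 4^-1 * EN (w n) + kap p * ED (w n).
  by rewrite (J_EF a b alpha h hp) Fw mulr0 add0r.
pose E := 4 * (level + 1).
have k0 := kap_gt0 hp.
have NE n : EN (w n) <= E.
  have n1 : (n.+1%:R^-1 : R) <= 1 by rewrite invf_le1 ?ltr0n// ler1n.
  have kD : 0 <= kap p * ED (w n) by apply: mulr_ge0; [exact: ltW|exact: ED_ge0].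
  have Jl : J (w n) < level + 1.
    by have [_ Jn _] := hw n; apply: lt_le_trans Jn _; rewrite lerD2l.
  by rewrite Jw in Jl; rewrite /E; lra.
have N0 n : 0 <= EN (w n) by exact: (EN_ge0 ha h00 hlow hup (lw n)).
have E0 : 0 <= E by rewrite /E; lra.
pose Z := E / h0; have Z0 : 0 <= Z by apply: divr_ge0 => //; exact: ltW.
have wZ n : zsum (fun x => w n x ^+ 2) <= Z.
  rewrite ler_pdivlMr// mulrC; exact: le_trans (EN_ge ha h00 hlow hup (lw n)) (NE n).
(* A sup bound needs Z <= M^2 for the bound [Z] on the square sums, and M = Z + 1 satisfies this
   without square roots. *)
have wM n x : `|w n x| <= Z + 1.
  apply: l2_bounded_by => //; first by rewrite addr_ge0.
  apply: le_trans (wZ n) _; rewrite sqrrD expr1n mulr1; have := sqr_ge0 Z; lra.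
have [u cu] : exists u : Z3 -> R, forall x, w n x @[n --> U] --> u x.
  suff H (x : Z3) : exists y : R, w n x @[n --> U] --> y by have [u hu] := choice H; exists u.
  exact: (ultra_bounded UU (fun n => wM n x)).
have lu : l2 u.
  have [] // := @fatou_zsum R U _ (fun n x => w n x ^+ 2) (fun x => u x ^+ 2) (fun=> Z) Z.
  - by move=> x; apply: cvgX; exact: cu.
  - by move=> n x; exact: sqr_ge0.
  - exact: cvg_cst.
have [z uz] : exists z, u z != 0.
  apply/not_existsP => /= u0.
  have uu0 x : u x = 0 by apply/eqP; apply: contra_notT (u0 x).
  (* The site of size [s] may change with [n]; summing over the finite [Q] bounds below
     independently of which site it is. *)
  have c : \sum_(y <- Q) `|w n y| @[n --> U] --> \sum_(y <- Q) `|u y|.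
    by apply: cvg_sumseq => y; apply: cvg_norm; exact: cu.
  have : s <= \sum_(y <- Q) `|u y|.
    apply: cvg_ge_near c _; apply: nearW => n; have [_ _ [y yQ sy]] := hw n.
    by apply: le_trans sy _; rewrite (big_rem y)//= lerDl sumr_ge0.
  rewrite big1; last by move=> y _; rewrite uu0 normr0.
  by rewrite leNgt s0.
have [Ni cN] : exists l : R, EN (w n) @[n --> U] --> l.
  by apply: (@ultra_bounded _ _ _ _ E) => n; rewrite ger0_norm.
have G0 n : 0 <= EG (w n) by exact: EG_ge0.
have GZ n : EG (w n) <= 12 * Z.
  by apply: le_trans (zsum_gradsq_le (lw n)) _; rewrite ler_wpM2l.
have [A cG] : exists l : R, EG (w n) @[n --> U] --> l.
  by apply: (@ultra_bounded _ _ _ _ (12 * Z)) => n; rewrite ger0_norm.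
have DE n : ED (w n) = EN (w n) + b * EG (w n) ^+ 2.
  by have /eqP := Fw n; rewrite /nehari_F subr_eq0 => /eqP.
have cD : ED (w n) @[n --> U] --> Ni + b * A ^+ 2.
  rewrite (_ : (fun n => ED (w n)) = fun n => EN (w n) + b * EG (w n) ^+ 2).
    by apply: cvgD => //; apply: cvgMr; exact: cvgX.
  by apply/funext => n; exact: DE.
set Di := Ni + b * A ^+ 2 in cD.
have cJ0 : J (w n) @[n --> \oo] --> level.
  apply: cvg_of_le (@cvg_harmonic R) => n; have [_ Jn _] := hw n.
  have := level_le ha hb halpha hp h00 hlow hup (NMw n).
  rewrite /= => Jl; rewrite ger0_norm ?subr_ge0// lerBlDl; exact: ltW.
have cJ : J (w n) @[n --> U] --> level by move=> V /cJ0; exact: oU.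
have Ni0 : 0 < Ni.
  apply: (@lt_le_trans _ _ (h0 * s ^+ 2)); first by rewrite mulr_gt0 ?exprn_gt0.
  apply: cvg_ge_near cN _; apply: nearW => n; have [_ _ [y _ sy]] := hw n.
  apply: le_trans (EN_ge1 ha h00 hlow hup y (lw n)); apply: ler_wpM2l; first exact: ltW.
  rewrite -[w n y ^+ 2]real_normK ?num_real//; apply: lerXn2r => //; rewrite ?nnegrE//.
  exact: ltW.
pose M1 := (Z + 1) `^ (p - 2) * Z.
have dM n : zsum (fun x => `|dens p (w n) x|) <= M1.
  apply: (@le_trans _ _ ((Z + 1) `^ (p - 2) * zsum (fun x => w n x ^+ 2))).
    rewrite -zsumZ; last exact: lw.
    apply: le_zsum => [||x]; first by apply: zsummable_abs; exact: dens_summable.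
      by apply: zsummableZ; exact: lw.
    by rewrite ger0_norm ?dens_ge0//; exact: powR_le_sqr.
  by apply: ler_wpM2l; [exact: powR_ge0|exact: wZ].
have EL0 x : EL a b alpha p h A u x = 0.
  exact: (EL_zero ha hb halpha hp h00 hlow hup UU NMw cu lu cN cG cD cJ Ni0 dM x).
have F0 : EN u + b * A * EG u - ED u = 0.
  rewrite -(EL_self a b halpha hp h00 hlow hup A lu) -(@zsum0 R).
  by apply: eq_zsum => x; rewrite EL0 mul0r.
have GA : EG u <= A.
  have [] // := @fatou_zsum R U _ (fun n => gradsq (w n)) (gradsq u) (fun n => EG (w n)) A.
  - by move=> x; exact: gradsq_cvg.
  - by move=> n x; exact: gradsq_ge0.
  - by move=> n; exact: gradsq_summable.
have NN : EN u <= Ni.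
  have hN (v : Z3 -> R) : l2 v -> zsummable (fun x => a * gradsq v x + h x * v x ^+ 2).
    move=> lv; apply: zsummableD; last exact: (l2_weight h00 hlow hup lv).
    by apply: zsummableZ; exact: gradsq_summable.
  have [] // := @fatou_zsum R U _ (fun n x => a * gradsq (w n) x + h x * w n x ^+ 2)
    (fun x => a * gradsq u x + h x * u x ^+ 2) (fun n => EN (w n)) Ni.
  - move=> x; apply: cvgD; apply: cvgMr; first exact: gradsq_cvg.
    by apply: cvgX; exact: cu.
  - move=> n x; apply: addr_ge0; apply: mulr_ge0; rewrite ?gradsq_ge0 ?sqr_ge0//; first exact: ltW.
    exact: le_trans (ltW h00) (hlow x).
  - by move=> n; exact: hN.
have sd := dens_summable hp lu.
have sdw n := dens_summable hp (lw n).
(* The form is nonnegative on the difference of the densities of [w n] and [u]. The cross term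
   converges to [ED u], since the convolution of the density of [u] vanishes at infinity, which
   leaves 0 <= Di - ED u. *)
have DD : ED u <= Di.
  have [r0 r00 cb] := conv_bound halpha.
  have c : zsum (fun x => conv (dens p u) x * dens p (w n) x) @[n --> U] --> ED u.
    apply: (@weak_dens R a b alpha p h h0 h1 halpha hp h00 hlow hup U UU w u M1 NMw cu lu dM
      (conv (dens p u)) (r0 * zsum (fun y => `|dens p u y|))).
    - by move=> x; exact: cb.
    - exact: conv_vanishing.
  have c2 : ED (w n) - 2 * zsum (fun x => conv (dens p u) x * dens p (w n) x) + ED u @[n --> U] -->
      Di - 2 * ED u + ED u.
    by apply: cvgD; [apply: cvgB => //; exact: cvgMr|exact: cvg_cst].
  have : 0 <= Di - 2 * ED u + ED u.
    apply: cvg_ge_near c2 _; apply: nearW => n.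
    have s1 := zsummableN sd.
    have s1' : zsummable (fun x => -1 * dens p u x) by exact: zsummableZ.
    have := bil_ge0 halpha (zsummableD (sdw n) s1').
    have ss := zsummableD (sdw n) s1'.
    rewrite (bilDl halpha (sdw n) s1' ss) (bilDr halpha (sdw n) s1' (sdw n)).
    rewrite (bilDr halpha (sdw n) s1' s1').
    rewrite (bilZr halpha _ (sdw n) sd) (bilZl halpha _ sd (sdw n)).
    rewrite (bilZr halpha _ s1' sd) (bilZl halpha _ sd sd) (bilC halpha (sdw n) sd).
    rewrite -/(ED (w n)) -/(ED u) /kform; lra.
  lra.
have G00 : 0 <= EG u by exact: EG_ge0.
(* Replacing [A] by the smaller [EG u] in the tested limit equation [F0] can only lower the left
   side. *)
have Fu : EF u <= 0.
  have h2 : b * EG u ^+ 2 <= b * A * EG u.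
    by rewrite expr2 mulrA; apply: ler_wpM2r => //; apply: ler_wpM2l => //; exact: ltW.
  by rewrite /nehari_F; lra.
have Nu0 := EN_gt0 ha h00 hlow hup lu uz.
have Du0 := ED_ge0 halpha hp lu.
have lev : level = 4^-1 * Ni + kap p * Di.
  have c : J (w n) @[n --> U] --> 4^-1 * Ni + kap p * Di.
    rewrite (_ : (fun n => J (w n)) = fun n => 4^-1 * EN (w n) + kap p * ED (w n)).
      by apply: cvgD; exact: cvgMr.
    by apply/funext => n; exact: Jw.
  by rewrite -(cvg_lim _ cJ)// -(cvg_lim _ c).
have up : 4^-1 * EN u + kap p * ED u <= level.
  by rewrite lev; apply: lerD; apply: ler_wpM2l => //; exact: ltW.
have [t /andP[t0 t1] NMt] := Nehari_project ha hb halpha hp h00 hlow hup lu (ex_intro _ z uz) Fu.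
have /NM_P[_ _ Ft] := NMt.
have low := level_le ha hb halpha hp h00 hlow hup NMt.
rewrite (J_EF a b alpha h hp) Ft mulr0 add0r in low.
rewrite (EN_scale a h00 hlow hup t lu) (ED_scale halpha hp (ltW t0) lu) in low.
have tp1 : (t `^ p) ^+ 2 <= 1.
  have tp : t `^ p <= 1.
    by rewrite -[leRHS](powRr0 t); apply: ger_powR; [rewrite t0 t1|lra].
  have tpp := powR_ge0 t p.
  by rewrite expr2 -[leRHS]mulr1; apply: ler_pM.
(* If t < 1, the term in [EN u > 0] drops strictly while the nonlocal one does not grow, so J (t u)
   would fall below [level]. *)
have te : t = 1.
  apply/eqP; rewrite eq_le t1 leNgt; apply/negP => tlt.
  have t21 : t ^+ 2 < 1 by rewrite exprn_ilt1// ltW.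
  have b1 : t ^+ 2 * EN u < EN u by rewrite gtr_pMl.
  have b2 : kap p * ((t `^ p) ^+ 2 * ED u) <= kap p * ED u.
    by apply: ler_wpM2l; [exact: ltW|rewrite ler_piMl].
  lra.
have u1 : (fun x => t * u x) = u by apply/funext => x; rewrite te mul1r.
rewrite u1 in NMt Ft.
have Ju : J u = level.
  apply/eqP; rewrite eq_le (level_le ha hb halpha hp h00 hlow hup NMt) andbT.
  by rewrite (J_EF a b alpha h hp) Ft mulr0 add0r.
exists u; split => // x.
(* Comparing [F0] with the Nehari identity gives b A EG = b EG^2, which identifies [A] unless EG u =
   0; in that case the Laplacian vanishes and the coefficient multiplies 0. *)
have [Gz|Gn] := eqVneq (EG u) 0.
  have Lz : Lap u x = 0.
    apply: Lap_gradsq0; apply: (@zsum_eq0 R (gradsq u)) => // [|y].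
    - exact: gradsq_summable.
    - exact: gradsq_ge0.
  by rewrite -[RHS](EL0 x) /EL Lz; ring.
have -> : EG u = A; last exact: EL0.
apply: (mulfI Gn); apply: (mulfI (lt0r_neq0 hb)).
move: Ft; rewrite /nehari_F; lra.
Qed.

End GroundState.

Theorem theorem1p1 (R : realType) (a b alpha p : R) (h : Z3 -> R)
  (ha : 0 < a) (hb : 0 < b) (halpha : 0 < alpha < 3) (hp : 2 < p)
  (hlow : exists h0 : R, 0 < h0 /\ forall x, h0 <= h x)
  (hper : exists tau : int, tau != 0 /\
            forall (x : Z3) (j : 'I_3), h (Zshift x j tau) = h x) :
  exists u : Z3 -> R,
    inH h u /\
    (forall phi, inH h phi -> dJ a b alpha p h u phi = 0) /\
    Jfun a b alpha p h u = inf [set Jfun a b alpha p h v | v in Nehari a b alpha p h].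
Proof.
have [h0 [h00 hl]] := hlow; have [tau [tau0 hpe]] := hper.
have [h1 hu] := periodic_bounded tau0 hpe.
have [u [lu EL0 Ju]] := ground_state ha hb halpha hp h00 hl hu tau0 hpe.
exists u; split; first exact/(inHP h00 hl hu).
split; last exact: Ju.
move=> phi /(inHP h00 hl hu) lphi.
rewrite (dJE a b halpha hp h00 hl hu lu lphi) -(@zsum0 R).
by apply: eq_zsum => x; rewrite EL0 mul0r.
Qed.
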